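(* The assignments on objects $r\mapsto V_1$, $b\mapsto k_{-1}$ and on generating morphisms $$\cap_r\mapsto\hat\cap_r,\quad \cup_r\mapsto\hat\cup_r,\quad \cap_b\mapsto\hat\cap_b,\quad \cup_b\mapsto\hat\cup_b,\quad X\mapsto\hat X,\quad Y\mapsto \hat Y$$ extend to an equivalence of $k$-linear monoidal categories $\Phi\colon\mathscr{V}\to\mathcal{V}$.
   Context: The ground field is $k=\mathbb{C}(q)$. $U_q(\mathfrak{sl}_2)$ is the $k$-algebra generated by $E,F,K,K^{-1}$ with $KK^{-1}=1=K^{-1}K$, $KE=q^2EK$, $KF=q^{-2}FK$, $EF-FE=\frac{K-K^{-1}}{q-q^{-1}}$, and comultiplication $\Delta(E)=E\otimes1+K\otimes E$, $\Delta(F)=F\otimes K^{-1}+1\otimes F$, $\Delta(K)=K\otimes K$. $V_1$ has basis $x,y$ with $Ex=0$, $Ey=x$, $Fx=y$, $Fy=0$, $Kx=qx$, $Ky=q^{-1}y$. For $\varepsilon=\pm1$, $k_\varepsilon$ is one-dimensional with basis $1_\varepsilon$, $E,F$ acting by $0$ and $K$ by $\varepsilon$; $k_1$ is the tensor unit. $\mathcal{V}$ is the full monoidal subcategory of $U_q(\mathfrak{sl}_2)$-representations generated by $V_1$ and $k_{-1}$: its objects are all finite tensor products of copies of $V_1$ and $k_{-1}$ (including the empty one, $k_1$), and its morphisms are all $U_q(\mathfrak{sl}_2)$-linear maps. $\mathscr{V}$ is the $k$-linear (strict) monoidal category with unit $\mathbb{1}$ generated by two objects $r$ (''red'') and $b$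 (''blue'') and morphisms $\cap_r\colon r\otimes r\to\mathbb{1}$, $\cup_r\colon\mathbb{1}\to r\otimes r$, $\cap_b\colon b\otimes b\to\mathbb{1}$, $\cup_b\colon\mathbb{1}\to b\otimes b$, $X\colon r\otimes b\to b\otimes r$, $Y\colon b\otimes r\to r\otimes b$, subject to: (1) $X\circ Y=\mathrm{id}_{b\otimes r}$, $Y\circ X=\mathrm{id}_{r\otimes b}$; (2) for $c\in\{r,b\}$: $(\cap_c\otimes\mathrm{id}_c)(\mathrm{id}_c\otimes\cup_c)=\mathrm{id}_c=(\mathrm{id}_c\otimes\cap_c)(\cup_c\otimes\mathrm{id}_c)$; (3) $\cap_r\circ\cup_r=-(q+q^{-1})$, $\cap_b\circ\cup_b=1$; (4) $\cup_b\circ\cap_b=\mathrm{id}_{b\otimes b}$; (5) $(\cap_r\otimes\mathrm{id}_b)(\mathrm{id}_r\otimes Y)=-(\mathrm{id}_b\otimes\cap_r)(X\otimes\mathrm{id}_r)$ as maps $r\otimes b\otimes r\to b$, and $(\cap_b\otimes\mathrm{id}_r)(\mathrm{id}_b\otimes X)=(\mathrm{id}_r\otimes\cap_b)(Y\otimes\mathrm{id}_b)$ as maps $b\otimes r\otimes b\to r$. The $U_q(\mathfrak{sl}_2)$-linear maps $\hat\cap_r\colon V_1\otimes V_1\to k_1$, $\hat\cup_r\colon k_1\to V_1\otimes V_1$, $\hat\cap_b\colon k_{-1}\otimes k_{-1}\to k_1$, $\hat\cup_b\colon k_1\to k_{-1}\otimes k_{-1}$, $\hat X\colon V_1\otimes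 k_{-1}\to k_{-1}\otimes V_1$, $\hat Y\colon k_{-1}\otimes V_1\to V_1\otimes k_{-1}$ are: $\hat\cap_r(x\otimes x)=\hat\cap_r(y\otimes y)=0$, $\hat\cap_r(x\otimes y)=-q^{-1}1_1$, $\hat\cap_r(y\otimes x)=1_1$; $\hat\cup_r(1_1)=x\otimes y-q\,y\otimes x$; $\hat\cap_b(1_{-1}\otimes1_{-1})=1_1$; $\hat\cup_b(1_1)=1_{-1}\otimes1_{-1}$; $\hat X(x\otimes1_{-1})=1_{-1}\otimes x$, $\hat X(y\otimes1_{-1})=-1_{-1}\otimes y$; $\hat Y(1_{-1}\otimes x)=x\otimes1_{-1}$, $\hat Y(1_{-1}\otimes y)=-y\otimes1_{-1}$. *)

(* Defs.v *)
From HB Require Import structures.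
From mathcomp Require Import all_boot all_order all_algebra.
From mathcomp Require Import generic_quotient fraction complex.
From mathcomp Require Import boolp reals ring.

Set Implicit Arguments.
Unset Strict Implicit.
Unset Printing Implicit Defensive.

Import GRing.Theory.
Local Open Scope ring_scope.
Local Open Scope quotient_scope.

Declare Scope cat_scope.
Delimit Scope cat_scope with cat.
Local Open Scope cat_scope.

Section LinearCategories.
Variable k : fieldType.

Record linCat := LinCat {
  ob :> Type;
  hom : ob -> ob -> lmodType k;
  idm : forall a, hom a a;
  comp : forall a b c, hom b c -> hom a b -> hom a c;
  compA : forall a b c d (h : hom c d) (g : hom b c) (f : hom a b),
    comp h (comp g f) = comp (comp h g) f;
  comp1m : forall a b (f : hom a b), comp (idm b) f = f;
  compm1 : forall a b (f : hom a b), comp f (idm a) = f;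
  comp_linear_l : forall a b c (f : hom a b),
    linear (fun g : hom b c => comp g f);
  comp_linear_r : forall a b c (g : hom b c),
    linear (fun f : hom a b => comp g f) }.

End LinearCategories.

Arguments idm {k l} a.
Arguments comp {k l a b c} g f.
Notation "g ∘ f" := (comp g f) (at level 40, left associativity) : cat_scope.

Section Iso.
Variables (k : fieldType) (C : linCat k).

Definition is_iso (a b : C) (f : hom a b) : Prop :=
  exists g : hom b a, g ∘ f = idm a /\ f ∘ g = idm b.

(* the identity of [a], read as a morphism to the (equal) object [b] *)
Definition eqhom (a b : C) (e : a = b) : hom a b :=
  match e in _ = b' return hom a b' with erefl => idm a end.

End Iso.

Section LinearMonoidalCategories.
Variable k : fieldType.

Record linMonCat := LinMonCat {
  lcat :> linCat k;
  tunit : lcat;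
  tens : lcat -> lcat -> lcat;
  tensm : forall a b c d : lcat,
    hom a b -> hom c d -> hom (tens a c) (tens b d);
  tensm_linear_l : forall (a b c d : lcat) (g : hom c d),
    linear (fun f : hom a b => tensm f g);
  tensm_linear_r : forall (a b c d : lcat) (f : hom a b),
    linear (fun g : hom c d => tensm f g);
  tensm_id : forall a b : lcat, tensm (idm a) (idm b) = idm (tens a b);
  tensm_comp : forall (a b c a' b' c' : lcat) (g : hom b c) (f : hom a b)
      (g' : hom b' c') (f' : hom a' b'),
    tensm (g ∘ f) (g' ∘ f') = tensm g g' ∘ tensm f f';
  assoc : forall a b c : lcat, hom (tens (tens a b) c) (tens a (tens b c));
  assoc_iso : forall a b c : lcat, is_iso (assoc a b c);
  assoc_nat : forall (a b c a' b' c' : lcat)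
      (f : hom a a') (g : hom b b') (h : hom c c'),
    assoc a' b' c' ∘ tensm (tensm f g) h = tensm f (tensm g h) ∘ assoc a b c;
  lunit : forall a : lcat, hom (tens tunit a) a;
  lunit_iso : forall a : lcat, is_iso (lunit a);
  lunit_nat : forall (a b : lcat) (f : hom a b),
    lunit b ∘ tensm (idm tunit) f = f ∘ lunit a;
  runit : forall a : lcat, hom (tens a tunit) a;
  runit_iso : forall a : lcat, is_iso (runit a);
  runit_nat : forall (a b : lcat) (f : hom a b),
    runit b ∘ tensm f (idm tunit) = f ∘ runit a;
  pentagon : forall a b c d : lcat,
    assoc a b (tens c d) ∘ assoc (tens a b) c d =
    tensm (idm a) (assoc b c d) ∘ assoc a (tens b c) d
      ∘ tensm (assoc a b c) (idm d);
  triangle : forall a b : lcat,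
    tensm (idm a) (lunit b) ∘ assoc a tunit b = tensm (runit a) (idm b) }.

End LinearMonoidalCategories.

Arguments tunit {k} l.
Arguments tens {k l} a b.
Arguments tensm {k l a b c d} f g.
Arguments assoc {k l} a b c.
Arguments lunit {k l} a.
Arguments runit {k l} a.
Notation "f ⊗ g" := (tensm f g) (at level 35, right associativity) : cat_scope.

Section Functors.
Variable k : fieldType.

Record linFunctor (C D : linCat k) := LinFunctor {
  fob :> C -> D;
  fmap : forall a b : C, hom a b -> hom (fob a) (fob b);
  fmap_linear : forall a b : C, linear (@fmap a b);
  fmap_id : forall a : C, fmap (idm a) = idm (fob a);
  fmap_comp : forall (a b c : C) (g : hom b c) (f : hom a b),
    fmap (g ∘ f) = fmap g ∘ fmap f }.

End Functors.

Arguments fmap {k C D} l {a b} f.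

Section Equivalences.
Variable k : fieldType.

Definition idFunctor (C : linCat k) : linFunctor C C :=
  @LinFunctor k C C id (fun _ _ f => f) (fun _ _ _ _ _ => erefl)
    (fun _ => erefl) (fun _ _ _ _ _ => erefl).

Section Compose.
Variables (A B C : linCat k) (G : linFunctor B C) (F : linFunctor A B).

Lemma compFunctor_linear (a b : A) :
  linear (fun f : hom a b => fmap G (fmap F f)).
Proof. by move=> t f g; rewrite !fmap_linear. Qed.

Lemma compFunctor_id (a : A) : fmap G (fmap F (idm a)) = idm (G (F a)).
Proof. by rewrite !fmap_id. Qed.

Lemma compFunctor_comp (a b c : A) (g : hom b c) (f : hom a b) :
  fmap G (fmap F (g ∘ f)) = fmap G (fmap F g) ∘ fmap G (fmap F f).
Proof. by rewrite !fmap_comp. Qed.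

Definition compFunctor : linFunctor A C :=
  LinFunctor compFunctor_linear compFunctor_id compFunctor_comp.

End Compose.

Definition nat_isomorphic (C D : linCat k) (F G : linFunctor C D) : Prop :=
  exists t : forall a : C, hom (F a) (G a),
    (forall a, is_iso (t a)) /\
    (forall (a b : C) (f : hom a b), t b ∘ fmap F f = fmap G f ∘ t a).

(* applied to a monoidal functor through [mfun]: a monoidal equivalence is a
   monoidal functor whose underlying functor is an equivalence *)
Definition is_equivalence (C D : linCat k) (F : linFunctor C D) : Prop :=
  exists G : linFunctor D C,
    nat_isomorphic (compFunctor G F) (idFunctor C) /\
    nat_isomorphic (compFunctor F G) (idFunctor D).

(* strong monoidal functors: the structure maps [mu] and [eps] are invertible *)
Record linMonFunctor (C D : linMonCat k) := LinMonFunctor {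
  mfun :> linFunctor C D;
  mu : forall a b : C, hom (tens (mfun a) (mfun b)) (mfun (tens a b));
  mu_iso : forall a b : C, is_iso (mu a b);
  mu_nat : forall (a b a' b' : C) (f : hom a a') (g : hom b b'),
    mu a' b' ∘ (fmap mfun f ⊗ fmap mfun g) = fmap mfun (f ⊗ g) ∘ mu a b;
  eps : hom (tunit D) (mfun (tunit C));
  eps_iso : is_iso eps;
  mu_assoc : forall a b c : C,
    fmap mfun (assoc a b c) ∘ mu (tens a b) c ∘ (mu a b ⊗ idm (mfun c)) =
    mu a (tens b c) ∘ (idm (mfun a) ⊗ mu b c)
      ∘ assoc (mfun a) (mfun b) (mfun c);
  mu_lunit : forall a : C,
    fmap mfun (lunit a) ∘ mu (tunit C) a ∘ (eps ⊗ idm (mfun a)) =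
    lunit (mfun a);
  mu_runit : forall a : C,
    fmap mfun (runit a) ∘ mu a (tunit C) ∘ (idm (mfun a) ⊗ eps) =
    runit (mfun a) }.

End Equivalences.

Arguments mu {k C D} l a b.
Arguments eps {k C D} l.

Section FullSubcategory.
Variables (k : fieldType) (C : linMonCat k) (P : C -> Prop).
Hypothesis P_unit : P (tunit C).
Hypothesis P_tens : forall a b : C, P a -> P b -> P (tens a b).

Definition fullCat : linCat k :=
  @LinCat k {a : C | P a} (fun a b => hom (sval a) (sval b))
    (fun a => idm (sval a)) (fun a b c g f => g ∘ f)
    (fun a b c d h g f => compA h g f)
    (fun a b f => comp1m f) (fun a b f => compm1 f)
    (fun a b c f => comp_linear_l f) (fun a b c g => comp_linear_r g).

Definition fullTens (a b : fullCat) : fullCat :=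
  exist _ (tens (sval a) (sval b)) (P_tens (svalP a) (svalP b)).

Lemma full_iso (a b : fullCat) (f : @hom k C (sval a) (sval b)) :
  is_iso f -> @is_iso k fullCat a b f.
Proof. by case=> g gP; exists g. Qed.

Definition fullMonCat : linMonCat k :=
  @LinMonCat k fullCat (exist _ (tunit C) P_unit) fullTens
    (fun a b c d f g => tensm f g)
    (fun a b c d g => tensm_linear_l g) (fun a b c d f => tensm_linear_r f)
    (fun a b => tensm_id (sval a) (sval b))
    (fun a b c a' b' c' g f g' f' => tensm_comp g f g' f')
    (fun a b c => assoc (sval a) (sval b) (sval c))
    (fun a b c => @full_iso (fullTens (fullTens a b) c) (fullTens a (fullTens b c)) _
       (assoc_iso (sval a) (sval b) (sval c)))
    (fun a b c a' b' c' f g h => assoc_nat f g h)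
    (fun a => lunit (sval a))
    (fun a => @full_iso (fullTens (exist _ (tunit C) P_unit) a) a _
      (lunit_iso (sval a)))
    (fun a b f => lunit_nat f)
    (fun a => runit (sval a))
    (fun a => @full_iso (fullTens a (exist _ (tunit C) P_unit)) a _
      (runit_iso (sval a)))
    (fun a b f => runit_nat f)
    (fun a b c d => pentagon (sval a) (sval b) (sval c) (sval d))
    (fun a b => triangle (sval a) (sval b)).

End FullSubcategory.

Inductive color := red | blue.

Section Presentation.
Variables (k : fieldType) (q : k).

Local Notation word := (seq color).
Local Notation r := [:: red].
Local Notation b := [:: blue].

(* Objects are words, with concatenation as tensor product.  Morphisms are
   formal k-linear combinations of composites and tensor products of the
   generators, modulo the congruence [tm_eq] generated by the axioms of k-linear
   strict monoidal categories and the relations on generators (from [te_XY] on).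
   Associativity of the tensor product and the right unit law equate terms of
   different types, hence the casts along [catA] and [cats0]; -f is (-1) f. *)
Inductive tm : word -> word -> Type :=
| tm_id u : tm u u
| tm_comp u v w : tm v w -> tm u v -> tm u w
| tm_tens u v u' v' : tm u v -> tm u' v' -> tm (u ++ u') (v ++ v')
| tm_zero u v : tm u v
| tm_add u v : tm u v -> tm u v -> tm u v
| tm_scale u v : k -> tm u v -> tm u v
| tm_cap c : tm [:: c; c] [::]
| tm_cup c : tm [::] [:: c; c]
| tm_X : tm [:: red; blue] [:: blue; red]
| tm_Y : tm [:: blue; red] [:: red; blue].

Definition tm_cast u u' v v' (eu : u = u') (ev : v = v') (f : tm u v) :
    tm u' v' :=
  match eu in _ = a, ev in _ = c return tm a c with erefl, erefl => f end.

Local Notation id_ := tm_id.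
Local Infix "**" := tm_tens (at level 35).
Local Infix "oo" := tm_comp (at level 40).
Local Infix "⊕" := tm_add (at level 50).
Local Infix "•" := tm_scale (at level 39).

Inductive tm_eq : forall u v, tm u v -> tm u v -> Prop :=
| te_refl u v (f : tm u v) : tm_eq f f
| te_sym u v (f g : tm u v) : tm_eq f g -> tm_eq g f
| te_trans u v (f g h : tm u v) : tm_eq f g -> tm_eq g h -> tm_eq f h
| te_comp u v w (g g' : tm v w) (f f' : tm u v) :
    tm_eq g g' -> tm_eq f f' -> tm_eq (g oo f) (g' oo f')
| te_tens u v u' v' (f g : tm u v) (f' g' : tm u' v') :
    tm_eq f g -> tm_eq f' g' -> tm_eq (f ** f') (g ** g')
| te_add u v (f f' g g' : tm u v) :
    tm_eq f f' -> tm_eq g g' -> tm_eq (f ⊕ g) (f' ⊕ g')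
| te_scale u v t (f f' : tm u v) : tm_eq f f' -> tm_eq (t • f) (t • f')
| te_addA u v (f g h : tm u v) : tm_eq (f ⊕ (g ⊕ h)) ((f ⊕ g) ⊕ h)
| te_addC u v (f g : tm u v) : tm_eq (f ⊕ g) (g ⊕ f)
| te_add0 u v (f : tm u v) : tm_eq (tm_zero u v ⊕ f) f
| te_addN u v (f : tm u v) : tm_eq ((-1 • f) ⊕ f) (tm_zero u v)
| te_scaleA u v s t (f : tm u v) : tm_eq (s • (t • f)) ((s * t) • f)
| te_scale1 u v (f : tm u v) : tm_eq (1 • f) f
| te_scaleDr u v t (f g : tm u v) :
    tm_eq (t • (f ⊕ g)) ((t • f) ⊕ (t • g))
| te_scaleDl u v s t (f : tm u v) :
    tm_eq ((s + t) • f) ((s • f) ⊕ (t • f))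
| te_compA u v w z (h : tm w z) (g : tm v w) (f : tm u v) :
    tm_eq (h oo (g oo f)) ((h oo g) oo f)
| te_comp1m u v (f : tm u v) : tm_eq (id_ v oo f) f
| te_compm1 u v (f : tm u v) : tm_eq (f oo id_ u) f
| te_comp_linl u v w t (g g' : tm v w) (f : tm u v) :
    tm_eq (((t • g) ⊕ g') oo f) ((t • (g oo f)) ⊕ (g' oo f))
| te_comp_linr u v w t (g : tm v w) (f f' : tm u v) :
    tm_eq (g oo ((t • f) ⊕ f')) ((t • (g oo f)) ⊕ (g oo f'))
| te_tens_linl u v u' v' t (f f' : tm u v) (g : tm u' v') :
    tm_eq (((t • f) ⊕ f') ** g) ((t • (f ** g)) ⊕ (f' ** g))
| te_tens_linr u v u' v' t (f : tm u v) (g g' : tm u' v') :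
    tm_eq (f ** ((t • g) ⊕ g')) ((t • (f ** g)) ⊕ (f ** g'))
| te_tens_id u v : tm_eq (id_ u ** id_ v) (id_ (u ++ v))
| te_tens_comp u v w u' v' w' (g : tm v w) (f : tm u v)
    (g' : tm v' w') (f' : tm u' v') :
    tm_eq ((g oo f) ** (g' oo f')) ((g ** g') oo (f ** f'))
| te_tensA u v u' v' u'' v'' (f : tm u v) (g : tm u' v') (h : tm u'' v'') :
    tm_eq (tm_cast (catA u u' u'') (catA v v' v'') (f ** (g ** h)))
          ((f ** g) ** h)
| te_tens1m u v (f : tm u v) : tm_eq (id_ [::] ** f) f
| te_tensm1 u v (f : tm u v) :
    tm_eq (tm_cast (cats0 u) (cats0 v) (f ** id_ [::])) f
| te_XY : tm_eq (tm_X oo tm_Y) (id_ [:: blue; red])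
| te_YX : tm_eq (tm_Y oo tm_X) (id_ [:: red; blue])
| te_zigzag_l c :
    tm_eq ((tm_cap c ** id_ [:: c]) oo (id_ [:: c] ** tm_cup c)) (id_ [:: c])
| te_zigzag_r c :
    tm_eq ((id_ [:: c] ** tm_cap c) oo (tm_cup c ** id_ [:: c])) (id_ [:: c])
| te_circle_red :
    tm_eq (tm_cap red oo tm_cup red) (- (q + q^-1) • id_ [::])
| te_circle_blue : tm_eq (tm_cap blue oo tm_cup blue) (id_ [::])
| te_cupcap_blue : tm_eq (tm_cup blue oo tm_cap blue) (id_ [:: blue; blue])
| te_slide_red :
    tm_eq ((tm_cap red ** id_ b) oo (id_ r ** tm_Y))
          (-1 • ((id_ b ** tm_cap red) oo (tm_X ** id_ r)))
| te_slide_blue :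
    tm_eq ((tm_cap blue ** id_ r) oo (id_ b ** tm_X))
          ((id_ r ** tm_cap blue) oo (tm_Y ** id_ b)).

Section Quotient.
Variables u v : word.

HB.instance Definition _ := gen_eqMixin (tm u v).
HB.instance Definition _ := gen_choiceMixin (tm u v).

Definition tm_eqb : rel (tm u v) := fun f g => `[< tm_eq f g >].

Lemma tm_eqb_equiv : equiv_class_of tm_eqb.
Proof.
split=> [f|f g|g f h]; rewrite /tm_eqb.
- by apply/asboolP; exact: te_refl.
- by apply/asbool_equiv_eq; split; exact: te_sym.
- by move=> /asboolP fg /asboolP gh; apply/asboolP; exact: te_trans fg gh.
Qed.

Canonical tm_eqb_equivRel := EquivRelPack tm_eqb_equiv.

Definition mor := {eq_quot tm_eqb}.
HB.instance Definition _ := EqQuotient.on mor.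
HB.instance Definition _ := Choice.on mor.

Definition cls (f : tm u v) : mor := \pi_mor f.
Definition rep_tm (f : mor) : tm u v := repr f.

Lemma clsP f g : cls f = cls g <-> tm_eq f g.
Proof.
split; first by move/eqmodP/asboolP.
by move=> fg; apply/eqmodP/asboolP.
Qed.

Lemma rep_tmK f : cls (rep_tm f) = f.
Proof. exact: reprK. Qed.

Lemma rep_cls f : tm_eq (rep_tm (cls f)) f.
Proof. by apply/clsP; rewrite rep_tmK. Qed.

Definition mor_add (f g : mor) := cls (tm_add (rep_tm f) (rep_tm g)).
Definition mor_opp (f : mor) := cls (tm_scale (-1) (rep_tm f)).
Definition mor_scale t (f : mor) := cls (tm_scale t (rep_tm f)).

Lemma cls_add f g : mor_add (cls f) (cls g) = cls (tm_add f g).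
Proof. by apply/clsP/te_add; exact: rep_cls. Qed.

Lemma cls_scale t f : mor_scale t (cls f) = cls (tm_scale t f).
Proof. by apply/clsP/te_scale; exact: rep_cls. Qed.

Lemma mor_addA : associative mor_add.
Proof.
move=> f g h; rewrite -(rep_tmK f) -(rep_tmK g) -(rep_tmK h) !cls_add.
exact/clsP/te_addA.
Qed.

Lemma mor_addC : commutative mor_add.
Proof. by move=> f g; apply/clsP/te_addC. Qed.

Lemma mor_add0 : left_id (cls (tm_zero u v)) mor_add.
Proof. by move=> f; rewrite -(rep_tmK f) cls_add; apply/clsP/te_add0. Qed.

Lemma mor_addN : left_inverse (cls (tm_zero u v)) mor_opp mor_add.
Proof.
move=> f; rewrite -{2}(rep_tmK f) cls_add.
exact/clsP/te_addN.
Qed.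

HB.instance Definition _ :=
  GRing.isZmodule.Build mor mor_addA mor_addC mor_add0 mor_addN.

Lemma mor_scaleA s t f : mor_scale s (mor_scale t f) = mor_scale (s * t) f.
Proof. by rewrite -(rep_tmK f) !cls_scale; apply/clsP/te_scaleA. Qed.

Lemma mor_scale1 : left_id 1 mor_scale.
Proof. by move=> f; rewrite -(rep_tmK f) cls_scale; apply/clsP/te_scale1. Qed.

Lemma mor_scaleDr : right_distributive mor_scale +%R.
Proof.
move=> t f g; rewrite -(rep_tmK f) -(rep_tmK g).
rewrite [LHS](congr1 _ (cls_add _ _)) !cls_scale [RHS]cls_add.
exact/clsP/te_scaleDr.
Qed.

Lemma mor_scaleDl f : {morph mor_scale^~ f : s t / s + t}.
Proof.
move=> s t /=; rewrite -(rep_tmK f) !cls_scale [RHS]cls_add.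
exact/clsP/te_scaleDl.
Qed.

HB.instance Definition _ := GRing.Zmodule_isLmodule.Build k mor
  mor_scaleA mor_scale1 mor_scaleDr mor_scaleDl.

Lemma clsD f g : cls f + cls g = cls (tm_add f g).
Proof. exact: cls_add. Qed.

Lemma clsZ t f : t *: cls f = cls (tm_scale t f).
Proof. exact: cls_scale. Qed.

End Quotient.

Definition mor_comp u v w (g : mor v w) (f : mor u v) : mor u w :=
  cls (tm_comp (rep_tm g) (rep_tm f)).

Definition mor_tens u v u' v' (f : mor u v) (g : mor u' v') :
    mor (u ++ u') (v ++ v') :=
  cls (tm_tens (rep_tm f) (rep_tm g)).

Lemma cls_comp u v w (g : tm v w) (f : tm u v) :
  mor_comp (cls g) (cls f) = cls (tm_comp g f).
Proof. by apply/clsP/te_comp; exact: rep_cls. Qed.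

Lemma cls_tens u v u' v' (f : tm u v) (g : tm u' v') :
  mor_tens (cls f) (cls g) = cls (tm_tens f g).
Proof. by apply/clsP/te_tens; exact: rep_cls. Qed.

Lemma mor_compA u v w z (h : mor w z) (g : mor v w) (f : mor u v) :
  mor_comp h (mor_comp g f) = mor_comp (mor_comp h g) f.
Proof.
rewrite -(rep_tmK f) -(rep_tmK g) -(rep_tmK h) !cls_comp.
exact/clsP/te_compA.
Qed.

Lemma mor_comp1m u v (f : mor u v) : mor_comp (cls (tm_id v)) f = f.
Proof. by rewrite -(rep_tmK f) cls_comp; apply/clsP/te_comp1m. Qed.

Lemma mor_compm1 u v (f : mor u v) : mor_comp f (cls (tm_id u)) = f.
Proof. by rewrite -(rep_tmK f) cls_comp; apply/clsP/te_compm1. Qed.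

Lemma mor_comp_linl u v w (f : mor u v) :
  linear (fun g : mor v w => mor_comp g f).
Proof.
move=> t g g'; rewrite -(rep_tmK f) -(rep_tmK g) -(rep_tmK g').
rewrite clsZ clsD !cls_comp clsZ clsD.
exact/clsP/te_comp_linl.
Qed.

Lemma mor_comp_linr u v w (g : mor v w) :
  linear (fun f : mor u v => mor_comp g f).
Proof.
move=> t f f'; rewrite -(rep_tmK g) -(rep_tmK f) -(rep_tmK f').
rewrite clsZ clsD !cls_comp clsZ clsD.
exact/clsP/te_comp_linr.
Qed.

Definition presCat : linCat k :=
  LinCat mor_compA mor_comp1m mor_compm1 mor_comp_linl mor_comp_linr.

Lemma mor_tens_linl u v u' v' (g : mor u' v') :
  linear (fun f : mor u v => mor_tens f g).
Proof.
move=> t f f'; rewrite -(rep_tmK g) -(rep_tmK f) -(rep_tmK f').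
rewrite clsZ clsD !cls_tens clsZ clsD.
exact/clsP/te_tens_linl.
Qed.

Lemma mor_tens_linr u v u' v' (f : mor u v) :
  linear (fun g : mor u' v' => mor_tens f g).
Proof.
move=> t g g'; rewrite -(rep_tmK f) -(rep_tmK g) -(rep_tmK g').
rewrite clsZ clsD !cls_tens clsZ clsD.
exact/clsP/te_tens_linr.
Qed.

Lemma mor_tens_id u v :
  mor_tens (cls (tm_id u)) (cls (tm_id v)) = cls (tm_id (u ++ v)).
Proof. by rewrite cls_tens; apply/clsP/te_tens_id. Qed.

Lemma mor_tens_comp u v w u' v' w' (g : mor v w) (f : mor u v)
    (g' : mor v' w') (f' : mor u' v') :
  mor_tens (mor_comp g f) (mor_comp g' f') =
  mor_comp (mor_tens g g') (mor_tens f f').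
Proof.
rewrite -(rep_tmK g) -(rep_tmK f) -(rep_tmK g') -(rep_tmK f').
rewrite !(cls_comp, cls_tens).
exact/clsP/te_tens_comp.
Qed.

Local Notation eqmor e := (@eqhom k presCat _ _ e).

Lemma eqmor_iso u v (e : u = v) : @is_iso k presCat u v (eqmor e).
Proof.
by case: v / e; exists (cls (tm_id u)); split; exact: mor_comp1m.
Qed.

Lemma eqmor_comp u v w (e : u = v) (e' : v = w) :
  mor_comp (eqmor e') (eqmor e) = eqmor (etrans e e').
Proof. by case: w / e'; exact: mor_comp1m. Qed.

Lemma eqmor_tens_l u v w (e : u = v) :
  mor_tens (eqmor e) (cls (tm_id w)) = eqmor (congr1 (fun z => z ++ w) e).
Proof. by case: v / e; exact: mor_tens_id. Qed.

Lemma eqmor_tens_r u v w (e : u = v) :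
  mor_tens (cls (tm_id w)) (eqmor e) = eqmor (congr1 (fun z => w ++ z) e).
Proof. by case: v / e; exact: mor_tens_id. Qed.

Lemma cls_castV u u' v v' (eu : u = u') (ev : v = v') (f : tm u v) :
  mor_comp (eqmor ev) (cls f) = mor_comp (cls (tm_cast eu ev f)) (eqmor eu).
Proof.
case: u' / eu; case: v' / ev => /=.
by rewrite mor_compm1 mor_comp1m.
Qed.

Lemma cls_cast u u' v v' (eu : u = u') (ev : v = v') (f : tm u v) :
  mor_comp (eqmor (esym ev)) (cls (tm_cast eu ev f)) =
  mor_comp (cls f) (eqmor (esym eu)).
Proof.
case: u' / eu; case: v' / ev => /=.
by rewrite mor_compm1 mor_comp1m.
Qed.

(* strictness: the associator and the right unitor are identities, up to the
   equalities [catA] and [cats0] of words; the left unitor is an identity *)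
Definition pres_assoc u v w :
    mor ((u ++ v) ++ w) (u ++ (v ++ w)) :=
  eqmor (esym (catA u v w)).
Definition pres_lunit u : mor ([::] ++ u) u := cls (tm_id u).
Definition pres_runit u : mor (u ++ [::]) u := eqmor (cats0 u).

Lemma pres_assoc_nat u v w u' v' w'
    (f : mor u u') (g : mor v v') (h : mor w w') :
  mor_comp (pres_assoc u' v' w') (mor_tens (mor_tens f g) h) =
  mor_comp (mor_tens f (mor_tens g h)) (pres_assoc u v w).
Proof.
rewrite -(rep_tmK f) -(rep_tmK g) -(rep_tmK h) !cls_tens /pres_assoc.
have /clsP <- := te_tensA (rep_tm f) (rep_tm g) (rep_tm h).
exact: cls_cast.
Qed.

Lemma pres_lunit_nat u v (f : mor u v) :
  mor_comp (pres_lunit v) (mor_tens (cls (tm_id [::])) f) =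
  mor_comp f (pres_lunit u).
Proof.
rewrite mor_comp1m mor_compm1 -(rep_tmK f) cls_tens.
exact/clsP/te_tens1m.
Qed.

Lemma pres_runit_nat u v (f : mor u v) :
  mor_comp (pres_runit v) (mor_tens f (cls (tm_id [::]))) =
  mor_comp f (pres_runit u).
Proof.
rewrite -(rep_tmK f) cls_tens.
have /clsP <- := te_tensm1 (rep_tm f).
exact: cls_castV.
Qed.

Lemma pres_pentagon u v w z :
  mor_comp (pres_assoc u v (w ++ z)) (pres_assoc (u ++ v) w z) =
  mor_comp (mor_comp (mor_tens (cls (tm_id u)) (pres_assoc v w z))
                     (pres_assoc u (v ++ w) z))
           (mor_tens (pres_assoc u v w) (cls (tm_id z))).
Proof.
rewrite /pres_assoc eqmor_tens_l eqmor_tens_r !eqmor_comp.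
by congr (eqmor _); exact: Prop_irrelevance.
Qed.

Lemma pres_triangle u v :
  mor_comp (mor_tens (cls (tm_id u)) (pres_lunit v)) (pres_assoc u [::] v) =
  mor_tens (pres_runit u) (cls (tm_id v)).
Proof.
rewrite /pres_assoc /pres_runit /pres_lunit mor_tens_id eqmor_tens_l.
rewrite [LHS]mor_comp1m.
by congr (eqmor _); exact: Prop_irrelevance.
Qed.

Definition presMonCat : linMonCat k :=
  @LinMonCat k presCat [::] cat (fun _ _ _ _ f g => mor_tens f g)
    (fun _ _ _ _ g => mor_tens_linl g) (fun _ _ _ _ f => mor_tens_linr f)
    mor_tens_id (fun _ _ _ _ _ _ g f g' f' => mor_tens_comp g f g' f')
    pres_assoc (fun u v w => eqmor_iso _) (fun _ _ _ _ _ _ f g h => pres_assoc_nat f g h)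
    pres_lunit (fun u => eqmor_iso (erefl u)) (fun _ _ f => pres_lunit_nat f)
    pres_runit (fun u => eqmor_iso _) (fun _ _ f => pres_runit_nat f)
    pres_pentagon pres_triangle.

End Presentation.

Section BasedSpaces.
Variable k : fieldType.
Implicit Types I J L M N : finType.

Notation sp I := {ffun I -> k^o}.

Definition bvec I (i : I) : sp I := [ffun j => (i == j)%:R].

Lemma sp_decomp I (u : sp I) : u = \sum_i u i *: bvec i.
Proof.
apply/ffunP=> j; rewrite sum_ffunE (bigD1 j) //= !ffunE eqxx [_ *: _]mulr1.
rewrite big1 ?addr0 // => i ij; rewrite !ffunE (negPf ij).
exact: mulr0.
Qed.

Lemma lfun_bvecP I J (f g : 'Hom(sp I, sp J)) :
  (forall i, f (bvec i) = g (bvec i)) -> f = g.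
Proof.
move=> fg; apply/lfunP=> u; rewrite (sp_decomp u) !linear_sum.
by apply: eq_bigr => i _; rewrite !linearZ /= fg.
Qed.

Definition bmap_fun I J (g : I -> sp J) (u : sp I) : sp J :=
  \sum_i u i *: g i.

Lemma bmap_fun_linear I J (g : I -> sp J) : linear (bmap_fun g).
Proof.
move=> t u v; rewrite /bmap_fun scaler_sumr -big_split /=.
by apply: eq_bigr => i _; rewrite !ffunE scalerDl scalerA.
Qed.

HB.instance Definition _ I J (g : I -> sp J) :=
  GRing.isLinear.Build k (sp I) (sp J) _ (bmap_fun g) (bmap_fun_linear g).

(* the linear map sending the basis vector [bvec i] to [g i] *)
Definition bmap I J (g : I -> sp J) : 'Hom(sp I, sp J) :=
  linfun (bmap_fun g).

Lemma bmapE I J (g : I -> sp J) u : bmap g u = \sum_i u i *: g i.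
Proof. by rewrite lfunE. Qed.

Lemma bmap_bvec I J (g : I -> sp J) i : bmap g (bvec i) = g i.
Proof.
rewrite bmapE (bigD1 i) //= !ffunE eqxx scale1r.
rewrite big1 ?addr0 // => j ji; rewrite ffunE eq_sym (negPf ji).
exact: scale0r.
Qed.

Definition tensv I J (u : sp I) (v : sp J) : sp (I * J)%type :=
  [ffun p => u p.1 * v p.2].

Lemma tensvZl I J t (u : sp I) (v : sp J) :
  tensv (t *: u) v = t *: tensv u v.
Proof. by apply/ffunP=> p; rewrite !ffunE -mulrA. Qed.

Lemma tensvZr I J t (u : sp I) (v : sp J) :
  tensv u (t *: v) = t *: tensv u v.
Proof. by apply/ffunP=> p; rewrite !ffunE; exact: mulrCA. Qed.

Lemma tensvDl I J (u u' : sp I) (v : sp J) :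
  tensv (u + u') v = tensv u v + tensv u' v.
Proof. by apply/ffunP=> p; rewrite !ffunE mulrDl. Qed.

Lemma tensvDr I J (u : sp I) (v v' : sp J) :
  tensv u (v + v') = tensv u v + tensv u v'.
Proof. by apply/ffunP=> p; rewrite !ffunE mulrDr. Qed.

Lemma tensv0l I J (v : sp J) : tensv (0 : sp I) v = 0.
Proof. by apply/ffunP=> p; rewrite !ffunE mul0r. Qed.

Lemma tensv0r I J (u : sp I) : tensv u (0 : sp J) = 0.
Proof. by apply/ffunP=> p; rewrite !ffunE mulr0. Qed.

Lemma bvec_pair I J (i : I) (j : J) : bvec (i, j) = tensv (bvec i) (bvec j).
Proof.
apply/ffunP=> -[a b]; rewrite !ffunE xpair_eqE /=.
by case: (i == a); case: (j == b); rewrite ?mulr1 ?mulr0.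
Qed.

Definition tensf I J I' J' (f : 'Hom(sp I, sp J)) (g : 'Hom(sp I', sp J')) :
    'Hom(sp (I * I')%type, sp (J * J')%type) :=
  bmap (fun p => tensv (f (bvec p.1)) (g (bvec p.2))).

Lemma lfun_coord I J (f : 'Hom(sp I, sp J)) u j :
  f u j = \sum_i u i * f (bvec i) j.
Proof.
rewrite {1}(sp_decomp u) linear_sum sum_ffunE.
by apply: eq_bigr => i _; rewrite linearZ !ffunE.
Qed.

Lemma tensfE I J I' J' (f : 'Hom(sp I, sp J)) (g : 'Hom(sp I', sp J')) u v :
  tensf f g (tensv u v) = tensv (f u) (g v).
Proof.
apply/ffunP=> -[a b]; rewrite bmapE sum_ffunE [RHS]ffunE /= !lfun_coord.
rewrite big_distrlr /= pair_bigA /=.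
by apply: eq_bigr => -[i i'] _; rewrite !ffunE /= [_ *: _]mulrACA.
Qed.

Lemma lfun_tensP I J L (f g : 'Hom(sp (I * J)%type, sp L)) :
  (forall u v, f (tensv u v) = g (tensv u v)) -> f = g.
Proof. by move=> fg; apply: lfun_bvecP => -[i j]; rewrite bvec_pair. Qed.

Lemma lfun_tens3P I J L M (f g : 'Hom(sp (I * J * L)%type, sp M)) :
  (forall u v w, f (tensv (tensv u v) w) = g (tensv (tensv u v) w)) -> f = g.
Proof.
by move=> fg; apply: lfun_bvecP => -[[i j] l]; rewrite !bvec_pair.
Qed.

Lemma lfun_tens4P I J L M N (f g : 'Hom(sp (I * J * L * M)%type, sp N)) :
  (forall u v w z, f (tensv (tensv (tensv u v) w) z) =
                   g (tensv (tensv (tensv u v) w) z)) -> f = g.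
Proof.
by move=> fg; apply: lfun_bvecP => -[[[i j] l] m]; rewrite !bvec_pair.
Qed.

Lemma bmap_bij I J (s : I -> J) (s' : J -> I) (sK : cancel s s')
    (s'K : cancel s' s) u j : bmap (fun i => bvec (s i)) u j = u (s' j).
Proof.
rewrite bmapE sum_ffunE (bigD1 (s' j)) //= !ffunE s'K eqxx [_ *: _]mulr1.
rewrite big1 ?addr0 // => i; rewrite !ffunE (can2_eq sK s'K) => /negPf ->.
exact: mulr0.
Qed.

Definition passoc I J L (p : I * J * L) : I * (J * L) :=
  (p.1.1, (p.1.2, p.2)).
Definition passocV I J L (p : I * (J * L)) : I * J * L :=
  (p.1, p.2.1, p.2.2).

Definition tassoc I J L : 'Hom(sp (I * J * L)%type, sp (I * (J * L))%type) :=
  bmap (fun p => bvec (passoc p)).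
Definition tassocV I J L : 'Hom(sp (I * (J * L))%type, sp (I * J * L)%type) :=
  bmap (fun p => bvec (passocV p)).

Lemma tassocE I J L (u : sp I) (v : sp J) (w : sp L) :
  tassoc I J L (tensv (tensv u v) w) = tensv u (tensv v w).
Proof.
apply/ffunP=> -[i [j l]].
rewrite (@bmap_bij _ _ (@passoc I J L) (@passocV I J L)) ?ffunE /= ?mulrA //.
- by case=> [[]].
- by case=> [? []].
Qed.

Lemma tassocVE I J L (u : sp I) (v : sp J) (w : sp L) :
  tassocV I J L (tensv u (tensv v w)) = tensv (tensv u v) w.
Proof.
apply/ffunP=> -[[i j] l].
rewrite (@bmap_bij _ _ (@passocV I J L) (@passoc I J L)) ?ffunE /= ?mulrA //.
- by case=> [? []].
- by case=> [[]].
Qed.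

Definition tlunit I : 'Hom(sp (unit * I)%type, sp I) :=
  bmap (fun p => bvec p.2).
Definition tlunitV I : 'Hom(sp I, sp (unit * I)%type) :=
  bmap (fun i => bvec (tt, i)).
Definition trunit I : 'Hom(sp (I * unit)%type, sp I) :=
  bmap (fun p => bvec p.1).
Definition trunitV I : 'Hom(sp I, sp (I * unit)%type) :=
  bmap (fun i => bvec (i, tt)).

Lemma sp_unit (u : sp unit) : u = u tt *: bvec tt.
Proof. by apply/ffunP=> -[]; rewrite !ffunE eqxx [_ *: _]mulr1. Qed.

Lemma tlunitE I (u : sp unit) (v : sp I) : tlunit I (tensv u v) = u tt *: v.
Proof.
apply/ffunP=> i; rewrite (@bmap_bij _ _ snd (pair tt)) ?ffunE //.
by case=> [[]].
Qed.

Lemma tlunitVE I (v : sp I) : tlunitV I v = tensv (bvec tt) v.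
Proof.
apply/ffunP=> -[[] i]; rewrite (@bmap_bij _ _ (pair tt) snd) ?ffunE ?mul1r //.
by case=> [[]].
Qed.

Lemma trunitE I (u : sp unit) (v : sp I) : trunit I (tensv v u) = u tt *: v.
Proof.
apply/ffunP=> i; rewrite (@bmap_bij _ _ fst (fun i => (i, tt))) ?ffunE //.
  exact: mulrC.
by case=> [? []].
Qed.

Lemma trunitVE I (v : sp I) : trunitV I v = tensv v (bvec tt).
Proof.
apply/ffunP=> -[i []].
rewrite (@bmap_bij _ _ (fun i => (i, tt)) fst) ?ffunE ?mulr1 //.
by case=> [? []].
Qed.

End BasedSpaces.

Notation sp k I := {ffun I -> k^o}.

Inductive Ugen := gE | gF | gK | gKi.

Section Representations.
Variables (k : fieldType) (q : k).

Local Notation sp I := (sp k I).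

(* A module over the algebra presented by E, F, K, K^-1 is a vector space with
   four operators satisfying the defining relations.  The vector space is
   k^idx: all tensor products of V_1 and k_{-1} come with a finite basis, that
   of a tensor product being the product of the bases. *)
Record rep := Rep {
  idx : finType;
  op : Ugen -> 'End(sp idx);
  op_KKi : (op gK \o op gKi)%VF = \1%VF;
  op_KiK : (op gKi \o op gK)%VF = \1%VF;
  op_KE : (op gK \o op gE)%VF = q ^+ 2 *: (op gE \o op gK)%VF;
  op_KF : (op gK \o op gF)%VF = q ^- 2 *: (op gF \o op gK)%VF;
  op_EF : (op gE \o op gF)%VF - (op gF \o op gE)%VF =
          (q - q^-1)^-1 *: (op gK - op gKi) }.

Implicit Types V W : rep.

Definition Ulinear V W : {pred 'Hom(sp (idx V), sp (idx W))} :=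
  fun f => `[< forall g, (f \o op V g)%VF = (op W g \o f)%VF >].

Arguments Ulinear : clear implicits.

Lemma UlinearP V W (f : 'Hom(sp (idx V), sp (idx W))) :
  reflect (forall g u, f (op V g u) = op W g (f u)) (f \in Ulinear V W).
Proof.
apply: (iffP (asboolP _)) => [H g u|H g].
  by have /lfunP/(_ u) := H g; rewrite !comp_lfunE.
by apply/lfunP=> u; rewrite !comp_lfunE.
Qed.

Lemma Ulinear_submod V W : submod_closed (Ulinear V W).
Proof.
split=> [|t f f' /UlinearP fP /UlinearP f'P]; apply/UlinearP=> g u.
  by rewrite !zero_lfunE linear0.
by rewrite !add_lfunE !scale_lfunE fP f'P linearP.
Qed.

HB.instance Definition _ V W :=
  GRing.isSubmodClosed.Build k 'Hom(sp (idx V), sp (idx W)) (Ulinear V W)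
    (Ulinear_submod V W).

Record rhom V W := RHom {
  rmap :> 'Hom(sp (idx V), sp (idx W));
  rmapP : rmap \in Ulinear V W }.

Section RHomLmodule.
Variables V W : rep.
HB.instance Definition _ := [isSub for @rmap V W].
HB.instance Definition _ := [Choice of rhom V W by <:].
HB.instance Definition _ := [SubChoice_isSubZmodule of rhom V W by <:].
HB.instance Definition _ := [SubZmodule_isSubLmodule of rhom V W by <:].
End RHomLmodule.

Lemma rhomP V W (f g : rhom V W) : (forall u, f u = g u) -> f = g.
Proof. by move=> fg; apply/val_inj/lfunP. Qed.

Lemma rhomU V W (f : rhom V W) g u : f (op V g u) = op W g (f u).
Proof. by have /UlinearP := rmapP f. Qed.

Lemma rhomLE V W t (f g : rhom V W) u : (t *: f + g) u = t *: f u + g u.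
Proof. by rewrite /= add_lfunE scale_lfunE. Qed.

Lemma rid_subproof V : \1%VF \in Ulinear V V.
Proof. by apply/UlinearP=> g u; rewrite !id_lfunE. Qed.
Definition rid V : rhom V V := RHom (rid_subproof V).

Lemma rcomp_subproof V W Z (g : rhom W Z) (f : rhom V W) :
  (g \o f)%VF \in Ulinear V Z.
Proof. by apply/UlinearP=> x u; rewrite !comp_lfunE !rhomU. Qed.
Definition rcomp V W Z (g : rhom W Z) (f : rhom V W) : rhom V Z :=
  RHom (rcomp_subproof g f).

Lemma rcompA V W Y Z (h : rhom Y Z) (g : rhom W Y) (f : rhom V W) :
  rcomp h (rcomp g f) = rcomp (rcomp h g) f.
Proof. by apply: rhomP => u; rewrite !comp_lfunE. Qed.

Lemma rcomp1m V W (f : rhom V W) : rcomp (rid W) f = f.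
Proof. by apply: rhomP => u; rewrite comp_lfunE id_lfunE. Qed.

Lemma rcompm1 V W (f : rhom V W) : rcomp f (rid V) = f.
Proof. by apply: rhomP => u; rewrite comp_lfunE id_lfunE. Qed.

Lemma rcomp_linl V W Z (f : rhom V W) :
  linear (fun g : rhom W Z => rcomp g f).
Proof.
by move=> t g g'; apply: rhomP => u; rewrite rhomLE !comp_lfunE rhomLE.
Qed.

Lemma rcomp_linr V W Z (g : rhom W Z) :
  linear (fun f : rhom V W => rcomp g f).
Proof.
by move=> t f f'; apply: rhomP => u; rewrite rhomLE !comp_lfunE rhomLE linearP.
Qed.

Definition repCat : linCat k :=
  LinCat rcompA rcomp1m rcompm1 rcomp_linl rcomp_linr.

Hypothesis q_neq0 : q != 0.
Hypothesis q_sq : q - q^-1 != 0.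

(* Delta(E) = E (x) 1 + K (x) E, Delta(F) = F (x) K^-1 + 1 (x) F,
   Delta(K) = K (x) K, hence Delta(K^-1) = K^-1 (x) K^-1 *)
Definition tens_op V W (g : Ugen) :
    'End(sp (idx V * idx W)%type) :=
  match g with
  | gE => tensf (op V gE) \1 + tensf (op V gK) (op W gE)
  | gF => tensf (op V gF) (op W gKi) + tensf \1 (op W gF)
  | gK => tensf (op V gK) (op W gK)
  | gKi => tensf (op V gKi) (op W gKi)
  end.

Let opKKi V u : op V gK (op V gKi u) = u.
Proof. by rewrite -comp_lfunE op_KKi id_lfunE. Qed.
Let opKiK V u : op V gKi (op V gK u) = u.
Proof. by rewrite -comp_lfunE op_KiK id_lfunE. Qed.
Let opKE V u : op V gK (op V gE u) = q ^+ 2 *: op V gE (op V gK u).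
Proof. by rewrite -!comp_lfunE op_KE scale_lfunE. Qed.
Let opKF V u : op V gK (op V gF u) = q ^- 2 *: op V gF (op V gK u).
Proof. by rewrite -!comp_lfunE op_KF scale_lfunE. Qed.
Let opEF V u : op V gE (op V gF u) =
  op V gF (op V gE u) + (q - q^-1)^-1 *: (op V gK u - op V gKi u).
Proof.
have /lfunP/(_ u) := op_EF V.
rewrite !(add_lfunE, opp_lfunE, scale_lfunE, comp_lfunE) => <-.
by rewrite addrC subrK.
Qed.
Let opEKi V u : op V gE (op V gKi u) = q ^+ 2 *: op V gKi (op V gE u).
Proof.
rewrite -[u in RHS](opKKi u) -[in LHS](opKiK (op V gE _)) opKE.
by rewrite linearZ.
Qed.

Section TensorRep.
Variables V W : rep.
Let T := tens_op V W.

Let opsE := (add_lfunE, opp_lfunE, scale_lfunE, comp_lfunE, id_lfunE, tensfE).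

Lemma tens_op_KKi : (T gK \o T gKi)%VF = \1%VF.
Proof. by apply: lfun_tensP => u v; rewrite !opsE !opKKi. Qed.

Lemma tens_op_KiK : (T gKi \o T gK)%VF = \1%VF.
Proof. by apply: lfun_tensP => u v; rewrite !opsE !opKiK. Qed.

Lemma tens_op_KE : (T gK \o T gE)%VF = q ^+ 2 *: (T gE \o T gK)%VF.
Proof.
apply: lfun_tensP => u v; rewrite /= !opsE linearD /= !opsE.
by rewrite !opKE tensvZl tensvZr scalerDr.
Qed.

Lemma tens_op_KF : (T gK \o T gF)%VF = q ^- 2 *: (T gF \o T gK)%VF.
Proof.
apply: lfun_tensP => u v; rewrite /= !opsE linearD /= !opsE.
by rewrite !opKF !opKiK !opKKi tensvZl tensvZr scalerDr.
Qed.

Lemma tens_op_EF : (T gE \o T gF)%VF - (T gF \o T gE)%VF =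
  (q - q^-1)^-1 *: (T gK - T gKi).
Proof.
apply: lfun_tensP => u v; rewrite /= !opsE !linearD /= !opsE.
rewrite !opEF !tensvDl !tensvDr !tensvZl !tensvZr.
rewrite !opKF opEKi tensvZl tensvZr scalerA mulVf ?expf_neq0 // scale1r.
apply/ffunP=> p; rewrite !ffunE /= /GRing.scale /=; ring.
Qed.

Definition tens_rep : rep :=
  Rep tens_op_KKi tens_op_KiK tens_op_KE tens_op_KF tens_op_EF.

End TensorRep.

Lemma tensf_Ulinear V W V' W' (f : rhom V W) (g : rhom V' W') :
  tensf f g \in Ulinear (tens_rep V V') (tens_rep W W').
Proof.
suff H x : (tensf f g \o tens_op V V' x = tens_op W W' x \o tensf f g)%VF.
  by apply/asboolP.
apply: lfun_tensP => u v; rewrite !comp_lfunE.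
by case: x; rewrite /= !(add_lfunE, tensfE, linearD, id_lfunE) /= ?tensfE
  ?rhomU ?id_lfunE.
Qed.
Definition rtens V W V' W' (f : rhom V W) (g : rhom V' W') :
    rhom (tens_rep V V') (tens_rep W W') := RHom (tensf_Ulinear f g).

(* for s = false, true: the one-dimensional representations k_1 and k_{-1} *)
Definition sgn_op (s : bool) (g : Ugen) : 'End(sp unit) :=
  match g with
  | gE | gF => 0
  | gK | gKi => (-1) ^+ s *: \1%VF
  end.

Section SignRep.
Variable s : bool.

Lemma sgn_op_KKi : (sgn_op s gK \o sgn_op s gKi)%VF = \1%VF.
Proof.
apply/lfunP=> u; rewrite comp_lfunE !scale_lfunE !id_lfunE scalerA.
by rewrite -signr_addb addbb scale1r.
Qed.

Lemma sgn_op_KE : (sgn_op s gK \o sgn_op s gE)%VF =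
  q ^+ 2 *: (sgn_op s gE \o sgn_op s gK)%VF.
Proof. by rewrite comp_lfun0l comp_lfun0r scaler0. Qed.

Lemma sgn_op_KF : (sgn_op s gK \o sgn_op s gF)%VF =
  q ^- 2 *: (sgn_op s gF \o sgn_op s gK)%VF.
Proof. by rewrite comp_lfun0l comp_lfun0r scaler0. Qed.

Lemma sgn_op_EF : (sgn_op s gE \o sgn_op s gF)%VF -
  (sgn_op s gF \o sgn_op s gE)%VF =
  (q - q^-1)^-1 *: (sgn_op s gK - sgn_op s gKi).
Proof. by rewrite !subrr scaler0. Qed.

Definition sgn_rep : rep :=
  Rep sgn_op_KKi sgn_op_KKi sgn_op_KE sgn_op_KF sgn_op_EF.

End SignRep.

Local Notation kone := (sgn_rep false).
Local Notation kmone := (sgn_rep true).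

Lemma tassoc_Ulinear V W Z : tassoc k (idx V) (idx W) (idx Z) \in
  Ulinear (tens_rep (tens_rep V W) Z) (tens_rep V (tens_rep W Z)).
Proof.
suff H x : (tassoc k (idx V) (idx W) (idx Z) \o
    tens_op (tens_rep V W) Z x =
    tens_op V (tens_rep W Z) x \o tassoc k (idx V) (idx W) (idx Z))%VF.
  by apply/asboolP.
apply: lfun_tens3P => u v w; rewrite !comp_lfunE tassocE.
case: x; rewrite /= !(add_lfunE, tensfE, tensvDl, tensvDr, linearD,
  id_lfunE) /= !tassocE ?addrA //.
Qed.
Definition rassoc V W Z :
    rhom (tens_rep (tens_rep V W) Z) (tens_rep V (tens_rep W Z)) :=
  RHom (tassoc_Ulinear V W Z).

Lemma Ulinear_inv V W (f : rhom V W)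
    (g : 'Hom(sp (idx W), sp (idx V))) :
  cancel f g -> cancel g f -> @is_iso k repCat V W f.
Proof.
move=> fK gK'.
have gP : g \in Ulinear W V.
  by apply/UlinearP=> x u; rewrite -{1}(gK' u) -rhomU fK.
exists (RHom gP); split; apply: rhomP => u;
  by rewrite comp_lfunE id_lfunE ?fK ?gK'.
Qed.

Lemma rassoc_iso V W Z : @is_iso k repCat _ _ (rassoc V W Z).
Proof.
apply: (@Ulinear_inv _ _ (rassoc V W Z) (tassocV k (idx V) (idx W) (idx Z))).
  move=> u; rewrite -comp_lfunE -[RHS]id_lfunE; congr (fun_of_lfun _ u).
  by apply: lfun_tens3P => *; rewrite comp_lfunE id_lfunE tassocE tassocVE.
move=> u; rewrite -comp_lfunE -[RHS]id_lfunE; congr (fun_of_lfun _ u).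
apply: lfun_bvecP => -[i [j l]]; rewrite !bvec_pair comp_lfunE id_lfunE.
by rewrite tassocVE tassocE.
Qed.

Lemma tlunit_Ulinear V : tlunit k (idx V) \in Ulinear (tens_rep kone V) V.
Proof.
suff H x : (tlunit k (idx V) \o tens_op kone V x =
    op V x \o tlunit k (idx V))%VF by apply/asboolP.
apply: lfun_tensP => u v; rewrite !comp_lfunE tlunitE.
by case: x; rewrite /= !(add_lfunE, tensfE, linearD, id_lfunE, zero_lfunE,
  scale_lfunE, expr0, scale1r) /= !(tlunitE, ffunE, scale0r, add0r, linearZ).
Qed.
Definition rlunit V : rhom (tens_rep kone V) V := RHom (tlunit_Ulinear V).

Lemma trunit_Ulinear V : trunit k (idx V) \in Ulinear (tens_rep V kone) V.
Proof.
suff H x : (trunit k (idx V) \o tens_op V kone x =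
    op V x \o trunit k (idx V))%VF by apply/asboolP.
apply: lfun_tensP => u v; rewrite !comp_lfunE trunitE.
by case: x; rewrite /= !(add_lfunE, tensfE, linearD, id_lfunE, zero_lfunE,
  scale_lfunE, expr0, scale1r) /= !(trunitE, ffunE, scale0r, addr0, linearZ).
Qed.
Definition rrunit V : rhom (tens_rep V kone) V := RHom (trunit_Ulinear V).

Lemma rlunit_iso V : @is_iso k repCat _ _ (rlunit V).
Proof.
apply: (@Ulinear_inv _ _ (rlunit V) (tlunitV k (idx V))) => u; last first.
  by rewrite tlunitVE tlunitE !ffunE scale1r.
rewrite -comp_lfunE -[RHS]id_lfunE; congr (fun_of_lfun _ u).
apply: lfun_tensP => {}u v; rewrite comp_lfunE id_lfunE tlunitE tlunitVE.
by rewrite tensvZr -tensvZl -sp_unit.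
Qed.

Lemma rrunit_iso V : @is_iso k repCat _ _ (rrunit V).
Proof.
apply: (@Ulinear_inv _ _ (rrunit V) (trunitV k (idx V))) => u; last first.
  by rewrite trunitVE trunitE !ffunE scale1r.
rewrite -comp_lfunE -[RHS]id_lfunE; congr (fun_of_lfun _ u).
apply: lfun_tensP => {}u v; rewrite comp_lfunE id_lfunE trunitE trunitVE.
by rewrite tensvZl -tensvZr -sp_unit.
Qed.

Lemma rhom_eqP V W (f g : rhom V W) :
  rmap f = rmap g -> f = g.
Proof. exact: val_inj. Qed.

Lemma rtens_linl V W V' W' (g : rhom V' W') :
  linear (fun f : rhom V W => rtens f g).
Proof.
move=> t f f'; apply: rhom_eqP; apply: lfun_tensP => u v /=.
by rewrite !(add_lfunE, scale_lfunE, tensfE) tensvDl tensvZl.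
Qed.

Lemma rtens_linr V W V' W' (f : rhom V W) :
  linear (fun g : rhom V' W' => rtens f g).
Proof.
move=> t g g'; apply: rhom_eqP; apply: lfun_tensP => u v /=.
by rewrite !(add_lfunE, scale_lfunE, tensfE) tensvDr tensvZr.
Qed.

Lemma rtens_id V W : rtens (rid V) (rid W) = rid (tens_rep V W).
Proof.
by apply: rhom_eqP; apply: lfun_tensP => u v /=; rewrite tensfE !id_lfunE.
Qed.

Lemma rtens_comp V W Z V' W' Z' (g : rhom W Z) (f : rhom V W)
    (g' : rhom W' Z') (f' : rhom V' W') :
  rtens (rcomp g f) (rcomp g' f') = rcomp (rtens g g') (rtens f f').
Proof.
apply: rhom_eqP; apply: lfun_tensP => u v /=.
by rewrite !(comp_lfunE, tensfE).
Qed.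

Lemma rassoc_nat V W Z V' W' Z'
    (f : rhom V V') (g : rhom W W') (h : rhom Z Z') :
  rcomp (rassoc V' W' Z') (rtens (rtens f g) h) =
  rcomp (rtens f (rtens g h)) (rassoc V W Z).
Proof.
apply: rhom_eqP; apply: lfun_tens3P => u v w /=.
by rewrite !(comp_lfunE, tensfE, tassocE).
Qed.

Lemma rlunit_nat V W (f : rhom V W) :
  rcomp (rlunit W) (rtens (rid kone) f) = rcomp f (rlunit V).
Proof.
apply: rhom_eqP; apply: lfun_tensP => u v /=.
by rewrite !(comp_lfunE, tensfE, tlunitE, id_lfunE) linearZ.
Qed.

Lemma rrunit_nat V W (f : rhom V W) :
  rcomp (rrunit W) (rtens f (rid kone)) = rcomp f (rrunit V).
Proof.
apply: rhom_eqP; apply: lfun_tensP => u v /=.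
by rewrite !(comp_lfunE, tensfE, trunitE, id_lfunE) linearZ.
Qed.

Lemma rpentagon V W Y Z :
  rcomp (rassoc V W (tens_rep Y Z)) (rassoc (tens_rep V W) Y Z) =
  rcomp (rcomp (rtens (rid V) (rassoc W Y Z)) (rassoc V (tens_rep W Y) Z))
        (rtens (rassoc V W Y) (rid Z)).
Proof.
apply: rhom_eqP; apply: lfun_tens4P => u v w z /=.
by rewrite !(comp_lfunE, tensfE, tassocE, id_lfunE).
Qed.

Lemma rtriangle V W :
  rcomp (rtens (rid V) (rlunit W)) (rassoc V kone W) =
  rtens (rrunit V) (rid W).
Proof.
apply: rhom_eqP; apply: lfun_tens3P => u v w /=.
rewrite !(comp_lfunE, tensfE, tassocE, id_lfunE, tlunitE, trunitE).
by rewrite tensvZl tensvZr.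
Qed.

Definition repMonCat : linMonCat k :=
  @LinMonCat k repCat kone tens_rep (fun _ _ _ _ f g => rtens f g)
    (fun _ _ _ _ g => rtens_linl g) (fun _ _ _ _ f => rtens_linr f)
    rtens_id (fun _ _ _ _ _ _ g f g' f' => rtens_comp g f g' f')
    rassoc rassoc_iso (fun _ _ _ _ _ _ f g h => rassoc_nat f g h)
    rlunit rlunit_iso (fun _ _ f => rlunit_nat f)
    rrunit rrunit_iso (fun _ _ f => rrunit_nat f)
    rpentagon rtriangle.

End Representations.

Arguments Ulinear {k q} V W.

Section Generators.
Variables (k : fieldType) (q : k).
Hypothesis q_neq0 : q != 0.
Hypothesis q_sq : q - q^-1 != 0.

Local Notation sp I := (sp k I).
Local Notation kone := (sgn_rep q false).
Local Notation kmone := (sgn_rep q true).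
Local Notation tens_rep := (tens_rep q_neq0).

(* V_1 has basis x = bvec true, y = bvec false *)
Local Notation vx := (bvec k true).
Local Notation vy := (bvec k false).

Definition V1_op (g : Ugen) : 'End(sp bool) :=
  match g with
  | gE => bmap (fun i => if i then 0 else vx)
  | gF => bmap (fun i => if i then vy else 0)
  | gK => bmap (fun i => if i then q *: vx else q^-1 *: vy)
  | gKi => bmap (fun i => if i then q^-1 *: vx else q *: vy)
  end.

Let V1E :=
  (comp_lfunE, add_lfunE, opp_lfunE, scale_lfunE, id_lfunE, linearZ, linear0).

Lemma V1_op_KKi : (V1_op gK \o V1_op gKi)%VF = \1%VF.
Proof.
apply: lfun_bvecP => -[]; rewrite !V1E bmap_bvec linearZ /= bmap_bvec scalerA.
  by rewrite mulVf ?scale1r.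
by rewrite mulfV ?scale1r.
Qed.

Lemma V1_op_KiK : (V1_op gKi \o V1_op gK)%VF = \1%VF.
Proof.
apply: lfun_bvecP => -[]; rewrite !V1E bmap_bvec linearZ /= bmap_bvec scalerA.
  by rewrite mulfV ?scale1r.
by rewrite mulVf ?scale1r.
Qed.

Lemma V1_op_KE : (V1_op gK \o V1_op gE)%VF =
  q ^+ 2 *: (V1_op gE \o V1_op gK)%VF.
Proof.
apply: lfun_bvecP => -[]; rewrite !V1E /= !bmap_bvec linearZ /= ?linear0.
  by rewrite bmap_bvec !scaler0.
by rewrite !bmap_bvec scalerA expr2 mulfK.
Qed.

Lemma V1_op_KF : (V1_op gK \o V1_op gF)%VF =
  q ^- 2 *: (V1_op gF \o V1_op gK)%VF.
Proof.
apply: lfun_bvecP => -[]; rewrite !V1E /= !bmap_bvec linearZ /= ?linear0.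
  by rewrite !bmap_bvec scalerA expr2 invfM mulfVK.
by rewrite bmap_bvec !scaler0.
Qed.

Lemma V1_op_EF : (V1_op gE \o V1_op gF)%VF - (V1_op gF \o V1_op gE)%VF =
  (q - q^-1)^-1 *: (V1_op gK - V1_op gKi).
Proof.
apply: lfun_bvecP => -[]; rewrite !V1E /= !bmap_bvec ?linear0.
  by rewrite addr0 -scalerBl scalerA mulVf ?scale1r.
by rewrite sub0r -scalerBl scalerA -(opprB q) mulrN mulVf ?scaleN1r.
Qed.

Definition V1 : rep q := Rep V1_op_KKi V1_op_KiK V1_op_KE V1_op_KF V1_op_EF.

(* all bracketed finite tensor products of V_1 and k_{-1}, including the empty
   one *)
Inductive generated : rep q -> Prop :=
| gen_V1 : generated V1
| gen_kmone : generated kmone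
| gen_unit : generated kone
| gen_tens V W : generated V -> generated W -> generated (tens_rep V W).

Definition genMonCat : linMonCat k :=
  @fullMonCat k (repMonCat q_neq0) generated gen_unit gen_tens.

Definition cap_red_map : 'Hom(sp (bool * bool)%type, sp unit) :=
  bmap (fun p => match p with
                 | (true, false) => - q^-1 *: bvec k tt
                 | (false, true) => bvec k tt
                 | _ => 0
                 end).

Definition cup_red_map : 'Hom(sp unit, sp (bool * bool)%type) :=
  bmap (fun _ => tensv vx vy - q *: tensv vy vx).

Definition cap_blue_map : 'Hom(sp (unit * unit)%type, sp unit) :=
  bmap (fun _ => bvec k tt).

Definition cup_blue_map : 'Hom(sp unit, sp (unit * unit)%type) :=
  bmap (fun _ => tensv (bvec k tt) (bvec k tt)).

Definition X_map : 'Hom(sp (bool * unit)%type, sp (unit * bool)%type) :=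
  bmap (fun p => if p.1 then tensv (bvec k tt) vx
                 else - tensv (bvec k tt) vy).

Definition Y_map : 'Hom(sp (unit * bool)%type, sp (bool * unit)%type) :=
  bmap (fun p => if p.2 then tensv vx (bvec k tt)
                 else - tensv vy (bvec k tt)).

Lemma Ulinear_bvecP (V W : rep q) (f : 'Hom(sp (idx V), sp (idx W))) :
  (forall g i, f (op V g (bvec k i)) = op W g (f (bvec k i))) ->
  f \in Ulinear V W.
Proof.
move=> H; apply/asboolP => g; apply: lfun_bvecP => i.
by rewrite !comp_lfunE.
Qed.

Let tensvNl (I J : finType) (u : sp I) (v : sp J) : tensv (- u) v = - tensv u v.
Proof. by rewrite -scaleN1r tensvZl scaleN1r. Qed.
Let tensvNr (I J : finType) (u : sp I) (v : sp J) : tensv u (- v) = - tensv u v.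
Proof. by rewrite -scaleN1r tensvZr scaleN1r. Qed.

Let lfD (I J : finType) (f : 'Hom(sp I, sp J)) u v : f (u + v) = f u + f v.
Proof. exact: linearD. Qed.
Let lfN (I J : finType) (f : 'Hom(sp I, sp J)) u : f (- u) = - f u.
Proof. exact: linearN. Qed.
Let lfZ (I J : finType) (f : 'Hom(sp I, sp J)) t u : f (t *: u) = t *: f u.
Proof. exact: linearZ. Qed.
Let lf0 (I J : finType) (f : 'Hom(sp I, sp J)) : f 0 = 0.
Proof. exact: linear0. Qed.

Let evE := (add_lfunE, opp_lfunE, scale_lfunE, id_lfunE, zero_lfunE, tensfE,
  (tensvDl, tensvDr, tensvZl, tensvZr, tensv0l, tensv0r, tensvNl, tensvNr),
  (lfD, lfN, lfZ, lf0)).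


Local Ltac evaluate :=
  rewrite /= ?bvec_pair ?evE /=;
  rewrite ?bmap_bvec ?evE -?bvec_pair /= ?bmap_bvec ?evE -?bvec_pair /=;
  rewrite ?bmap_bvec ?evE ?bvec_pair /=;
  apply/ffunP=> j; rewrite !ffunE /= /GRing.scale /= ?expr0 ?expr1;
  by field.

Lemma cap_red_Ulinear : cap_red_map \in Ulinear (tens_rep V1 V1) kone.
Proof. by apply: Ulinear_bvecP => -[] [[] []]; evaluate. Qed.

Lemma cup_red_Ulinear : cup_red_map \in Ulinear kone (tens_rep V1 V1).
Proof. by apply: Ulinear_bvecP => -[] []; evaluate. Qed.

Lemma cap_blue_Ulinear : cap_blue_map \in Ulinear (tens_rep kmone kmone) kone.
Proof. by apply: Ulinear_bvecP => -[] [[] []]; evaluate. Qed.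

Lemma cup_blue_Ulinear : cup_blue_map \in Ulinear kone (tens_rep kmone kmone).
Proof. by apply: Ulinear_bvecP => -[] []; evaluate. Qed.

Lemma X_Ulinear : X_map \in Ulinear (tens_rep V1 kmone) (tens_rep kmone V1).
Proof. by apply: Ulinear_bvecP => -[] [[] []]; evaluate. Qed.

Lemma Y_Ulinear : Y_map \in Ulinear (tens_rep kmone V1) (tens_rep V1 kmone).
Proof. by apply: Ulinear_bvecP => -[] [[] []]; evaluate. Qed.

Definition color_ob (c : color) : genMonCat :=
  match c with
  | red => exist generated V1 gen_V1
  | blue => exist generated kmone gen_kmone
  end.

Definition cap_hat (c : color) :
    hom (tens (color_ob c) (color_ob c)) (tunit genMonCat) :=
  match c with
  | red => RHom cap_red_Ulinear
  | blue => RHom cap_blue_Ulinear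
  end.

Definition cup_hat (c : color) :
    hom (tunit genMonCat) (tens (color_ob c) (color_ob c)) :=
  match c with
  | red => RHom cup_red_Ulinear
  | blue => RHom cup_blue_Ulinear
  end.

Definition X_hat : hom (tens (color_ob red) (color_ob blue))
                       (tens (color_ob blue) (color_ob red)) :=
  RHom X_Ulinear.

Definition Y_hat : hom (tens (color_ob blue) (color_ob red))
                       (tens (color_ob red) (color_ob blue)) :=
  RHom Y_Ulinear.

(* Phi sends [:: c] to [color_ob c], and each generating morphism to the
   corresponding hat morphism, read through the structure maps of Phi *)
Definition extends_generators
    (Phi : linMonFunctor (presMonCat q) genMonCat) : Prop :=
  exists eo : forall c : color, Phi [:: c] = color_ob c,
  let e c := eqhom (eo c) in
  let e' c := eqhom (esym (eo c)) in
  [/\ forall c : color,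
        fmap Phi (cls q (tm_cap k c)) ∘ mu Phi [:: c] [:: c] =
        eps Phi ∘ cap_hat c ∘ (e c ⊗ e c),
      forall c : color,
        fmap Phi (cls q (tm_cup k c)) ∘ eps Phi =
        mu Phi [:: c] [:: c] ∘ (e' c ⊗ e' c) ∘ cup_hat c,
      fmap Phi (cls q (tm_X k)) ∘ mu Phi [:: red] [:: blue] =
        mu Phi [:: blue] [:: red] ∘ (e' blue ⊗ e' red) ∘ X_hat
          ∘ (e red ⊗ e blue) &
      fmap Phi (cls q (tm_Y k)) ∘ mu Phi [:: blue] [:: red] =
        mu Phi [:: red] [:: blue] ∘ (e' red ⊗ e' blue) ∘ Y_hat
          ∘ (e blue ⊗ e red)].

End Generators.

Section GroundField.
Variable R : realType.

Definition Cq : fieldType := {fraction {poly R[i]}}.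
Definition qvar : Cq := tofrac 'X.

Lemma qvar_neq0 : qvar != 0.
Proof. by rewrite /qvar tofrac_eq0 polyX_eq0. Qed.

Lemma qvar_sq : qvar - qvar^-1 != 0.
Proof.
rewrite subr_eq0; apply/eqP => E.
have : qvar ^+ 2 == 1 by rewrite expr2 {2}E mulfV // qvar_neq0.
rewrite /qvar -tofracXn -tofrac1 tofrac_eq => /eqP /(congr1 (fun p : {poly R[i]} => size p)).
by rewrite size_polyXn size_poly1.
Qed.

End GroundField.

(* Main.v *)
From mathcomp Require Import all_boot all_order all_algebra.
From mathcomp Require Import fraction complex boolp reals ring.
Require Import Defs.

(* The objects of the target are rigid, so full faithfulness may be checked on
   morphisms out of the unit.  Conjugating by crossings and blue caps moves all
   blue strands to the left and cancels them in pairs; this reduces the target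
   to a power r^n, or to b r^n, into which there is no morphism on either side.
   For r^n, one compares more generally morphisms r^m -> r^n, modulo those
   starting with a cap, to the highest weight vectors of weight q^m in V_1^n,
   through the image of x^m.  Both sides obey the same recursion on n: a highest
   weight vector of V_1 ⊗ V_1^n is x⊗a + y⊗c with c of highest weight q^(m+1),
   hence c comes from some g : r^(m+1) -> r^n by induction, and subtracting a
   multiple of the image of (id ⊗ g)(cup ⊗ id) makes c vanish, so that a is of
   highest weight q^(m-1) (and zero for m = 0).  On diagrams this is the
   decomposition [TL_inv].  That all morphisms decompose so comes from closing
   the recursive description under caps on the right ([TL]) and checking that
   it is stable under all generators on the left. *)

Set Implicit Arguments.
Unset Strict Implicit.
Unset Printing Implicit Defensive.

Import GRing.Theory Num.Theory.
Local Open Scope ring_scope.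
Local Open Scope cat_scope.

(** * Planar diagrams *)

(** Caps kill [x^m], so this vector sees a morphism out of [r^m] at best modulo [capped]. Sources
    with m > 0 are forced all the same: splitting off the leftmost target strand of a morphism
    [r^m -> r^n] produces one out of [r^(m+1)]. Nothing is lost at m = 0, where no cap fits and
    [capped] means zero. Faithfulness mirrors the recursion for highest weight vectors: the
    y-component of the image of [x^m] determines g modulo [capped], and bending a capped g gives
    again a straight leftmost strand plus something capped, so that the x-component decides the
    rest. The arithmetic of q enters through weights. As q is not a root of unity, E is injective in
    negative weight, whence a = 0 for m = 0; as moreover 2 is nonzero, -1 is not an eigenvalue of K
    on [V_1^n], whence no morphism into [b r^n]. Concatenation of words is strict while the tensor
    product of representations is not; this costs the structure maps [merge] and the comparison of
    coherence maps through labels of basis vectors. *)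

Section Diagrams.
Variables (k : fieldType) (q : k).

Local Notation word := (seq color).
Local Notation mor := (mor q).
Local Notation "1_ u" := (cls q (tm_id k u))
  (at level 8, u at level 2, format "1_ u").
Local Notation cap c := (cls q (tm_cap k c)).
Local Notation cup c := (cls q (tm_cup k c)).
Local Notation X := (cls q (tm_X k)).
Local Notation Y := (cls q (tm_Y k)).
Local Notation "g ∘ f" := (mor_comp g f).
Local Notation "f ⊗ g" := (mor_tens f g).
Local Notation ι c := (cls q (tm_id k [:: c])).
Local Notation r := red.
Local Notation b := blue.

(** * Linear and strict monoidal calculus of diagrams *)

Lemma compDl u v w (g g' : mor v w) (f : mor u v) :
  (g + g') ∘ f = g ∘ f + g' ∘ f.
Proof. by have := mor_comp_linl f 1 g g'; rewrite !scale1r. Qed.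

Lemma compDr u v w (g : mor v w) (f f' : mor u v) :
  g ∘ (f + f') = g ∘ f + g ∘ f'.
Proof. by have := mor_comp_linr g 1 f f'; rewrite !scale1r. Qed.

Lemma comp0l u v w (f : mor u v) : (0 : mor v w) ∘ f = 0.
Proof. by apply: (addrI (0 ∘ f)); rewrite -compDl !addr0. Qed.

Lemma comp0r u v w (g : mor v w) : g ∘ (0 : mor u v) = 0.
Proof. by apply: (addrI (g ∘ 0)); rewrite -compDr !addr0. Qed.

Lemma compZl u v w t (g : mor v w) (f : mor u v) : (t *: g) ∘ f = t *: (g ∘ f).
Proof. by have := mor_comp_linl f t g 0; rewrite comp0l !addr0. Qed.

Lemma compZr u v w t (g : mor v w) (f : mor u v) : g ∘ (t *: f) = t *: (g ∘ f).
Proof. by have := mor_comp_linr g t f 0; rewrite comp0r !addr0. Qed.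

Lemma tensDr u v u' v' (f : mor u v) (g g' : mor u' v') :
  f ⊗ (g + g') = f ⊗ g + f ⊗ g'.
Proof. by have := mor_tens_linr f 1 g g'; rewrite !scale1r. Qed.

Lemma tensDl u v u' v' (f f' : mor u v) (g : mor u' v') :
  (f + f') ⊗ g = f ⊗ g + f' ⊗ g.
Proof. by have := mor_tens_linl g 1 f f'; rewrite !scale1r. Qed.

Lemma tens0r u v u' v' (f : mor u v) : f ⊗ (0 : mor u' v') = 0.
Proof. by apply: (addrI (f ⊗ 0)); rewrite -tensDr !addr0. Qed.

Lemma tens0l u v u' v' (g : mor u' v') : (0 : mor u v) ⊗ g = 0.
Proof. by apply: (addrI (0 ⊗ g)); rewrite -tensDl !addr0. Qed.

Lemma tensZr u v u' v' t (f : mor u v) (g : mor u' v') :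
  f ⊗ (t *: g) = t *: (f ⊗ g).
Proof. by have := mor_tens_linr f t g 0; rewrite tens0r !addr0. Qed.

Lemma tensZl u v u' v' t (f : mor u v) (g : mor u' v') :
  (t *: f) ⊗ g = t *: (f ⊗ g).
Proof. by have := mor_tens_linl g t f 0; rewrite tens0l !addr0. Qed.

Lemma tens_nil u v (f : mor u v) : 1_[::] ⊗ f = f.
Proof. by rewrite -(rep_tmK f) cls_tens; apply/clsP/te_tens1m. Qed.

Lemma slide_l u v u' v' (f : mor u v) (g : mor u' v') :
  (f ⊗ 1_v') ∘ (1_u ⊗ g) = f ⊗ g.
Proof. by rewrite -mor_tens_comp mor_compm1 mor_comp1m. Qed.

Lemma slide_r u v u' v' (f : mor u v) (g : mor u' v') :
  (1_v ⊗ g) ∘ (f ⊗ 1_u') = f ⊗ g.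
Proof. by rewrite -mor_tens_comp mor_compm1 mor_comp1m. Qed.

Lemma tens_idcomp c u v w (g : mor v w) (f : mor u v) :
  ι c ⊗ (g ∘ f) = (ι c ⊗ g) ∘ (ι c ⊗ f).
Proof. by rewrite -mor_tens_comp mor_comp1m. Qed.

Lemma tens_compid u v w z (g : mor v w) (f : mor u v) :
  (g ∘ f) ⊗ 1_z = (g ⊗ 1_z) ∘ (f ⊗ 1_z).
Proof. by rewrite -mor_tens_comp mor_comp1m. Qed.

Lemma tens_cons c u : ι c ⊗ 1_u = 1_(c :: u).
Proof. exact: mor_tens_id. Qed.

(** Both sides live in types that are only propositionally equal, so the relation between them is
    left open as P. When the leftmost word is explicit, as in the lemmas below, the two types are
    convertible: P can be equality and the cast is along a loop. *)
Lemma tensA_gen u v u' v' u'' v'' (f : mor u v) (g : mor u' v') (h : mor u'' v'')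
   (P : mor (u ++ u' ++ u'') (v ++ v' ++ v'') -> 
        mor ((u ++ u') ++ u'') ((v ++ v') ++ v'') -> Prop) :
  (forall t eu ev, P (cls q t) (cls q (tm_cast eu ev t))) ->
  P (f ⊗ (g ⊗ h)) ((f ⊗ g) ⊗ h).
Proof.
move=> HP; rewrite -(rep_tmK f) -(rep_tmK g) -(rep_tmK h) !cls_tens.
have /clsP <- := te_tensA q (rep_tm f) (rep_tm g) (rep_tm h).
exact: HP.
Qed.

Lemma tm_cast_id u v (eu : u = u) (ev : v = v) (f : tm k u v) :
  tm_cast eu ev f = f.
Proof. by rewrite (Prop_irrelevance eu erefl) (Prop_irrelevance ev erefl). Qed.

Lemma tensA_id c u' v' u'' v'' (g : mor u' v') (h : mor u'' v'') :
  ι c ⊗ (g ⊗ h) = (ι c ⊗ g) ⊗ h.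
Proof.
by apply: (@tensA_gen _ _ _ _ _ _ (ι c) g h eq) => t eu ev; rewrite tm_cast_id.
Qed.

Lemma tensA_cap c u' v' u'' v'' (g : mor u' v') (h : mor u'' v'') :
  cap c ⊗ (g ⊗ h) = (cap c ⊗ g) ⊗ h.
Proof.
by apply: (@tensA_gen _ _ _ _ _ _ (cap c) g h eq) => t eu ev; rewrite tm_cast_id.
Qed.

Lemma tensA_cup c u' v' u'' v'' (g : mor u' v') (h : mor u'' v'') :
  cup c ⊗ (g ⊗ h) = (cup c ⊗ g) ⊗ h.
Proof.
by apply: (@tensA_gen _ _ _ _ _ _ (cup c) g h eq) => t eu ev; rewrite tm_cast_id.
Qed.

Lemma tensA_X u' v' u'' v'' (g : mor u' v') (h : mor u'' v'') :
  X ⊗ (g ⊗ h) = (X ⊗ g) ⊗ h.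
Proof.
by apply: (@tensA_gen _ _ _ _ _ _ (X) g h eq) => t eu ev; rewrite tm_cast_id.
Qed.

Lemma tensA_Y u' v' u'' v'' (g : mor u' v') (h : mor u'' v'') :
  Y ⊗ (g ⊗ h) = (Y ⊗ g) ⊗ h.
Proof.
by apply: (@tensA_gen _ _ _ _ _ _ (Y) g h eq) => t eu ev; rewrite tm_cast_id.
Qed.

Lemma tens_cons2 c d u v (f : mor u v) : 1_[:: c; d] ⊗ f = ι c ⊗ (ι d ⊗ f).
Proof. by rewrite tensA_id tens_cons. Qed.

(** * Defining relations in the presence of further strands *)

Lemma cap_nat c u v (f : mor u v) :
  (cap c ⊗ 1_v) ∘ (ι c ⊗ (ι c ⊗ f)) = f ∘ (cap c ⊗ 1_u).
Proof. by rewrite -tens_cons2 (slide_l (cap c) f) -slide_r tens_nil. Qed.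

Lemma cup_nat c u v (f : mor u v) :
  (ι c ⊗ (ι c ⊗ f)) ∘ (cup c ⊗ 1_u) = (cup c ⊗ 1_v) ∘ f.
Proof. by rewrite -tens_cons2 (slide_r (cup c) f) -slide_l tens_nil. Qed.

Lemma cls_compP u v w (g : tm k v w) (f : tm k u v) (h : tm k u w) :
  tm_eq q (tm_comp g f) h -> cls q g ∘ cls q f = cls q h.
Proof. by rewrite cls_comp => /clsP. Qed.

Lemma zigzag_l c u :
  (cap c ⊗ 1_(c :: u)) ∘ (ι c ⊗ (cup c ⊗ 1_u)) = 1_(c :: u).
Proof.
rewrite -(tens_cons c u) (tensA_cap c (ι c) 1_u) tensA_id.
rewrite -(tens_compid u (cap c ⊗ ι c) (ι c ⊗ cup c)).
suff -> : (cap c ⊗ ι c) ∘ (ι c ⊗ cup c) = ι c by [].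
by rewrite !cls_tens; exact: cls_compP (te_zigzag_l q c).
Qed.

Lemma zigzag_r c u :
  (ι c ⊗ (cap c ⊗ 1_u)) ∘ (cup c ⊗ 1_(c :: u)) = 1_(c :: u).
Proof.
rewrite -(tens_cons c u) (tensA_cup c (ι c) 1_u) tensA_id.
rewrite -(tens_compid u (ι c ⊗ cap c) (cup c ⊗ ι c)).
suff -> : (ι c ⊗ cap c) ∘ (cup c ⊗ ι c) = ι c by [].
by rewrite !cls_tens; exact: cls_compP (te_zigzag_r q c).
Qed.

Lemma circle_red u : (cap r ⊗ 1_u) ∘ (cup r ⊗ 1_u) = - (q + q^-1) *: 1_u.
Proof.
rewrite -(tens_compid u (cap r) (cup r)).
rewrite (cls_compP (te_circle_red q)) -clsZ.
by rewrite tensZl tens_nil.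
Qed.

Lemma circle_blue u : (cap b ⊗ 1_u) ∘ (cup b ⊗ 1_u) = 1_u.
Proof.
rewrite -(tens_compid u (cap b) (cup b)).
by rewrite (cls_compP (te_circle_blue q)); exact: tens_nil.
Qed.

Lemma cupcap_blue u : (cup b ⊗ 1_u) ∘ (cap b ⊗ 1_u) = 1_(b :: b :: u).
Proof.
rewrite -(tens_compid u (cup b) (cap b)).
by rewrite (cls_compP (te_cupcap_blue q)); exact: mor_tens_id.
Qed.

Lemma XY_id u : (X ⊗ 1_u) ∘ (Y ⊗ 1_u) = 1_(b :: r :: u).
Proof.
rewrite -(tens_compid u X Y).
by rewrite (cls_compP (te_XY q)); exact: mor_tens_id.
Qed.

Lemma YX_id u : (Y ⊗ 1_u) ∘ (X ⊗ 1_u) = 1_(r :: b :: u).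
Proof.
rewrite -(tens_compid u Y X).
by rewrite (cls_compP (te_YX q)); exact: mor_tens_id.
Qed.

Lemma slide_red u : (cap r ⊗ 1_(b :: u)) ∘ (ι r ⊗ (Y ⊗ 1_u)) =
  - ((ι b ⊗ (cap r ⊗ 1_u)) ∘ (X ⊗ 1_(r :: u))).
Proof.
rewrite -(tens_cons r u) -(tens_cons b u) (tensA_cap r (ι b) 1_u) !tensA_id.
rewrite (tensA_X (ι r) 1_u) -(tens_compid u (cap r ⊗ ι b) (ι r ⊗ Y)).
rewrite -(tens_compid u (ι b ⊗ cap r) (X ⊗ ι r)).
suff -> : (cap r ⊗ ι b) ∘ (ι r ⊗ Y) = -1 *: ((ι b ⊗ cap r) ∘ (X ⊗ ι r)).
  by rewrite tensZl scaleN1r.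
rewrite !cls_tens; apply: etrans (cls_compP (te_slide_red q)) _.
by rewrite -clsZ; congr (_ *: _); apply/esym/cls_comp.
Qed.

Lemma slide_blue u : (cap b ⊗ 1_(r :: u)) ∘ (ι b ⊗ (X ⊗ 1_u)) =
  (ι r ⊗ (cap b ⊗ 1_u)) ∘ (Y ⊗ 1_(b :: u)).
Proof.
rewrite -(tens_cons r u) -(tens_cons b u) (tensA_cap b (ι r) 1_u) !tensA_id.
rewrite (tensA_Y (ι b) 1_u) -(tens_compid u (cap b ⊗ ι r) (ι b ⊗ X)).
rewrite -(tens_compid u (ι r ⊗ cap b) (Y ⊗ ι b)).
suff -> : (cap b ⊗ ι r) ∘ (ι b ⊗ X) = (ι r ⊗ cap b) ∘ (Y ⊗ ι b) by [].
rewrite !cls_tens; apply: etrans (cls_compP (te_slide_blue q)) _.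
by apply/esym/cls_comp.
Qed.

(** * Red diagrams: Temperley-Lieb morphisms *)

Local Notation rn n := (nseq n r).

(* for [i > n] this is the cap (cup) at the last position *)
Fixpoint cap_at i n : mor (rn n.+2) (rn n) :=
  match i, n return mor (rn n.+2) (rn n) with
  | i'.+1, n'.+1 => ι r ⊗ cap_at i' n'
  | _, n => cap r ⊗ 1_(rn n)
  end.

Fixpoint cup_at i n : mor (rn n) (rn n.+2) :=
  match i, n return mor (rn n) (rn n.+2) with
  | i'.+1, n'.+1 => ι r ⊗ cup_at i' n'
  | _, n => cup r ⊗ 1_(rn n)
  end.

Lemma cap_at0 n : cap_at 0 n = cap r ⊗ 1_(rn n). Proof. by case: n. Qed.
Lemma cup_at0 n : cup_at 0 n = cup r ⊗ 1_(rn n). Proof. by case: n. Qed.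

Lemma cap_atS i n : cap_at i.+1 n.+1 = ι r ⊗ cap_at i n. Proof. by []. Qed.
Lemma cup_atS i n : cup_at i.+1 n.+1 = ι r ⊗ cup_at i n. Proof. by []. Qed.

Lemma cap_at_last i : cap_at i 0 = cap_at 0 0. Proof. by case: i. Qed.
Lemma cup_at_last i : cup_at i 0 = cup_at 0 0. Proof. by case: i. Qed.

(** The Temperley-Lieb relations: equal positions give a circle, adjacent ones straighten by a
    zigzag, distant ones commute. Commuting needs an intermediate word with two letters less, hence
    the match on n, whose default [False] excludes this case for n < 2. *)
Lemma cap_cup_at n i j :
  (exists t, cap_at i n ∘ cup_at j n = t *: 1_(rn n)) \/
  (if n is n'.+2 return mor (rn n) (rn n) -> Prop then fun f =>
     exists i' j', f = cup_at i' n' ∘ cap_at j' n'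
   else fun=> False) (cap_at i n ∘ cup_at j n).
Proof.
elim: n i j => [|n IH] i j.
  by left; exists (- (q + q^-1)); rewrite cap_at_last cup_at_last circle_red.
case: i j => [|i] [|j].
- by left; exists (- (q + q^-1)); rewrite cap_at0 cup_at0 circle_red.
- case: n IH j => [|n] IH j.
    by left; exists 1; rewrite cap_at0 cup_atS cup_at_last zigzag_l scale1r.
  case: j => [|j].
    by left; exists 1; rewrite cap_at0 cup_atS cup_at0 zigzag_l scale1r.
  right; exists j, 0; rewrite cap_at0 cup_atS.
  case: n IH => [|n] IH; first by rewrite cap_at0 cup_atS cap_nat.
  by rewrite cap_at0 cup_atS cap_nat.
- case: n IH i => [|n] IH i.
    by left; exists 1; rewrite cup_at0 cap_atS cap_at_last zigzag_r scale1r.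
  case: i => [|i].
    by left; exists 1; rewrite cup_at0 cap_atS cap_at0 zigzag_r scale1r.
  by right; exists 0, i; rewrite cup_at0 cup_at0 !cap_atS cup_nat.
rewrite cap_atS cup_atS -tens_idcomp; case: (IH i j) => [[t ->]|].
  by left; exists t; rewrite tensZr tens_cons.
case: n {IH} => [|[|n]] // [i' [j' ->]]; right; exists i'.+1, j'.+1.
by rewrite tens_idcomp.
Qed.

(** [TL_line] and [TL_cup] are the two ways to add a leftmost target strand: it continues a new
    leftmost source strand, or it turns back into the first input of f. Caps enter by
    precomposition, at any position. *)
Inductive TL : forall m n, mor (rn m) (rn n) -> Prop :=
| TL_id : TL (m := 0) (n := 0) 1_[::]
| TL_zero m n : TL (m := m) (n := n) 0
| TL_lin m n t (f g : mor (rn m) (rn n)) : TL f -> TL g -> TL (t *: f + g)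
| TL_line m n (f : mor (rn m) (rn n)) :
    TL f -> TL (m := m.+1) (n := n.+1) (ι r ⊗ f)
| TL_cup m n (f : mor (rn m.+1) (rn n)) :
    TL f -> TL (m := m) (n := n.+1) ((ι r ⊗ f) ∘ (cup r ⊗ 1_(rn m)))
| TL_cap m n i (f : mor (rn m) (rn n)) : TL f -> TL (f ∘ cap_at i m).

Lemma TL_scale m n t (f : mor (rn m) (rn n)) : TL f -> TL (t *: f).
Proof. by move=> fT; rewrite -[_ *: _]addr0; apply: TL_lin fT (TL_zero _ _). Qed.

Lemma TL_idn n : TL (m := n) (n := n) 1_(rn n).
Proof.
elim: n => [|n IH]; first exact: TL_id.
by rewrite -[X in TL X](tens_cons r (rn n)); apply: TL_line.
Qed.

(** A cup at the first position below a straight strand is an instance of [TL_cup]; any other cup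
    slides past the leftmost strand or meets a cap, where [cap_cup_at] decides. *)
Lemma TL_cup_at m n (f : mor (rn m.+2) (rn n)) i : TL f -> TL (f ∘ cup_at i m).
Proof.
(* Induction on the derivation needs a variable source; the match restores the shape [m.+2] and is
   trivial elsewhere. The same device recurs below. *)
suff H m' (g : mor (rn m') (rn n)) : TL g ->
  (if m' is m.+2 return mor (rn m') (rn n) -> Prop then fun g =>
   forall i, TL (g ∘ cup_at i m) else fun => True) g by move/H; apply.
elim=> {m f g m' n i} //.
- by move=> [|[|m]] n // i; rewrite comp0l; apply: TL_zero.
- move=> [|[|m]] n t f g _ fT _ gT // i; rewrite compDl compZl.
  by apply: TL_lin.
- move=> [|m] n f fT IH //; case: m f fT IH => [|m] f fT IH i.
    by rewrite cup_at_last cup_at0; apply: TL_cup.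
  case: i => [|i]; first by rewrite cup_at0; apply: TL_cup.
  by rewrite cup_atS -tens_idcomp; apply/TL_line/IH.
- move=> [|[|m]] n f _ IH // i.
  rewrite -mor_compA -cup_nat mor_compA -tens_idcomp.
  by apply: TL_cup; exact: (IH i.+1).
- move=> m n i f fT IH j; rewrite -mor_compA.
  case: (cap_cup_at m i j) => [[t ->]|].
    by rewrite compZr mor_compm1; apply: TL_scale.
  case: m i f fT IH => [|[|m]] // i f fT IH [i' [j' ->]].
  by rewrite mor_compA; apply: TL_cap.
Qed.

(** Bending the leftmost target strand down to the source: a straight strand becomes a cap, and the
    cup of [TL_cup] is undone by a zigzag. *)
Lemma TL_bend m n (f : mor (rn m) (rn n.+1)) :
  TL f -> TL (m := m.+1) (n := n) ((cap r ⊗ 1_(rn n)) ∘ (ι r ⊗ f)).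
Proof.
suff H n' (g : mor (rn m) (rn n')) : TL g ->
  (if n' is n.+1 return mor (rn m) (rn n') -> Prop then fun g =>
   TL (m := m.+1) (n := n) ((cap r ⊗ 1_(rn n)) ∘ (ι r ⊗ g)) else fun => True) g.
  by move/H; apply.
elim=> {m n f g n'} //.
- by move=> m [|n] //; rewrite tens0r comp0r; apply: TL_zero.
- move=> m [|n] t f g _ fT _ gT //; rewrite tensDr tensZr compDr compZr.
  by apply: TL_lin.
- by move=> m n f fT _; rewrite cap_nat -cap_at0; apply: TL_cap.
- move=> m n f fT _; rewrite tens_idcomp mor_compA cap_nat -mor_compA.
  by rewrite (zigzag_l r (rn m)) mor_compm1.
- move=> m [|n] i f _ IH //; rewrite tens_idcomp mor_compA -cap_atS.
  exact: TL_cap.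
Qed.

(* [TL] is defined by closure under composition on the right; these are the
   morphisms preserving it by composition on the left *)
Definition TLstable m n (t : mor (rn m) (rn n)) :=
  forall p (f : mor (rn p) (rn m)), TL f -> TL (t ∘ f).

Lemma TLstable_TL m n (t : mor (rn m) (rn n)) : TLstable t -> TL t.
Proof. by move=> /(_ _ _ (TL_idn m)); rewrite mor_compm1. Qed.

Lemma TLstable_id n : TLstable 1_(rn n).
Proof. by move=> p f fT; rewrite mor_comp1m. Qed.

Lemma TLstable0 m n : TLstable (0 : mor (rn m) (rn n)).
Proof. by move=> p f fT; rewrite comp0l; exact: TL_zero. Qed.

Lemma TLstable_lin m n a (s t : mor (rn m) (rn n)) :
  TLstable s -> TLstable t -> TLstable (a *: s + t).
Proof.
move=> sS tS p f fT; rewrite compDl compZl.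
by apply: TL_lin; [apply: sS|apply: tS].
Qed.

Lemma TLstable_comp m n p (s : mor (rn n) (rn p)) (t : mor (rn m) (rn n)) :
  TLstable s -> TLstable t -> TLstable (s ∘ t).
Proof. by move=> sS tS l f fT; rewrite -mor_compA; apply/sS/tS. Qed.

Lemma TLstable_cup n : TLstable (cup r ⊗ 1_(rn n) : mor (rn n) (rn n.+2)).
Proof.
by move=> p f fT; rewrite -cup_nat; apply/TL_cup/TL_line.
Qed.

(** A cap meeting a leftmost strand built by [TL_line] is literally a bend; one built by [TL_cup] is
    a bend preceded by a cup. So [TL_bend] and [TL_cup_at] settle both. *)
Lemma TLstable_cap n : TLstable (cap r ⊗ 1_(rn n) : mor (rn n.+2) (rn n)).
Proof.
move=> m f; suff H n' (g : mor (rn m) (rn n')) : TL g ->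
  (if n' is n.+2 return mor (rn m) (rn n') -> Prop then fun g =>
   TL ((cap r ⊗ 1_(rn n) : mor (rn n.+2) (rn n)) ∘ g) else fun => True) g.
  by move/H; apply.
elim=> {m n f g n'} //.
- by move=> m [|[|n]] //; rewrite comp0r; apply: TL_zero.
- move=> m [|[|n]] t f g _ fT _ gT //; rewrite compDr compZr.
  by apply: TL_lin.
- by move=> m [|n] f fT _ //; apply: TL_bend.
- move=> m [|n] f fT _ //; rewrite mor_compA -cup_at0.
  by apply/TL_cup_at/TL_bend.
- move=> m [|[|n]] i f _ IH //; rewrite mor_compA.
  exact: TL_cap.
Qed.

Lemma TLstable_line m n (t : mor (rn m) (rn n)) :
  TLstable t -> TLstable (m := m.+1) (n := n.+1) (ι r ⊗ t).
Proof.
move=> tS p f; suff H m' (g : mor (rn p) (rn m')) : TL g ->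
  (if m' is m.+1 return mor (rn p) (rn m') -> Prop then fun g =>
   forall t : mor (rn m) (rn n), TLstable t ->
   TL (m := p) (n := n.+1) ((ι r ⊗ t) ∘ g) else fun => True) g.
  by move/H; apply.
elim=> {m t tS p f m' g} //.
- by move=> p [|m] // t tS; rewrite comp0r; apply: TL_zero.
- move=> p [|m] a f g _ fT _ gT // t tS; rewrite compDr compZr.
  by apply: TL_lin; [apply: fT|apply: gT].
- by move=> p m f fT _ t tS; rewrite -tens_idcomp; apply/TL_line/tS.
- move=> p m f fT _ t tS; rewrite mor_compA -tens_idcomp.
  by apply/TL_cup/tS.
- by move=> p [|m] i f _ IH // t tS; rewrite mor_compA; apply/TL_cap/IH.
Qed.

(* the elements of [TL] that kill [x^m], see [faithful_TL] *)
Inductive capped : forall m n, mor (rn m) (rn n) -> Prop :=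
| capped0 m n : capped (m := m) (n := n) 0
| capped_lin m n t (f g : mor (rn m) (rn n)) :
    capped f -> capped g -> capped (t *: f + g)
| capped_cap m n i (f : mor (rn m) (rn n)) : TL f -> capped (f ∘ cap_at i m).

(** A cap needs two source strands. This makes working modulo [capped] harmless for morphisms out of
    the unit. *)
Lemma capped_eq0 n (f : mor (rn 0) (rn n)) : capped f -> f = 0.
Proof.
suff H m (g : mor (rn m) (rn n)) : capped g ->
  (if m is 0 return mor (rn m) (rn n) -> Prop then fun g => g = 0
   else fun => True) g by move/H.
elim=> {m n f g} // [[|m] n //|[|m] n t f g _ IHf _ IHg //].
by rewrite IHf IHg scaler0 addr0.
Qed.

Lemma capped_add m n (f g : mor (rn m) (rn n)) :
  capped f -> capped g -> capped (f + g).
Proof. by move=> fC gC; rewrite -[f]scale1r; apply: capped_lin. Qed.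

Lemma capped_line m n (f : mor (rn m) (rn n)) :
  capped f -> capped (m := m.+1) (n := n.+1) (ι r ⊗ f).
Proof.
elim=> {m n f}.
- by move=> m n; rewrite tens0r; apply: capped0.
- by move=> m n t f g _ IHf _ IHg; rewrite tensDr tensZr; apply: capped_lin.
- move=> m n i f fT; rewrite tens_idcomp -cap_atS.
  by apply: (@capped_cap m.+1 n.+1); apply: TL_line.
Qed.

(** * Decomposition along the leftmost target strand *)

(** The leftmost strand runs straight from source to target, which for m = 0 leaves only zero. The
    image of [x^m] under such a morphism has no y-component. *)
Definition lined m n : mor (rn m) (rn n.+1) -> Prop :=
  if m is m'.+1 return mor (rn m) (rn n.+1) -> Prop
  then fun a => exists2 f : mor (rn m') (rn n), TL f & a = ι r ⊗ f
  else fun a => a = 0.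

Lemma lined0 m n : lined (0 : mor (rn m) (rn n.+1)).
Proof.
by case: m => [|m] //; exists 0; [apply: TL_zero|rewrite tens0r].
Qed.

Lemma lined_lin m n t (f g : mor (rn m) (rn n.+1)) :
  lined f -> lined g -> lined (t *: f + g).
Proof.
case: m f g => [|m] f g; first by move=> -> ->; rewrite scaler0 addr0.
move=> [f' f'T ->] [g' g'T ->]; exists (t *: f' + g'); first exact: TL_lin.
by rewrite tensDr tensZr.
Qed.

(** A cap at the first position cancels the bending cup by a zigzag and leaves a straight strand; a
    cap further right slides below the cup and stays a cap, one position to the left. *)
Lemma capped_bend m n (g : mor (rn m.+1) (rn n)) : capped g ->
  exists a c : mor (rn m) (rn n.+1), [/\ lined a, capped c &
    (ι r ⊗ g) ∘ (cup r ⊗ 1_(rn m)) = a + c].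
Proof.
suff H m' (f : mor (rn m') (rn n)) : capped f ->
  (if m' is m.+1 return mor (rn m') (rn n) -> Prop then fun f =>
    exists a c : mor (rn m) (rn n.+1), [/\ lined a, capped c &
      (ι r ⊗ f) ∘ (cup r ⊗ 1_(rn m)) = a + c] else fun => True) f.
  by move/H.
elim=> {m n g m' f} //.
- move=> [|m] n //; exists 0, 0; rewrite tens0r comp0l addr0.
  by split=> //; [apply: lined0|apply: capped0].
- move=> [|m] n t f g // _ [a [c [aL cC E]]] _ [a' [c' [a'L c'C E']]].
  exists (t *: a + a'), (t *: c + c'); split; first exact: lined_lin.
    exact: capped_lin.
  by rewrite tensDr tensZr compDl compZl E E' scalerDr addrACA.
- move=> m n i f fT; rewrite tens_idcomp -mor_compA.
  have H0 : (ι r ⊗ cap_at 0 m) ∘ (cup r ⊗ 1_(rn m.+1)) = 1_(rn m.+1).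
    by rewrite cap_at0 zigzag_r.
  have L0 : lined (m := m.+1) (n := n) (ι r ⊗ f) by exists f.
  (* For m = 0 every index denotes the same cap, the one at the first position. *)
  case: m f fT H0 L0 => [|m] f fT H0 L0; last case: i => [|i].
  - exists (ι r ⊗ f), 0; rewrite cap_at_last H0 mor_compm1 addr0.
    by split=> //; apply: capped0.
  - exists (ι r ⊗ f), 0; rewrite H0 mor_compm1 addr0.
    by split=> //; apply: capped0.
  - exists 0, ((ι r ⊗ f) ∘ (cup r ⊗ 1_(rn m)) ∘ cap_at i m).
    split; [exact: lined0|apply: capped_cap; exact: TL_cup|].
    by rewrite cap_atS cup_nat mor_compA add0r.
Qed.

(** The three terms collect the derivations that end with [TL_line], [TL_cup] and [TL_cap]. Only the
    middle one can give the image of [x^m] a y-component. *)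
Lemma TL_inv m n (f : mor (rn m) (rn n.+1)) : TL f ->
  exists (a : mor (rn m) (rn n.+1)) (g : mor (rn m.+1) (rn n))
      (c : mor (rn m) (rn n.+1)), [/\ lined a, TL g, capped c &
    f = a + (ι r ⊗ g) ∘ (cup r ⊗ 1_(rn m)) + c].
Proof.
suff H n' (h : mor (rn m) (rn n')) : TL h ->
  (if n' is n.+1 return mor (rn m) (rn n') -> Prop then fun h =>
    exists (a : mor (rn m) (rn n.+1)) (g : mor (rn m.+1) (rn n))
      (c : mor (rn m) (rn n.+1)), [/\ lined a, TL g, capped c &
      h = a + (ι r ⊗ g) ∘ (cup r ⊗ 1_(rn m)) + c] else fun => True) h.
  by move/H.
elim=> {m n f n' h} //.
- move=> m [|n] //; exists 0, 0, 0; rewrite tens0r comp0l !addr0.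
  by split=> //; [apply: lined0|apply: TL_zero|apply: capped0].
- move=> m [|n] t f g // _ [a [h [c [aL hT cC ->]]]] _.
  move=> [a' [h' [c' [a'L h'T c'C ->]]]].
  exists (t *: a + a'), (t *: h + h'), (t *: c + c').
  split; [exact: lined_lin|exact: TL_lin|exact: capped_lin|].
  rewrite tensDr tensZr compDl compZl !scalerDr addrACA.
  by rewrite [X in X + _ = _]addrACA.
- move=> m n f fT _; exists (ι r ⊗ f), 0, 0; rewrite tens0r comp0l !addr0.
  by split=> //; [exists f|apply: TL_zero|apply: capped0].
- move=> m n f fT _; exists 0, f, 0; rewrite add0r addr0.
  by split=> //; [apply: lined0|apply: capped0].
- move=> m [|n] i f fT _ //; exists 0, 0, (f ∘ cap_at i m).
  rewrite tens0r comp0l !add0r; split=> //; first exact: lined0.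
    exact: TL_zero.
  exact: capped_cap.
Qed.

Lemma TL_inv0 m (f : mor (rn m) (rn 0)) : TL f ->
  exists2 a, capped (f - a) &
    (if m is 0 return mor (rn m) (rn 0) -> Prop then fun a =>
     exists t, a = t *: 1_[::] else fun a => a = 0) a.
Proof.
suff H n' (h : mor (rn m) (rn n')) : TL h ->
  (if n' is 0 return mor (rn m) (rn n') -> Prop then fun h =>
    exists2 a, capped (h - a) &
    (if m is 0 return mor (rn m) (rn 0) -> Prop then fun a =>
     exists t, a = t *: 1_[::] else fun a => a = 0) a else fun => True) h.
  by move/H.
elim=> {m f n' h} //.
- by exists 1_[::]; [rewrite subrr; apply: capped0|exists 1; rewrite scale1r].
- move=> m [|n] //; exists 0; first by rewrite subr0; apply: capped0.
  by case: m => // ; exists 0; rewrite scale0r.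
- move=> m [|n] t f g // _ [a aC aE] _ [a' a'C a'E]; exists (t *: a + a').
    rewrite opprD addrACA -scalerBr; exact: capped_lin.
  case: m a a' aE a'E {f g aC a'C} => [|m] a a'.
    by move=> [s ->] [s' ->]; exists (t * s + s'); rewrite scalerA scalerDl.
  by move=> -> ->; rewrite scaler0 addr0.
- move=> m [|n] i f fT _ //; exists 0 => //.
  by rewrite subr0; apply: capped_cap.
Qed.

(** * Moving blue strands to the left and cancelling them *)

Fixpoint parity (u : word) : bool :=
  if u is c :: u' then (if c is blue then ~~ parity u' else parity u')
  else false.

Fixpoint reds (u : word) : nat :=
  if u is c :: u' then (if c is blue then reds u' else (reds u').+1) else 0.

Definition sorted_word (p : bool) n : word := if p then b :: rn n else rn n.

(** Absorbs one more letter into a sorted word: a red letter crosses the blue one, a second blue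
    letter is removed by the blue cap. Each case is invertible, the last one by the relation making
    the blue cup and cap mutually inverse. *)
Definition step c p n :
    mor (c :: sorted_word p n)
      (sorted_word (if c is blue then ~~ p else p)
                   (if c is blue then n else n.+1)) :=
  match c, p return
    mor (c :: sorted_word p n)
      (sorted_word (if c is blue then ~~ p else p)
                   (if c is blue then n else n.+1)) with
  | red, false => 1_(r :: rn n)
  | red, true => X ⊗ 1_(rn n)
  | blue, false => 1_(b :: rn n)
  | blue, true => cap b ⊗ 1_(rn n)
  end.

Fixpoint sort_blue u : mor u (sorted_word (parity u) (reds u)) :=
  if u is c :: u' return mor u (sorted_word (parity u) (reds u))
  then step c (parity u') (reds u') ∘ (ι c ⊗ sort_blue u') else 1_[::].

(* zero for [p != p'], as every morphism preserves the parity of blue letters *)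
Definition widen p p' m n (t : mor (rn m) (rn n)) :
    mor (sorted_word p m) (sorted_word p' n) :=
  match p, p' return mor (sorted_word p m) (sorted_word p' n) with
  | false, false => t
  | true, true => ι b ⊗ t
  | _, _ => 0
  end.

Definition invertible u v (f : mor u v) :=
  exists g, g ∘ f = 1_u /\ f ∘ g = 1_v.

Lemma invertible_comp u v w (g : mor v w) (f : mor u v) :
  invertible g -> invertible f -> invertible (g ∘ f).
Proof.
move=> [g' [g'g gg']] [f' [f'f ff']]; exists (f' ∘ g'); split.
  by rewrite mor_compA -(mor_compA f') g'g mor_compm1.
by rewrite mor_compA -(mor_compA g) ff' mor_compm1.
Qed.

Lemma invertible_cons c u v (f : mor u v) :
  invertible f -> invertible (u := c :: u) (v := c :: v) (ι c ⊗ f).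
Proof.
by move=> [g [gf fg]]; exists (ι c ⊗ g); rewrite -!tens_idcomp gf fg !tens_cons.
Qed.

Lemma step_invertible c p n : invertible (step c p n).
Proof.
case: c; case: p => /=.
- by exists (Y ⊗ 1_(rn n)); rewrite YX_id XY_id.
- by exists 1_(rn n.+1); rewrite mor_comp1m.
- by exists (cup b ⊗ 1_(rn n)); rewrite cupcap_blue circle_blue.
- by exists 1_(b :: rn n); rewrite mor_comp1m.
Qed.

Lemma sort_blue_invertible u : invertible (sort_blue u).
Proof.
elim: u => [|c u IH]; first by exists 1_[::]; rewrite mor_comp1m.
exact: invertible_comp (step_invertible c _ _) (invertible_cons c IH).
Qed.

(** In sorted form, tensoring with a red letter adds a line to t, and tensoring with a blue letter
    leaves t unchanged. *)
Lemma widen_step c p p' m n (t : mor (rn m) (rn n)) :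
  exists2 t' : mor (rn (if c is blue then m else m.+1))
                   (rn (if c is blue then n else n.+1)),
  (TLstable t -> TLstable t') &
  step c p' n ∘ (ι c ⊗ widen p p' t) =
  widen (if c is blue then ~~ p else p) (if c is blue then ~~ p' else p') t'
    ∘ step c p m.
Proof.
case: c.
  exists (ι r ⊗ t); first exact: TLstable_line.
  case: p; case: p'; rewrite /= ?tens0r ?comp0l ?comp0r
    ?mor_comp1m ?mor_compm1 //.
  by rewrite -!tens_cons2 (slide_l X t) (slide_r X t).
exists t => //.
case: p; case: p'; rewrite /= ?tens0r ?comp0l ?comp0r
    ?mor_comp1m ?mor_compm1 //.
exact: cap_nat.
Qed.

(** After sorting source and target, h is purely red. Asking for [TLstable] rather than [TL] makes
    the property compatible with composition. *)
Definition sortable u v (h : mor u v) := exists2 t, TLstable t &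
  sort_blue v ∘ h = widen (parity u) (parity v) t ∘ sort_blue u.

Lemma widen0 p p' m n : widen p p' (0 : mor (rn m) (rn n)) = 0.
Proof. by case: p; case: p'; rewrite /= ?tens0r. Qed.

Lemma widen1 p n : widen p p 1_(rn n) = 1_(sorted_word p n).
Proof. by case: p => //=; rewrite tens_cons. Qed.

Lemma sortable0 u v : sortable (0 : mor u v).
Proof.
exists 0; first exact: TLstable0.
by rewrite comp0r widen0 comp0l.
Qed.

Lemma widen_lin p p' m n t (f g : mor (rn m) (rn n)) :
  widen p p' (t *: f + g) = t *: widen p p' f + widen p p' g.
Proof.
by case: p; case: p'; rewrite /= ?scaler0 ?addr0 // tensDr tensZr.
Qed.

Lemma sortable_lin u v t (f g : mor u v) :
  sortable f -> sortable g -> sortable (t *: f + g).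
Proof.
move=> [f' f'S Ef] [g' g'S Eg]; exists (t *: f' + g'); first exact: TLstable_lin.
by rewrite widen_lin compDl compZl compDr compZr Ef Eg.
Qed.

Lemma sortable_id u : sortable 1_u.
Proof.
exists 1_(rn (reds u)); first exact: TLstable_id.
by rewrite mor_compm1 widen1 mor_comp1m.
Qed.

Lemma widen_comp p p' p'' m n l (g : mor (rn n) (rn l)) (f : mor (rn m) (rn n)) :
  widen p' p'' g ∘ widen p p' f =
  (if (p == p') && (p' == p'') then widen p p'' (g ∘ f) else 0).
Proof.
by case: p; case: p'; case: p''; rewrite /= ?comp0l ?comp0r // tens_idcomp.
Qed.

Lemma sortable_comp u v w (g : mor v w) (f : mor u v) :
  sortable g -> sortable f -> sortable (g ∘ f).
Proof.
move=> [g' g'S Eg] [f' f'S Ef].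
have E : sort_blue w ∘ (g ∘ f) =
    widen (parity v) (parity w) g' ∘ widen (parity u) (parity v) f' ∘ sort_blue u.
  by rewrite mor_compA Eg -mor_compA Ef mor_compA.
move: E; rewrite widen_comp; case: ifP => _ E.
  by exists (g' ∘ f'); first exact: TLstable_comp.
(* Some parity changes along the way, so the composite vanishes. *)
exists 0; first exact: TLstable0.
by rewrite E widen0.
Qed.

Lemma sortable_cons c u v (h : mor u v) :
  sortable h -> sortable (u := c :: u) (v := c :: v) (ι c ⊗ h).
Proof.
move=> [t tS E]; have [t' t'S E'] := widen_step c (parity u) (parity v) t.
exists t'; first exact: t'S.
rewrite /= -mor_compA -tens_idcomp E tens_idcomp [RHS]mor_compA -E'.
exact: mor_compA.
Qed.

Lemma sortable_idl l u v (h : mor u v) : sortable h -> sortable (1_l ⊗ h).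
Proof.
elim: l => [|c l IH] hS; first by rewrite tens_nil.
rewrite -(tens_cons c l) -tensA_id; exact: sortable_cons (IH hS).
Qed.

Lemma sortable_eqmor u v (e : u = v) : sortable (@eqhom k (presCat q) _ _ e).
Proof. by case: v / e; apply: sortable_id. Qed.

(* bend [slide_red]: [X] is [Y] rotated through a cup and a cap *)
Lemma cup_pass u :
  (X ⊗ 1_(r :: u)) ∘ ((ι r ⊗ (X ⊗ 1_u)) ∘ (cup r ⊗ 1_(b :: u))) =
  - (ι b ⊗ (cup r ⊗ 1_u)).
Proof.
pose W : mor (b :: u) [:: r, b, r & u] :=
  (Y ⊗ 1_(r :: u)) ∘ (ι b ⊗ (cup r ⊗ 1_u)).
have EX : X ⊗ 1_u = - ((cap r ⊗ 1_[:: b, r & u]) ∘ (ι r ⊗ W)).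
  rewrite tens_idcomp mor_compA slide_red -scaleN1r compZl scaleN1r opprK.
  rewrite -mor_compA -(tens_cons2 r b) (slide_l X (cup r ⊗ 1_u)).
  rewrite -(slide_r X (cup r ⊗ 1_u)) tens_cons2 mor_compA -tens_idcomp.
  by rewrite zigzag_l tens_cons mor_comp1m.
have -> : (ι r ⊗ (X ⊗ 1_u)) ∘ (cup r ⊗ 1_(b :: u)) = - W.
  rewrite EX -scaleN1r tensZr tens_idcomp compZl -mor_compA cup_nat mor_compA.
  by rewrite zigzag_r mor_comp1m scaleN1r.
by rewrite -scaleN1r compZr mor_compA XY_id mor_comp1m scaleN1r.
Qed.

Lemma sortable_cup c z : sortable (u := z) (v := c :: c :: z) (cup c ⊗ 1_z).
Proof.
suff [t tS E] : exists2 t, TLstable t &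
    step c (parity (c :: z)) (reds (c :: z)) ∘
      ((ι c ⊗ step c (parity z) (reds z)) ∘
       (cup c ⊗ 1_(sorted_word (parity z) (reds z)))) =
  widen (parity z) (parity [:: c, c & z]) t.
  exists t => //; rewrite -E /= tens_idcomp -!mor_compA -cup_nat //.
case: c => /=.
  case: (parity z) => /=; last first.
    exists (cup r ⊗ 1_(rn (reds z))); first exact: TLstable_cup.
    by rewrite tens_cons !mor_comp1m.
  (* The sign is the price of moving a blue strand through a red cup, see [cup_pass]; the summand 0
     puts the witness in the form of [TLstable_lin]. *)
  exists (- 1 *: (cup r ⊗ 1_(rn (reds z))) + 0).
    by apply: TLstable_lin; [exact: TLstable_cup|exact: TLstable0].
  by rewrite addr0 tensZr scaleN1r cup_pass.
exists 1_(rn (reds z)); first exact: TLstable_id.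
case: (parity z) => /=; last first.
  by rewrite tens_cons mor_comp1m circle_blue.
by rewrite mor_comp1m zigzag_r tens_cons.
Qed.

Lemma sortable_cap c z : sortable (u := c :: c :: z) (v := z) (cap c ⊗ 1_z).
Proof.
suff [t tS E] : exists2 t, TLstable t &
    cap c ⊗ 1_(sorted_word (parity z) (reds z)) =
    widen (parity [:: c, c & z]) (parity z) t ∘
      (step c (parity (c :: z)) (reds (c :: z)) ∘
       (ι c ⊗ step c (parity z) (reds z))).
  exists t => //; rewrite -cap_nat E /= tens_idcomp !mor_compA //.
case: c => /=.
  case: (parity z) => /=; last first.
    exists (cap r ⊗ 1_(rn (reds z))); first exact: TLstable_cap.
    by rewrite tens_cons !mor_compm1.
  exists (- 1 *: (cap r ⊗ 1_(rn (reds z))) + 0).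
    by apply: TLstable_lin; [exact: TLstable_cap|exact: TLstable0].
  rewrite addr0 tensZr scaleN1r mor_compA -(scaleN1r (_ ⊗ _)) compZl.
  rewrite scaleN1r -slide_red.
  rewrite -mor_compA -tens_idcomp YX_id tens_cons mor_compm1 //.
exists 1_(rn (reds z)); first exact: TLstable_id.
case: (parity z) => /=; last first.
  by rewrite tens_cons mor_compm1 mor_comp1m.
rewrite tens_cons !mor_comp1m.
(* A blue cap shifts across a third blue strand: insert the cup after the cap, which is the
   identity, and straighten the zigzag. *)
rewrite -[RHS]mor_compm1 -cupcap_blue mor_compA zigzag_r mor_comp1m //.
Qed.

Lemma sortable_X z :
  sortable (u := [:: r, b & z]) (v := [:: b, r & z]) (X ⊗ 1_z).
Proof.
exists 1_(rn (reds z).+1); first exact: TLstable_id.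
rewrite /= !tens_idcomp -!mor_compA -tens_cons2 (slide_r X (sort_blue z)).
rewrite -tens_cons2 -(slide_l X (sort_blue z)).
rewrite !mor_compA; congr (_ ∘ _); case: (parity z) => /=.
  by rewrite mor_comp1m slide_blue -mor_compA YX_id mor_compm1 mor_comp1m.
by rewrite !tens_cons !mor_comp1m mor_compm1.
Qed.

Lemma sortable_Y z :
  sortable (u := [:: b, r & z]) (v := [:: r, b & z]) (Y ⊗ 1_z).
Proof.
exists 1_(rn (reds z).+1); first exact: TLstable_id.
rewrite /= !tens_idcomp -!mor_compA -tens_cons2 (slide_r Y (sort_blue z)).
rewrite -tens_cons2 -(slide_l Y (sort_blue z)).
rewrite !mor_compA; congr (_ ∘ _); case: (parity z) => /=.
  by rewrite !mor_comp1m slide_blue.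
by rewrite !tens_cons !mor_comp1m mor_compm1 XY_id.
Qed.

Lemma sortable_assoc u v w u' v' w' (f : mor ((u ++ v) ++ w) ((u' ++ v') ++ w'))
    (g : mor (u ++ v ++ w) (u' ++ v' ++ w')) :
  pres_assoc q u' v' w' ∘ f = g ∘ pres_assoc q u v w -> sortable g -> sortable f.
Proof.
move=> E gS.
have -> : f = @eqhom k (presCat q) _ _ (catA u' v' w') ∘
    (g ∘ pres_assoc q u v w).
  rewrite -E mor_compA /pres_assoc eqmor_comp.
  by rewrite (Prop_irrelevance (etrans _ _) erefl) mor_comp1m.
by apply/sortable_comp/sortable_comp => //; exact: sortable_eqmor.
Qed.

(** Strands on the right are built into the induction, since sorting proceeds from the right end of
    the word; strands on the left are added one at a time by [sortable_cons]. *)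
Lemma sortable_tm u v (f : tm k u v) z : sortable (cls q f ⊗ 1_z).
Proof.
elim: f z => {u v}.
- by move=> u z; rewrite mor_tens_id; apply: sortable_id.
- move=> u v w g IHg f IHf z; rewrite -cls_comp tens_compid.
  exact: sortable_comp.
- move=> u v u' v' f IHf g IHg z; rewrite -cls_tens.
  apply: sortable_assoc (pres_assoc_nat _ _ _) _.
  rewrite -slide_l.
  exact: sortable_comp (IHf _) (sortable_idl _ (IHg z)).
- by move=> u v z; rewrite (_ : cls q _ = 0) // tens0l; apply: sortable0.
- move=> u v f IHf g IHg z; rewrite -clsD tensDl -[cls q f ⊗ _]scale1r.
  exact: sortable_lin.
- move=> u v t f IHf z; rewrite -clsZ tensZl -[_ *: _]addr0.
  exact: sortable_lin (IHf z) (sortable0 _ _).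
- exact: sortable_cap.
- exact: sortable_cup.
- exact: sortable_X.
- exact: sortable_Y.
Qed.

Lemma sortable_all u v (f : mor u v) : sortable f.
Proof.
have -> : f = pres_runit q v ∘ (f ⊗ 1_[::]) ∘
    @eqhom k (presCat q) _ _ (esym (cats0 u)).
  rewrite pres_runit_nat /pres_runit -mor_compA eqmor_comp.
  by rewrite (Prop_irrelevance (etrans _ _) erefl) mor_compm1.
rewrite -[f in f ⊗ _]rep_tmK.
apply: sortable_comp (sortable_eqmor _).
exact: sortable_comp (sortable_eqmor _) (sortable_tm _ _).
Qed.

Lemma sort_blue_TL w (f : mor [::] w) :
  exists2 t : mor (rn 0) (rn (reds w)), TL t &
    sort_blue w ∘ f = widen false (parity w) t.
Proof.
have [t tS E] := sortable_all f; exists t; first exact: TLstable_TL.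
by rewrite E /= mor_compm1.
Qed.

End Diagrams.

(** * The functor *)

Section IsoTheory.
Variables (k : fieldType) (C : linCat k).

Lemma is_iso_id (a : C) : is_iso (idm a).
Proof. by exists (idm a); rewrite comp1m. Qed.

Lemma is_iso_comp (a b c : C) (g : hom b c) (f : hom a b) :
  is_iso g -> is_iso f -> is_iso (g ∘ f).
Proof.
move=> [g' [g'g gg']] [f' [f'f ff']]; exists (f' ∘ g'); split.
  by rewrite compA -(compA f') g'g compm1.
by rewrite compA -(compA g) ff' compm1.
Qed.

Definition inverse (a b : C) (f : hom a b) (fI : is_iso f) : hom b a :=
  projT1 (cid fI).

Lemma inverseK (a b : C) (f : hom a b) (fI : is_iso f) :
  inverse fI ∘ f = idm a.
Proof. by rewrite /inverse; case: (cid fI) => g []. Qed.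

Lemma inverseVK (a b : C) (f : hom a b) (fI : is_iso f) :
  f ∘ inverse fI = idm b.
Proof. by rewrite /inverse; case: (cid fI) => g []. Qed.

Lemma iso_epi (a b c : C) (f : hom a b) (g g' : hom b c) :
  is_iso f -> g ∘ f = g' ∘ f -> g = g'.
Proof.
by move=> [h [_ fh]] E; rewrite -(compm1 g) -(compm1 g') -fh !compA E.
Qed.

(** The diagram chase common to associativity and the right unit: e, e' and d' are casts along
    equalities of words, l, s, l', s' structure maps, t and t' coherence maps, and I is an
    interpreted diagram. *)
Lemma conj_transport (x y x' y' m m' n n' : C)
    (I : hom x y) (e : hom x' x) (e' : hom y y') (d' : hom y' y)
    (l : hom m x') (s : hom n x) (t : hom m n) (l' : hom m' y')
    (s' : hom n' y) (t' : hom m' n') (f : hom n n') (g : hom m m') :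
  e ∘ l = s ∘ t -> d' ∘ l' = s' ∘ t' -> e' ∘ d' = idm y' ->
  I ∘ s = s' ∘ f -> t' ∘ g = f ∘ t -> e' ∘ I ∘ e ∘ l = l' ∘ g.
Proof.
move=> E1 E2 E3 E4 E5; rewrite -compA E1 compA -(compA e') E4.
rewrite -!compA -E5 (compA s') -E2 !compA E3 comp1m //.
Qed.

End IsoTheory.

Lemma is_iso_tens (k : fieldType) (C : linMonCat k) (a b c d : C)
    (f : hom a b) (g : hom c d) :
  is_iso f -> is_iso g -> is_iso (f ⊗ g).
Proof.
move=> [f' [f'f ff']] [g' [g'g gg']]; exists (f' ⊗ g').
by rewrite -!tensm_comp f'f ff' g'g gg' !tensm_id.
Qed.


(** * Objects and labels of their basis vectors *)

Section Functor.
Variables (k : fieldType) (q : k).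
Hypothesis q_neq0 : q != 0.
Hypothesis q_sq : q - q^-1 != 0.

Local Notation D := (genMonCat q_neq0 q_sq).
Local Notation word := (seq color).
Local Notation cob := (color_ob q_neq0 q_sq).
Local Notation ix a := (idx (sval a)).

(* [ob_of [:: c]] is [color_ob c] on the nose, as [extends_generators] wants *)
Fixpoint ob_of (u : word) : D :=
  match u with
  | [::] => tunit D
  | c :: u' => if u' is _ :: _ then tens (cob c) (ob_of u') else cob c
  end.

Definition label_color c : ix (cob c) -> seq bool :=
  match c return ix (cob c) -> seq bool with
  | red => fun i => [:: i]
  | blue => fun _ => [::]
  end.

Fixpoint label u : ix (ob_of u) -> seq bool :=
  match u return ix (ob_of u) -> seq bool with
  | [::] => fun _ => [::]
  | c :: u' =>
    match u' return (ix (ob_of u') -> seq bool) ->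
                    ix (ob_of (c :: u')) -> seq bool with
    | [::] => fun _ => @label_color c
    | d :: u'' => fun l p => label_color p.1 ++ l p.2
    end (label (u := u'))
  end.

Definition tlabel (a b : D) (la : ix a -> seq bool) (lb : ix b -> seq bool) :
    ix (tens a b) -> seq bool := fun p => la p.1 ++ lb p.2.

(* Labels determine basis vectors of [ob_of u], so two based maps into [ob_of u]
   are equal; this yields all coherence equations. *)
Definition based (a b : D) (la : ix a -> seq bool) (lb : ix b -> seq bool)
    (f : hom a b) :=
  forall i, exists2 j, rmap f (bvec k i) = bvec k j & lb j = la i.

Lemma based_uniq (a b : D) la (lb : ix b -> seq bool) (f g : hom a b) :
  injective lb -> based la lb f -> based la lb g -> f = g.
Proof.
move=> lbI fB gB; apply/rhom_eqP/lfun_bvecP => i.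
by have [j -> Ej] := fB i; have [j' -> Ej'] := gB i; rewrite (lbI j j') // Ej Ej'.
Qed.

Lemma based_id (a : D) (la : ix a -> seq bool) : based la la (idm a).
Proof. by move=> i; exists i; rewrite //= id_lfunE. Qed.

Lemma based_comp (a b c : D) la (lb : ix b -> seq bool) (lc : ix c -> seq bool)
    (g : hom b c) (f : hom a b) :
  based lb lc g -> based la lb f -> based la lc (g ∘ f).
Proof.
move=> gB fB i; have [j Ej lj] := fB i; have [l El ll] := gB j.
by exists l; rewrite ?ll //= comp_lfunE Ej El.
Qed.

Lemma based_tens (a b c d : D) la (lb : ix b -> seq bool) lc
    (ld : ix d -> seq bool) (f : hom a b) (g : hom c d) :
  based la lb f -> based lc ld g -> based (tlabel la lc) (tlabel lb ld) (f ⊗ g).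
Proof.
move=> fB gB [i i']; have [j Ej lj] := fB i; have [j' Ej' lj'] := gB i'.
exists (j, j'); last by rewrite /tlabel /= lj lj'.
by rewrite /= !bvec_pair tensfE Ej Ej'.
Qed.

Lemma based_assoc (a b c : D) (la : ix a -> seq bool) (lb : ix b -> seq bool)
    (lc : ix c -> seq bool) :
  based (tlabel (tlabel la lb) lc) (tlabel la (tlabel lb lc)) (assoc a b c).
Proof.
move=> [[i j] l]; exists (i, (j, l)); last by rewrite /tlabel /= catA.
by rewrite /= !bvec_pair tassocE.
Qed.

Lemma based_lunit (a : D) (la : ix a -> seq bool) :
  based (tlabel (label (u := [::])) la) la (lunit a).
Proof.
by move=> [[] i]; exists i; rewrite //= bvec_pair tlunitE ffunE scale1r.
Qed.

Lemma based_runit (a : D) (la : ix a -> seq bool) :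
  based (tlabel la (label (u := [::]))) la (runit a).
Proof.
move=> [i []]; exists i; last by rewrite /tlabel /= cats0.
by rewrite /= bvec_pair trunitE ffunE scale1r.
Qed.

Lemma label_color_size c i j : size (@label_color c i) = size (@label_color c j).
Proof. by case: c i j. Qed.

Lemma label_color_inj c : injective (@label_color c).
Proof. by case: c => [i j []|[] []]. Qed.

Lemma label_inj u : injective (@label u).
Proof.
elim: u => [|c [|d u] IH]; [by move=> [] []|exact: label_color_inj|].
move=> [i i'] [j j'] /eqP /=; rewrite eqseq_cat; last exact: label_color_size.
by move=> /andP[/eqP/label_color_inj -> /eqP/IH ->].
Qed.

Lemma ob_coherence (a : D) (la : ix a -> seq bool) u (f g : hom a (ob_of u)) :
  based la (@label u) f -> based la (@label u) g -> f = g.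
Proof. exact: based_uniq (@label_inj u). Qed.

(** * Structure maps of the functor *)

(** A one-letter word carries no unit factor, so prefixing a letter to the empty word must use the
    right unitor. *)
Definition kons c u : hom (tens (cob c) (ob_of u)) (ob_of (c :: u)) :=
  match u return hom (tens (cob c) (ob_of u)) (ob_of (c :: u)) with
  | [::] => runit (cob c)
  | d :: u' => idm (ob_of [:: c, d & u'])
  end.

Lemma kons_based c u : based (tlabel (@label_color c) (@label u))
  (@label (c :: u)) (kons c u).
Proof.
case: u => [|d u] /=; first exact: based_runit.
exact: based_id.
Qed.

Lemma kons_iso c u : is_iso (kons c u).
Proof. by case: u => [|d u] /=; [exact: runit_iso|exact: is_iso_id]. Qed.

Fixpoint merge u v : hom (tens (ob_of u) (ob_of v)) (ob_of (u ++ v)) :=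
  match u return hom (tens (ob_of u) (ob_of v)) (ob_of (u ++ v)) with
  | [::] => lunit (ob_of v)
  | c :: u' =>
    match u' return hom (tens (ob_of u') (ob_of v)) (ob_of (u' ++ v)) ->
      hom (tens (ob_of (c :: u')) (ob_of v)) (ob_of (c :: u' ++ v)) with
    | [::] => fun _ => kons c v
    | d :: u'' => fun m => (idm (cob c) ⊗ m) ∘
        assoc (cob c) (ob_of (d :: u'')) (ob_of v)
    end (merge u' v)
  end.

Lemma merge_based u v :
  based (tlabel (@label u) (@label v)) (@label (u ++ v)) (merge u v).
Proof.
elim: u => [|c [|d u] IH]; [exact: based_lunit|exact: kons_based|].
have B := based_comp (based_tens (based_id (@label_color c)) IH)
  (based_assoc (@label_color c) (@label (d :: u)) (@label v)).
exact: B.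
Qed.

Lemma merge_iso u v : is_iso (merge u v).
Proof.
elim: u => [|c [|d u] IH]; [exact: lunit_iso|exact: kons_iso|].
apply: is_iso_comp; last exact: assoc_iso.
by apply: is_iso_tens IH; exact: is_iso_id.
Qed.

Local Notation unmerge u v := (inverse (merge_iso u v)).

(** * Interpretation of terms *)

Fixpoint interp_rec u v (f : tm k u v) : hom (ob_of u) (ob_of v) :=
  match f in tm _ u v return @hom k D (ob_of u) (ob_of v) with
  | tm_id u => idm (ob_of u)
  | tm_comp _ _ _ g f => interp_rec g ∘ interp_rec f
  | tm_tens u v u' v' f g =>
      merge v v' ∘ (interp_rec f ⊗ interp_rec g) ∘ unmerge u u'
  | tm_zero _ _ => 0
  | tm_add _ _ f g => interp_rec f + interp_rec g
  | tm_scale _ _ t f => t *: interp_rec f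
  | tm_cap c => cap_hat q_neq0 q_sq c
  | tm_cup c => cup_hat q_neq0 q_sq c
  | tm_X => X_hat q_neq0 q_sq
  | tm_Y => Y_hat q_neq0 q_sq
  end.

(* locked, as rewriting would otherwise unfold it *)
Fact interp_key : unit. Proof. exact: tt. Qed.
Definition interp u v (f : tm k u v) := locked_with interp_key (interp_rec f).

Lemma interpE u v (f : tm k u v) : interp f = interp_rec f.
Proof. by rewrite /interp unlock. Qed.

Lemma interp_id u : interp (tm_id k u) = idm (ob_of u).
Proof. by rewrite interpE. Qed.

Lemma interp_comp u v w (g : tm k v w) (f : tm k u v) :
  interp (tm_comp g f) = interp g ∘ interp f.
Proof. by rewrite !interpE. Qed.

Lemma interp_tens u v u' v' (f : tm k u v) (g : tm k u' v') :
  interp (tm_tens f g) ∘ merge u u' = merge v v' ∘ (interp f ⊗ interp g).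
Proof.
rewrite !interpE; set m := merge u u'.
rewrite -[LHS]/(merge v v' ∘ (interp_rec f ⊗ interp_rec g) ∘ unmerge u u' ∘ m).
by rewrite -compA inverseK compm1.
Qed.

Lemma interp_zero u v : interp (tm_zero k u v) = 0.
Proof. by rewrite interpE. Qed.

Lemma interp_add u v (f g : tm k u v) :
  interp (tm_add f g) = interp f + interp g.
Proof. by rewrite !interpE. Qed.

Lemma interp_scale u v t (f : tm k u v) :
  interp (tm_scale t f) = t *: interp f.
Proof. by rewrite !interpE. Qed.

Lemma interp_cap c : interp (tm_cap k c) = cap_hat q_neq0 q_sq c.
Proof. by rewrite interpE. Qed.

Lemma interp_cup c : interp (tm_cup k c) = cup_hat q_neq0 q_sq c.
Proof. by rewrite interpE. Qed.

Lemma interp_X : interp (tm_X k) = X_hat q_neq0 q_sq.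
Proof. by rewrite interpE. Qed.

Lemma interp_Y : interp (tm_Y k) = Y_hat q_neq0 q_sq.
Proof. by rewrite interpE. Qed.

Lemma interp_cast u u' v v' (eu : u = u') (ev : v = v') (f : tm k u v) :
  interp (tm_cast eu ev f) =
  eqhom (congr1 ob_of ev) ∘ interp f ∘ eqhom (congr1 ob_of (esym eu)).
Proof.
by case: u' / eu; case: v' / ev; rewrite compm1 comp1m.
Qed.

Lemma eqhom_based u v (e : u = v) :
  based (@label u) (@label v) (eqhom (congr1 ob_of e)).
Proof. by case: v / e; apply: based_id. Qed.


Definition merge3l u v w :
    hom (tens (tens (ob_of u) (ob_of v)) (ob_of w)) (ob_of ((u ++ v) ++ w)) :=
  merge (u ++ v) w ∘ (merge u v ⊗ idm (ob_of w)).

Definition merge3r u v w :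
    hom (tens (ob_of u) (tens (ob_of v) (ob_of w))) (ob_of (u ++ v ++ w)) :=
  merge u (v ++ w) ∘ (idm (ob_of u) ⊗ merge v w).

Lemma merge_nil v : merge [::] v = lunit (ob_of v). Proof. by []. Qed.
Lemma merge1 c v : merge [:: c] v = kons c v. Proof. by []. Qed.
Lemma merge2 c d v : merge [:: c; d] v =
  kons c (d :: v) ∘ (idm (cob c) ⊗ kons d v) ∘ assoc (cob c) (cob d) (ob_of v).
Proof.
by rewrite -[kons c (d :: v)]/(idm (ob_of [:: c, d & v])) -[RHS]compA comp1m.
Qed.

Local Opaque merge.

Lemma merge3l_iso u v w : is_iso (merge3l u v w).
Proof.
apply: is_iso_comp; first exact: merge_iso.
by apply: is_iso_tens; [exact: merge_iso|exact: is_iso_id].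
Qed.

Lemma merge3E u v w : eqhom (congr1 ob_of (esym (catA u v w))) ∘ merge3l u v w =
  merge3r u v w ∘ assoc (ob_of u) (ob_of v) (ob_of w).
Proof.
apply: (@ob_coherence _ (tlabel (tlabel (@label u) (@label v)) (@label w))).
  apply: based_comp; first exact: eqhom_based.
  apply: based_comp; first exact: merge_based.
  by apply: based_tens; [exact: merge_based|exact: based_id].
apply: based_comp; last exact: based_assoc.
apply: based_comp; first exact: merge_based.
by apply: based_tens; [exact: based_id|exact: merge_based].
Qed.

Lemma merge3lE u v w : merge3l u v w =
  merge (u ++ v) w ∘ (merge u v ⊗ idm (ob_of w)).
Proof. by []. Qed.

Lemma merge3rE u v w : merge3r u v w =
  merge u (v ++ w) ∘ (idm (ob_of u) ⊗ merge v w).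
Proof. by []. Qed.

Local Opaque merge3l merge3r.

Lemma interp_merge3l u v u' v' u'' v'' (f : tm k u v) (g : tm k u' v')
    (h : tm k u'' v'') :
  interp (tm_tens (tm_tens f g) h) ∘ merge3l u u' u'' =
  merge3l v v' v'' ∘ ((interp f ⊗ interp g) ⊗ interp h).
Proof.
rewrite !merge3lE compA interp_tens -!compA; congr (_ ∘ _).
rewrite -(tensm_comp (interp (tm_tens f g)) (merge u u')) interp_tens.
by rewrite compm1 -[in LHS](comp1m (interp h)) tensm_comp.
Qed.

Lemma interp_merge3r u v u' v' u'' v'' (f : tm k u v) (g : tm k u' v')
    (h : tm k u'' v'') :
  interp (tm_tens f (tm_tens g h)) ∘ merge3r u u' u'' =
  merge3r v v' v'' ∘ (interp f ⊗ (interp g ⊗ interp h)).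
Proof.
rewrite !merge3rE compA interp_tens -!compA; congr (_ ∘ _).
rewrite -(tensm_comp (interp f) (idm _) (interp (tm_tens g h))) interp_tens.
by rewrite compm1 -[in LHS](comp1m (interp f)) tensm_comp.
Qed.

Lemma eqhomK (a b : D) (e : a = b) (e' : b = a) :
  eqhom e' ∘ eqhom e = idm a.
Proof. by case: b / e e' => e; rewrite (Prop_irrelevance e erefl) comp1m. Qed.

Lemma interp_tensA u v u' v' u'' v'' (f : tm k u v) (g : tm k u' v')
    (h : tm k u'' v'') :
  interp (tm_cast (catA u u' u'') (catA v v' v'') (tm_tens f (tm_tens g h))) =
  interp (tm_tens (tm_tens f g) h).
Proof.
apply: (iso_epi (merge3l_iso u u' u'')).
rewrite interp_cast interp_merge3l.
apply: conj_transport (merge3E _ _ _) (merge3E _ _ _) (eqhomK _ _) _ _.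
  exact: interp_merge3r.
exact: assoc_nat.
Qed.

Lemma interp_tens1m u v (f : tm k u v) :
  interp (tm_tens (tm_id k [::]) f) = interp f.
Proof.
apply: (iso_epi (merge_iso [::] u)).
by rewrite interp_tens interp_id; exact: lunit_nat.
Qed.

Lemma interp_tensm1 u v (f : tm k u v) :
  interp (tm_cast (cats0 u) (cats0 v) (tm_tens f (tm_id k [::]))) = interp f.
Proof.
have E w : merge w [::] = eqhom (congr1 ob_of (esym (cats0 w))) ∘ runit (ob_of w).
  apply: (@ob_coherence _ (tlabel (@label w) (@label [::]))).
    exact: merge_based.
  by apply: based_comp; [exact: eqhom_based|exact: based_runit].
rewrite interp_cast; apply: (iso_epi (runit_iso (ob_of u))).
rewrite -[RHS]runit_nat.
apply: (conj_transport (d' := eqhom (congr1 ob_of (esym (cats0 v))))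
  (t := idm _) (t' := idm _)); last by rewrite comp1m compm1.
- by rewrite compm1; apply/esym/E.
- by rewrite compm1; apply/esym/E.
- exact: eqhomK.
- by apply: etrans (interp_tens f (tm_id k [::])) _; rewrite interp_id.
Qed.

(** * Evaluation of diagrams on vectors *)

Definition ap (a b : D) (f : hom a b) (v : sp k (ix a)) : sp k (ix b) :=
  rmap f v.

Lemma ap_id (a : D) v : ap (idm a) v = v.
Proof. exact: id_lfunE. Qed.

Lemma ap_comp (a b c : D) (g : hom b c) (f : hom a b) v :
  ap (g ∘ f) v = ap g (ap f v).
Proof. exact: comp_lfunE. Qed.

Lemma ap_tens (a b c d : D) (f : hom a b) (g : hom c d) u v :
  ap (f ⊗ g) (tensv u v) = tensv (ap f u) (ap g v).
Proof. exact: tensfE. Qed.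

Lemma apD (a b : D) (f : hom a b) u v : ap f (u + v) = ap f u + ap f v.
Proof. exact: linearD. Qed.

Lemma apZ (a b : D) (f : hom a b) t v : ap f (t *: v) = t *: ap f v.
Proof. exact: linearZ. Qed.

Lemma apN (a b : D) (f : hom a b) v : ap f (- v) = - ap f v.
Proof. exact: linearN. Qed.

Lemma ap0 (a b : D) (f : hom a b) : ap f 0 = 0.
Proof. exact: linear0. Qed.

Lemma ap_add (a b : D) (f g : hom a b) v : ap (f + g) v = ap f v + ap g v.
Proof. exact: add_lfunE. Qed.

Lemma ap_scale (a b : D) t (f : hom a b) v : ap (t *: f) v = t *: ap f v.
Proof. exact: scale_lfunE. Qed.

Lemma ap_zero (a b : D) v : ap (0 : hom a b) v = 0.
Proof. exact: zero_lfunE. Qed.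

Lemma ap_ext (a b : D) (f g : hom a b) : ap f =1 ap g -> f = g.
Proof. exact: rhomP. Qed.

Lemma ap_assoc (a b c : D) u v w :
  ap (assoc a b c) (tensv (tensv u v) w) = tensv u (tensv v w).
Proof. exact: tassocE. Qed.

Lemma ap_lunit (a : D) (u : sp k unit) v : ap (lunit a) (tensv u v) = u tt *: v.
Proof. exact: tlunitE. Qed.

Lemma ap_runit (a : D) (u : sp k unit) v : ap (runit a) (tensv v u) = u tt *: v.
Proof. exact: trunitE. Qed.

(** The vector a ⊗ v read in the object of [c :: u], uniformly in u: the exceptional shape of
    one-letter words stays hidden in [kons]. *)
Definition star c u (a : sp k (ix (cob c))) (v : sp k (ix (ob_of u))) :
  sp k (ix (ob_of (c :: u))) := ap (kons c u) (tensv a v).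

Lemma starDr c u a v v' : @star c u a (v + v') = star a v + star a v'.
Proof. by rewrite /star tensvDr apD. Qed.
Lemma starZl c u t a v : @star c u (t *: a) v = t *: star a v.
Proof. by rewrite /star tensvZl apZ. Qed.
Lemma starZr c u t a v : @star c u a (t *: v) = t *: star a v.
Proof. by rewrite /star tensvZr apZ. Qed.
Lemma starNr c u a v : @star c u a (- v) = - star a v.
Proof. by rewrite -scaleN1r starZr scaleN1r. Qed.
Lemma star0r c u a : @star c u a 0 = 0.
Proof. by rewrite -(scale0r 0) starZr scale0r. Qed.

Lemma star_ext c u (b : D) (f g : hom (ob_of (c :: u)) b) :
  (forall i v, ap f (star (bvec k i) v) = ap g (star (bvec k i) v)) -> f = g.
Proof.
move=> fg; apply: (iso_epi (kons_iso c u)); apply/rhom_eqP/lfun_bvecP => -[i j].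
by rewrite bvec_pair; have := fg i (bvec k j); rewrite -!ap_comp.
Qed.

Lemma star_cons1 c (a : sp k (ix (cob c))) (v : sp k unit) :
  @star c [::] a v = v tt *: a.
Proof. exact: ap_runit. Qed.

Lemma star_cons2 c d u a (v : sp k (ix (ob_of (d :: u)))) :
  @star c (d :: u) a v = tensv a v.
Proof. exact: ap_id. Qed.

Lemma interp_star c u v (f : tm k u v) a w :
  ap (interp (tm_tens (tm_id k [:: c]) f)) (@star c u a w) =
  star a (ap (interp f) w).
Proof.
rewrite /star -!merge1 -(ap_comp _ (merge _ _)) interp_tens interp_id.
by rewrite ap_comp ap_tens ap_id.
Qed.

Lemma merge2E c d u a b w :
  ap (merge [:: c; d] u) (tensv (tensv a b) w) =
  @star c (d :: u) a (@star d u b w).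
Proof. by rewrite merge2 !ap_comp ap_assoc ap_tens ap_id. Qed.

Lemma interp_cap_star c u a b w :
  ap (interp (tm_tens (tm_cap k c) (tm_id k u)))
    (@star c (c :: u) a (@star c u b w)) =
  ap (cap_hat q_neq0 q_sq c) (tensv a b) tt *: w.
Proof.
rewrite -merge2E -(ap_comp _ (merge _ _)) interp_tens interp_id ap_comp ap_tens.
by rewrite ap_id merge_nil ap_lunit interp_cap.
Qed.

Lemma interp_gen2 c d c' d' u (g : tm k [:: c; d] [:: c'; d']) a b w :
  ap (interp (tm_tens g (tm_id k u))) (@star c (d :: u) a (@star d u b w)) =
  ap (merge [:: c'; d'] u) (tensv (ap (interp g) (tensv a b)) w).
Proof.
rewrite -merge2E -(ap_comp _ (merge _ _)) interp_tens interp_id ap_comp ap_tens.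
by rewrite ap_id.
Qed.

Lemma interp_cup_star c u w :
  ap (interp (tm_tens (tm_cup k c) (tm_id k u))) w =
  ap (merge [:: c; c] u) (tensv (ap (cup_hat q_neq0 q_sq c) (bvec k tt)) w).
Proof.
have {1}-> : w = ap (merge [::] u) (tensv (bvec k tt) w).
  by rewrite merge_nil ap_lunit ffunE eqxx scale1r.
rewrite -(ap_comp _ (merge _ _)) interp_tens interp_id ap_comp ap_tens.
by rewrite ap_id interp_cup.
Qed.

Local Notation vx := (bvec k true).
Local Notation vy := (bvec k false).
Local Notation e1 := (bvec k tt).

Local Notation cup_hat c := (cup_hat q_neq0 q_sq c).
Local Notation cap_hat c := (cap_hat q_neq0 q_sq c).

Lemma cup_hat_red : ap (cup_hat red) e1 = tensv vx vy - q *: tensv vy vx.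
Proof. exact: bmap_bvec. Qed.

Lemma cup_hat_blue : ap (cup_hat blue) e1 = tensv e1 e1.
Proof. exact: bmap_bvec. Qed.

Lemma cap_hat_red (i j : bool) : ap (cap_hat red) (tensv (bvec k i) (bvec k j)) =
  (if i && ~~ j then - q^-1 else if ~~ i && j then 1 else 0) *: e1.
Proof.
rewrite -bvec_pair; apply: etrans (bmap_bvec _ _) _.
by case: i; case: j; rewrite /= ?scale0r ?scale1r.
Qed.

Lemma cap_hat_blue : ap (cap_hat blue) (tensv e1 e1) = e1.
Proof. by rewrite -bvec_pair; exact: bmap_bvec. Qed.

Lemma X_hatE (i : bool) :
  ap (X_hat q_neq0 q_sq) (tensv (bvec k i) e1) =
  (if i then 1 else -1) *: tensv e1 (bvec k i).
Proof.
rewrite -bvec_pair; apply: etrans (bmap_bvec _ _) _.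
by case: i; rewrite /= ?scale1r ?scaleN1r.
Qed.

Lemma Y_hatE (i : bool) :
  ap (Y_hat q_neq0 q_sq) (tensv e1 (bvec k i)) =
  (if i then 1 else -1) *: tensv (bvec k i) e1.
Proof.
rewrite -bvec_pair; apply: etrans (bmap_bvec _ _) _.
by case: i; rewrite /= ?scale1r ?scaleN1r.
Qed.

Lemma merge2D c d u (s t : sp k (ix (tens (cob c) (cob d)))) w :
  ap (merge [:: c; d] u) (tensv (s + t) w) =
  ap (merge [:: c; d] u) (tensv s w) + ap (merge [:: c; d] u) (tensv t w).
Proof. by rewrite tensvDl apD. Qed.
Lemma merge2Z c d u x (s : sp k (ix (tens (cob c) (cob d)))) w :
  ap (merge [:: c; d] u) (tensv (x *: s) w) =
  x *: ap (merge [:: c; d] u) (tensv s w).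
Proof. by rewrite tensvZl apZ. Qed.

Lemma cup_red u w : ap (interp (tm_tens (tm_cup k red) (tm_id k u))) w =
  @star red (red :: u) vx (@star red u vy w) -
  q *: @star red (red :: u) vy (@star red u vx w).
Proof.
by rewrite interp_cup_star cup_hat_red -scaleNr merge2D merge2Z !merge2E scaleNr.
Qed.

Lemma cup_blue u w : ap (interp (tm_tens (tm_cup k blue) (tm_id k u))) w =
  @star blue (blue :: u) e1 (@star blue u e1 w).
Proof. by rewrite interp_cup_star cup_hat_blue merge2E. Qed.

Lemma cap_red u (i j : bool) w : ap (interp (tm_tens (tm_cap k red) (tm_id k u)))
    (@star red (red :: u) (bvec k i) (@star red u (bvec k j) w)) =
  (if i && ~~ j then - q^-1 else if ~~ i && j then 1 else 0) *: w.
Proof.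
by rewrite interp_cap_star cap_hat_red !ffunE eqxx [_ *: 1]mulr1.
Qed.

Lemma cap_blue u w : ap (interp (tm_tens (tm_cap k blue) (tm_id k u)))
    (@star blue (blue :: u) e1 (@star blue u e1 w)) = w.
Proof. by rewrite interp_cap_star cap_hat_blue ffunE eqxx scale1r. Qed.

Lemma Xstar u (i : bool) w : ap (interp (tm_tens (tm_X k) (tm_id k u)))
    (@star red (blue :: u) (bvec k i) (@star blue u e1 w)) =
  (if i then 1 else -1) *: @star blue (red :: u) e1 (@star red u (bvec k i) w).
Proof. by rewrite interp_gen2 interp_X X_hatE merge2Z merge2E. Qed.

Lemma Ystar u (i : bool) w : ap (interp (tm_tens (tm_Y k) (tm_id k u)))
    (@star blue (red :: u) e1 (@star red u (bvec k i) w)) =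
  (if i then 1 else -1) *: @star red (blue :: u) (bvec k i) (@star blue u e1 w).
Proof. by rewrite interp_gen2 interp_Y Y_hatE merge2Z merge2E. Qed.

Lemma star_bare c d a b : @star c [:: d] a (@star d [::] b e1) = tensv a b.
Proof. by rewrite star_cons2 star_cons1 ffunE eqxx scale1r. Qed.

(** * The defining relations hold in the target *)

Lemma interp_zigzag_l c : interp (tm_comp (tm_tens (tm_cap k c) (tm_id k [:: c]))
   (tm_tens (tm_id k [:: c]) (tm_cup k c))) = idm (ob_of [:: c]).
Proof.
apply: star_ext => i v; rewrite interp_comp ap_comp interp_star (sp_unit v).
rewrite interp_cup apZ !starZr !apZ ap_id; congr (_ *: _).
case: c i => i; last first.
  rewrite cup_hat_blue -(@star_bare blue blue); case: i.
  exact: cap_blue.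
rewrite cup_hat_red -!(@star_bare red red) starDr starNr starZr apD apN apZ.
rewrite !cap_red.
case: i => /=; rewrite ?scale0r ?scaler0 ?oppr0 ?addr0 ?add0r ?scale1r //.
(* The coefficient -q of the cup meets the value -q^-1 of the cap. *)
by rewrite scaleNr scalerN opprK scalerA mulfV ?scale1r.
Qed.

Lemma interp_zigzag_r c : interp (tm_comp (tm_tens (tm_id k [:: c]) (tm_cap k c))
   (tm_tens (tm_cup k c) (tm_id k [:: c]))) = idm (ob_of [:: c]).
Proof.
apply: star_ext => i v; rewrite interp_comp ap_comp (sp_unit v).
rewrite !starZr !apZ ap_id; congr (_ *: _).
case: c i => i; last first.
  rewrite cup_blue interp_star interp_cap; case: i.
  by rewrite star_bare cap_hat_blue.
rewrite cup_red apD apN apZ !interp_star interp_cap !star_bare !cap_hat_red.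
case: i => /=; rewrite ?scale0r ?star0r ?scaler0 ?oppr0 ?addr0 ?add0r ?scale1r //.
by rewrite starZr scaleNr scalerN opprK scalerA mulfV ?scale1r.
Qed.

Lemma unit_ext (a : D) (f g : hom (ob_of [::]) a) : ap f e1 = ap g e1 -> f = g.
Proof. by move=> fg; apply/rhom_eqP/lfun_bvecP => -[]; exact: fg. Qed.

Lemma star_ext2 c d (b : D) (f g : hom (ob_of [:: c; d]) b) :
  (forall i j, ap f (tensv (bvec k i) (bvec k j)) =
               ap g (tensv (bvec k i) (bvec k j))) -> f = g.
Proof.
by move=> fg; apply/rhom_eqP/lfun_bvecP => -[i j]; rewrite bvec_pair; exact: fg.
Qed.

Lemma interp_circle_red : interp (tm_comp (tm_cap k red) (tm_cup k red)) =
  interp (tm_scale (- (q + q^-1)) (tm_id k [::])).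
Proof.
apply: unit_ext.
rewrite interp_comp ap_comp interp_scale interp_id ap_scale ap_id.
rewrite interp_cap interp_cup cup_hat_red apD apN apZ !cap_hat_red /= scale1r.
by rewrite -scaleNr -scalerDl opprD addrC.
Qed.

Lemma interp_circle_blue : interp (tm_comp (tm_cap k blue) (tm_cup k blue)) =
  interp (tm_id k [::]).
Proof.
apply: unit_ext; rewrite interp_comp ap_comp interp_id ap_id.
by rewrite interp_cap interp_cup cup_hat_blue cap_hat_blue.
Qed.

Lemma interp_cupcap_blue : interp (tm_comp (tm_cup k blue) (tm_cap k blue)) =
  interp (tm_id k [:: blue; blue]).
Proof.
apply: star_ext2 => -[] []; rewrite interp_comp ap_comp interp_id ap_id.
by rewrite interp_cap interp_cup cap_hat_blue cup_hat_blue.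
Qed.

Lemma interp_XY :
  interp (tm_comp (tm_X k) (tm_Y k)) = interp (tm_id k [:: blue; red]).
Proof.
apply: star_ext2 => -[] i; rewrite interp_comp ap_comp interp_id ap_id.
rewrite interp_X interp_Y Y_hatE apZ X_hatE scalerA.
by case: i; rewrite ?mulr1 ?mulrNN ?mulr1 scale1r.
Qed.

Lemma interp_YX :
  interp (tm_comp (tm_Y k) (tm_X k)) = interp (tm_id k [:: red; blue]).
Proof.
apply: star_ext2 => i []; rewrite interp_comp ap_comp interp_id ap_id.
rewrite interp_X interp_Y X_hatE apZ Y_hatE scalerA.
by case: i; rewrite ?mulr1 ?mulrNN ?mulr1 scale1r.
Qed.

Lemma star_ext3 c d e (b : D) (f g : hom (ob_of [:: c; d; e]) b) :
  (forall i j l,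
     ap f (@star c [:: d; e] (bvec k i)
            (@star d [:: e] (bvec k j) (@star e [::] (bvec k l) e1))) =
     ap g (@star c [:: d; e] (bvec k i)
            (@star d [:: e] (bvec k j) (@star e [::] (bvec k l) e1)))) ->
  f = g.
Proof.
move=> fg; apply/rhom_eqP/lfun_bvecP => -[i [j l]].
by have := fg i j l; rewrite star_bare star_cons2 -!bvec_pair.
Qed.

(** Crossing a blue strand costs a sign on y. The red cap is nonzero only if exactly one of its two
    entries is y, and the two sides let the blue strand cross different entries; hence the minus
    sign. *)
Lemma interp_slide_red :
  interp (tm_comp (tm_tens (tm_cap k red) (tm_id k [:: blue]))
                  (tm_tens (tm_id k [:: red]) (tm_Y k))) =
  interp (tm_scale (-1) (tm_comp (tm_tens (tm_id k [:: blue]) (tm_cap k red))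
                  (tm_tens (tm_X k) (tm_id k [:: red])))).
Proof.
apply: star_ext3 => i [] l.
rewrite interp_scale ap_scale !interp_comp !ap_comp Xstar apZ !interp_star.
rewrite interp_Y interp_cap !star_bare Y_hatE cap_hat_red starZr apZ.
rewrite -(@star_bare red blue) cap_red !starZr.
case: i; case: l; rewrite /= ?scale0r ?scaler0 // !scalerA.
  by rewrite mul1r.
by rewrite mulr1 mulr1 mulN1r opprK.
Qed.

Lemma interp_slide_blue :
  interp (tm_comp (tm_tens (tm_cap k blue) (tm_id k [:: red]))
                  (tm_tens (tm_id k [:: blue]) (tm_X k))) =
  interp (tm_comp (tm_tens (tm_id k [:: red]) (tm_cap k blue))
                  (tm_tens (tm_Y k) (tm_id k [:: blue]))).
Proof.
apply: star_ext3 => -[] i [].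
rewrite !interp_comp !ap_comp Ystar apZ !interp_star.
rewrite interp_X interp_cap !star_bare X_hatE cap_hat_blue starZr apZ.
by rewrite -(@star_bare blue red) cap_blue.
Qed.

Lemma interp_eq u v (f g : tm k u v) : tm_eq q f g -> interp f = interp g.
Proof.
elim=> {u v f g}.
- by [].
- by move=> u v f g _ ->.
- by move=> u v f g h _ -> _ ->.
- by move=> u v w g g' f f' _ E _ E'; rewrite !interp_comp E E'.
- move=> u v u' v' f g f' g' _ E _ E'; apply: (iso_epi (merge_iso _ _)).
  by rewrite !interp_tens E E'.
- by move=> u v f f' g g' _ E _ E'; rewrite !interp_add E E'.
- by move=> u v t f f' _ E; rewrite !interp_scale E.
- by move=> u v f g h; rewrite !interp_add addrA.
- by move=> u v f g; rewrite !interp_add addrC.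
- by move=> u v f; rewrite interp_add interp_zero add0r.
- by move=> u v f; rewrite interp_add interp_scale interp_zero scaleN1r addNr.
- by move=> u v s t f; rewrite !interp_scale scalerA.
- by move=> u v f; rewrite interp_scale scale1r.
- by move=> u v t f g; rewrite !(interp_scale, interp_add) scalerDr.
- by move=> u v s t f; rewrite !(interp_scale, interp_add) scalerDl.
- by move=> u v w z h g f; rewrite !interp_comp compA.
- by move=> u v f; rewrite interp_comp interp_id comp1m.
- by move=> u v f; rewrite interp_comp interp_id compm1.
- move=> u v w t g g' f.
  by rewrite !(interp_comp, interp_add, interp_scale) comp_linear_l.
- move=> u v w t g f f'.
  by rewrite !(interp_comp, interp_add, interp_scale) comp_linear_r.
- move=> u v u' v' t f f' g; apply: (iso_epi (merge_iso _ _)).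
  rewrite interp_tens !(interp_add, interp_scale) tensm_linear_l.
  by rewrite comp_linear_r comp_linear_l !interp_tens.
- move=> u v u' v' t f g g'; apply: (iso_epi (merge_iso _ _)).
  rewrite interp_tens !(interp_add, interp_scale) tensm_linear_r.
  by rewrite comp_linear_r comp_linear_l !interp_tens.
- move=> u v; apply: (iso_epi (merge_iso _ _)).
  by rewrite interp_tens !interp_id tensm_id comp1m compm1.
- move=> u v w u' v' w' g f g' f'; apply: (iso_epi (merge_iso _ _)).
  rewrite interp_tens !interp_comp tensm_comp.
  by rewrite -compA interp_tens !compA interp_tens.
- by move=> *; apply: interp_tensA.
- by move=> *; apply: interp_tens1m.
- by move=> *; apply: interp_tensm1.
- exact: interp_XY.
- exact: interp_YX.
- by move=> c; rewrite interp_id; exact: interp_zigzag_l.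
- by move=> c; rewrite interp_id; exact: interp_zigzag_r.
- exact: interp_circle_red.
- exact: interp_circle_blue.
- exact: interp_cupcap_blue.
- exact: interp_slide_red.
- exact: interp_slide_blue.
Qed.

(** * The monoidal functor *)

Definition phi_map u v (f : mor q u v) : hom (ob_of u) (ob_of v) :=
  interp (rep_tm f).

Lemma phi_cls u v (f : tm k u v) : phi_map (cls q f) = interp f.
Proof. exact/interp_eq/rep_cls. Qed.

Lemma phi_linear u v : linear (@phi_map u v).
Proof.
move=> t f g; rewrite -(rep_tmK f) -(rep_tmK g) clsZ clsD !phi_cls.
by rewrite interp_add interp_scale.
Qed.

Lemma phi_id u : phi_map (cls q (tm_id k u)) = idm (ob_of u).
Proof. by rewrite phi_cls interp_id. Qed.

Lemma phi_comp u v w (g : mor q v w) (f : mor q u v) :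
  phi_map (mor_comp g f) = phi_map g ∘ phi_map f.
Proof. by rewrite -(rep_tmK f) -(rep_tmK g) cls_comp !phi_cls interp_comp. Qed.

Definition Phi_fun : linFunctor (presMonCat q) D :=
  @LinFunctor k (presMonCat q) D ob_of phi_map phi_linear phi_id phi_comp.

Lemma merge_nat u v u' v' (f : mor q u u') (g : mor q v v') :
  merge u' v' ∘ (phi_map f ⊗ phi_map g) =
  phi_map (mor_tens f g) ∘ merge u v.
Proof.
by rewrite -(rep_tmK f) -(rep_tmK g) cls_tens !phi_cls interp_tens.
Qed.

Lemma phi_eqmor u v (e : u = v) :
  phi_map (@eqhom k (presCat q) _ _ e) = eqhom (congr1 ob_of e).
Proof. by case: v / e; exact: phi_id. Qed.

Lemma merge_assoc u v w :
  phi_map (pres_assoc q u v w) ∘ merge (u ++ v) w ∘ (merge u v ⊗ idm (ob_of w)) =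
  merge u (v ++ w) ∘ (idm (ob_of u) ⊗ merge v w) ∘ assoc _ _ _.
Proof. by rewrite phi_eqmor -merge3rE -merge3E merge3lE compA. Qed.

Lemma merge_lunit u : phi_map (pres_lunit q u) ∘ merge [::] u ∘
  (idm (tunit D) ⊗ idm (ob_of u)) = lunit (ob_of u).
Proof. by rewrite phi_id comp1m tensm_id compm1 merge_nil. Qed.

Lemma merge_runit u : phi_map (pres_runit q u) ∘ merge u [::] ∘
  (idm (ob_of u) ⊗ idm (tunit D)) = runit (ob_of u).
Proof.
rewrite phi_eqmor tensm_id compm1.
apply: (@ob_coherence _ (tlabel (@label u) (@label [::]))).
  by apply: based_comp; [exact: eqhom_based|exact: merge_based].
exact: based_runit.
Qed.

Definition Phi : linMonFunctor (presMonCat q) D :=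
  @LinMonFunctor k (presMonCat q) D Phi_fun merge merge_iso
    (fun _ _ _ _ f g => merge_nat f g) (idm (tunit D)) (is_iso_id _)
    merge_assoc merge_lunit merge_runit.

Lemma merge11 c d : merge [:: c] [:: d] = idm (tens (cob c) (cob d)).
Proof. by rewrite merge1. Qed.

(** The object of a one-letter word computes to the generating object, so all transports are
    identities, and so is [merge] of two letters. *)
Lemma Phi_extends : extends_generators Phi.
Proof.
exists (fun c => erefl); split=> [c|c||].
- rewrite -[LHS]/(phi_map (cls q (tm_cap k c)) ∘ merge [:: c] [:: c]).
  rewrite -[RHS]/(idm (tunit D) ∘ cap_hat c ∘ (idm (cob c) ⊗ idm (cob c))).
  by rewrite phi_cls interp_cap merge11 tensm_id comp1m !compm1.
- rewrite -[LHS]/(phi_map (cls q (tm_cup k c)) ∘ idm (tunit D)).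
  rewrite -[RHS]/(merge [:: c] [:: c] ∘ (idm (cob c) ⊗ idm (cob c)) ∘ cup_hat c).
  by rewrite phi_cls interp_cup merge11 tensm_id !comp1m compm1.
- rewrite -[LHS]/(phi_map (cls q (tm_X k)) ∘ merge [:: red] [:: blue]).
  rewrite -[RHS]/(merge [:: blue] [:: red] ∘ (idm (cob blue) ⊗ idm (cob red)) ∘
    X_hat q_neq0 q_sq ∘ (idm (cob red) ⊗ idm (cob blue))).
  by rewrite phi_cls interp_X !merge11 !tensm_id !comp1m.
- rewrite -[LHS]/(phi_map (cls q (tm_Y k)) ∘ merge [:: blue] [:: red]).
  rewrite -[RHS]/(merge [:: red] [:: blue] ∘ (idm (cob red) ⊗ idm (cob blue)) ∘
    Y_hat q_neq0 q_sq ∘ (idm (cob blue) ⊗ idm (cob red))).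
  by rewrite phi_cls interp_Y !merge11 !tensm_id !comp1m.
Qed.

End Functor.

(** * Full faithfulness *)

Lemma fully_faithful_equivalence (k : fieldType) (C D : linCat k)
    (F : linFunctor C D) :
  (forall (a b : C) (f g : hom a b), fmap F f = fmap F g -> f = g) ->
  (forall (a b : C) (g : hom (F a) (F b)), exists f, fmap F f = g) ->
  (forall d : D, exists (a : C) (f : hom (F a) d), is_iso f) ->
  is_equivalence F.
Proof.
move=> faith full surj.
pose o d := projT1 (cid (surj d)).
pose e d : hom (F (o d)) d := projT1 (cid (projT2 (cid (surj d)))).
have eI d : is_iso (e d) := projT2 (cid (projT2 (cid (surj d)))).
pose e' d := inverse (eI d).
pose pre a b (g : hom (F a) (F b)) : hom a b := projT1 (cid (full a b g)).
have preK a b g : fmap F (@pre a b g) = g by rewrite /pre; case: (cid _).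
pose gm d d' (f : hom d d') : hom (o d) (o d') := pre _ _ (e' d' ∘ f ∘ e d).
have gmE d d' (f : hom d d') : fmap F (gm d d' f) = e' d' ∘ f ∘ e d.
  exact: preK.
have gm_lin d d' : linear (gm d d').
  move=> t f g; apply: faith; rewrite fmap_linear !gmE.
  by rewrite comp_linear_r comp_linear_l.
have gm_id d : gm d d (idm d) = idm (o d).
  by apply: faith; rewrite gmE fmap_id compm1 inverseK.
have gm_comp a b c (g : hom b c) (f : hom a b) :
    gm a c (g ∘ f) = gm b c g ∘ gm a b f.
  apply: faith; rewrite fmap_comp !gmE -!compA; congr (_ ∘ _).
  by rewrite (compA (e b)) inverseVK comp1m.
exists (LinFunctor gm_lin gm_id gm_comp); split.
  exists (fun a => pre (o (F a)) a (e (F a))); split=> [a|a b f].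
    exists (pre a (o (F a)) (e' (F a))); split; apply: faith;
      by rewrite fmap_comp !preK fmap_id ?inverseK ?inverseVK.
  rewrite -[LHS]/(pre _ _ (e (F b)) ∘ gm _ _ (fmap F f)).
  rewrite -[RHS]/(f ∘ pre _ _ (e (F a))).
  by apply: faith; rewrite !fmap_comp !preK !compA inverseVK comp1m.
exists e; split=> [//|a b f] /=.
by rewrite gmE !compA inverseVK comp1m.
Qed.

Section Faithful.
Variables (k : fieldType) (q : k).
Hypothesis q_neq0 : q != 0.
Hypothesis q_sq : q - q^-1 != 0.

Local Notation D := (genMonCat q_neq0 q_sq).
Local Notation W u := (ob_of q_neq0 q_sq u).
Local Notation Φ f := (phi_map q_neq0 q_sq f).
Local Notation cob := (color_ob q_neq0 q_sq).
Local Notation ix a := (idx (sval a)).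
Local Notation lay c u := (@star k q q_neq0 q_sq c u).
Local Notation vx := (bvec k true).
Local Notation vy := (bvec k false).
Local Notation e1 := (bvec k tt).
Local Notation word := (seq color).
Local Notation mor := (mor q).
Local Notation "1_ u" := (cls q (tm_id k u))
  (at level 8, u at level 2, format "1_ u").
Local Notation cap c := (cls q (tm_cap k c)).
Local Notation cup c := (cls q (tm_cup k c)).
Local Notation ι c := (cls q (tm_id k [:: c])).
Local Notation "g ⊚ f" := (mor_comp g f) (at level 40, left associativity).
Local Notation "f ⊠ g" := (mor_tens f g) (at level 35, right associativity).
Local Notation r := red.
Local Notation b := blue.
Local Notation rn n := (nseq n red).

(** * Splitting vectors by their first tensor factor *)

Lemma phi_star c u v (f : mor u v) a w :
  ap (Φ (ι c ⊠ f)) (lay c u a w) = lay c v a (ap (Φ f) w).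
Proof. by rewrite -(rep_tmK f) cls_tens !phi_cls interp_star. Qed.

Lemma phi_cap_star c u a b w :
  ap (Φ (cap c ⊠ 1_u)) (lay c (c :: u) a (lay c u b w)) =
  ap (cap_hat q_neq0 q_sq c) (tensv a b) tt *: w.
Proof. by rewrite cls_tens phi_cls interp_cap_star. Qed.

Lemma phi_capxx u w :
  ap (Φ (cap r ⊠ 1_u)) (lay r (r :: u) vx (lay r u vx w)) = 0.
Proof. by rewrite cls_tens phi_cls cap_red scale0r. Qed.

Lemma phi_cup u w : ap (Φ (cup r ⊠ 1_u)) w =
  lay r (r :: u) vx (lay r u vy w) - q *: lay r (r :: u) vy (lay r u vx w).
Proof. by rewrite cls_tens phi_cls cup_red. Qed.

Lemma phi_zero u v : Φ (0 : mor u v) = 0.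
Proof.
have := phi_linear q_neq0 q_sq 1 (0 : mor u v) 0.
rewrite scaler0 addr0 => /(congr1 (fun f => f - Φ 0)).
by rewrite scale1r addrK subrr.
Qed.

Lemma phi_add u v (f g : mor u v) : Φ (f + g) = Φ f + Φ g.
Proof. by have := phi_linear q_neq0 q_sq 1 f g; rewrite !scale1r. Qed.

Lemma phi_scale u v t (f : mor u v) : Φ (t *: f) = t *: Φ f.
Proof. by have := phi_linear q_neq0 q_sq t f 0; rewrite phi_zero !addr0. Qed.

Lemma star_red_split u v : exists s t, v = lay r u vx s + lay r u vy t.
Proof.
have [h [hK Kh]] := kons_iso q_neq0 q_sq r u; pose v' := ap h v.
exists [ffun i => v' (true, i)], [ffun i => v' (false, i)].
rewrite /star -apD -[LHS]ap_id -Kh ap_comp -/v'; congr (ap _ _).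
apply/ffunP=> -[[] i]; rewrite !ffunE /= ?ffunE /=.
  by rewrite mul1r mul0r addr0.
by rewrite mul1r mul0r add0r.
Qed.

Lemma star_red_eq0 u s t :
  lay r u vx s + lay r u vy t = 0 -> s = 0 /\ t = 0.
Proof.
have [h [hK Kh]] := kons_iso q_neq0 q_sq r u.
rewrite /star -apD => /(congr1 (ap h)); rewrite -ap_comp hK ap_id ap0 => /ffunP E.
split; apply/ffunP=> i; [have := E (true, i)|have := E (false, i)];
  by rewrite !ffunE /= ?ffunE /= mul1r mul0r ?addr0 ?add0r.
Qed.

Lemma star_blue_split u v : exists s, v = lay b u e1 s.
Proof.
have [h [hK Kh]] := kons_iso q_neq0 q_sq b u; pose v' := ap h v.
exists [ffun i => v' (tt, i)].
rewrite /star -[LHS]ap_id -Kh ap_comp -/v'; congr (ap _ _).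
by apply/ffunP=> -[[] i]; rewrite !ffunE /= mul1r.
Qed.

Lemma star_blue_inj u s t : lay b u e1 s = lay b u e1 t -> s = t.
Proof.
have [h [hK Kh]] := kons_iso q_neq0 q_sq b u.
rewrite /star => /(congr1 (ap h)); rewrite -!ap_comp hK !ap_id => /ffunP E.
by apply/ffunP=> i; have := E (tt, i); rewrite !ffunE /= !mul1r.
Qed.

(** * The action of E and K *)

Definition act u g (v : sp k (ix (W u))) : sp k (ix (W u)) :=
  op (sval (W u)) g v.

Lemma actD u g v w : @act u g (v + w) = act g v + act g w.
Proof. exact: linearD. Qed.
Lemma actZ u g t v : @act u g (t *: v) = t *: act g v.
Proof. exact: linearZ. Qed.
Lemma act0 u g : @act u g 0 = 0.
Proof. exact: linear0. Qed.

Lemma act_phi u v (f : hom (W u) (W v)) g w :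
  act g (ap f w) = ap f (act g w).
Proof. by apply/esym/rhomU. Qed.

Lemma act_star c u g a v : act g (lay c u a v) =
  ap (kons q_neq0 q_sq c u) (op (sval (tens (cob c) (W u))) g (tensv a v)).
Proof. by apply/esym/rhomU. Qed.

Lemma actE_star c u a v : act gE (lay c u a v) =
  lay c u (op (sval (cob c)) gE a) v +
  lay c u (op (sval (cob c)) gK a) (act gE v).
Proof. by rewrite act_star /= add_lfunE !tensfE id_lfunE apD. Qed.

Lemma actK_star c u a v : act gK (lay c u a v) =
  lay c u (op (sval (cob c)) gK a) (act gK v).
Proof. by rewrite act_star /= tensfE. Qed.

Lemma E_x u v : act gE (lay r u vx v) = q *: lay r u vx (act gE v).
Proof.
rewrite actE_star /= !bmap_bvec -[X in lay _ _ X v](scale0r vx).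
by rewrite !starZl scale0r add0r.
Qed.

Lemma E_y u v : act gE (lay r u vy v) =
  lay r u vx v + q^-1 *: lay r u vy (act gE v).
Proof. by rewrite actE_star /= !bmap_bvec starZl. Qed.

Lemma K_x u v : act gK (lay r u vx v) = q *: lay r u vx (act gK v).
Proof. by rewrite actK_star /= bmap_bvec starZl. Qed.

Lemma K_y u v : act gK (lay r u vy v) = q^-1 *: lay r u vy (act gK v).
Proof. by rewrite actK_star /= bmap_bvec starZl. Qed.

Lemma K_blue u v : act gK (lay b u e1 v) = - lay b u e1 (act gK v).
Proof.
by rewrite actK_star /= scale_lfunE id_lfunE expr1 starZl scaleN1r.
Qed.

Lemma K_nil v : @act [::] gK v = v.
Proof. by rewrite /act /= scale_lfunE id_lfunE expr0 scale1r. Qed.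

Lemma E_nil v : @act [::] gE v = 0.
Proof. by rewrite /act /= zero_lfunE. Qed.

(** * Faithfulness on red diagrams *)

Fixpoint xs n : sp k (ix (W (rn n))) :=
  if n is n'.+1 return sp k (ix (W (rn n))) then lay r (rn n') vx (xs n') else e1.

Lemma phi_cap_at i m : ap (Φ (cap_at q i m)) (xs m.+2) = 0.
Proof.
elim: i m => [|i IH] [|m]; rewrite ?cap_at0 ?cap_at_last ?cap_at0 ?phi_capxx //.
by rewrite cap_atS; apply: etrans (phi_star _ _ _) _; rewrite IH star0r.
Qed.

Lemma phi_capped m n (f : mor (rn m) (rn n)) : capped f -> ap (Φ f) (xs m) = 0.
Proof.
elim=> {m n f}.
- by move=> m n; rewrite phi_zero ap_zero.
- move=> m n t f g _ IHf _ IHg.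
  by rewrite phi_add phi_scale ap_add ap_scale IHf IHg scaler0 addr0.
- by move=> m n i f _; rewrite phi_comp ap_comp phi_cap_at ap0.
Qed.

(** Putting the y of the cup in front leaves an x before [x^m], so the y-component is the image of
    [x^(m+1)] under g, up to the factor -q. *)
Lemma phi_bend m n (g : mor (rn m.+1) (rn n)) :
  ap (Φ ((ι r ⊠ g) ⊚ (cup r ⊠ 1_(rn m)))) (xs m) =
  lay r (rn n) vx (ap (Φ g) (lay r (rn m) vy (xs m)))
  - q *: lay r (rn n) vy (ap (Φ g) (xs m.+1)).
Proof.
rewrite phi_comp ap_comp phi_cup apD apN apZ.
by congr (_ - _ *: _); apply: phi_star.
Qed.

(** Vanishing of the y-component makes g capped by induction, so by [capped_bend] the bent term is
    lined plus capped. The remaining lined term is a red line next to a morphism to which induction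
    applies again. The two uses have sources of length one more and one less, so m varies in the
    induction. *)
Lemma faithful_TL m n (f : mor (rn m) (rn n)) :
  TL f -> ap (Φ f) (xs m) = 0 -> capped f.
Proof.
elim: n m f => [|n IH] m f fT f0.
  have [a aC aE] := TL_inv0 fT.
  have Ea : ap (Φ a) (xs m) = 0.
    have := phi_capped aC; rewrite -[f - a]addrC phi_add -scaleN1r phi_scale.
    rewrite ap_add ap_scale f0 addr0 => /eqP.
    by rewrite scaler_eq0 oppr_eq0 oner_eq0 => /eqP.
  suff a0 : a = 0 by move: aC; rewrite a0 subr0.
  case: m {f fT f0 aC} a aE Ea => [|m] a // [t ->].
  rewrite phi_scale ap_scale phi_id ap_id => /eqP; rewrite scaler_eq0.
  move=> /orP[/eqP->|/eqP/ffunP/(_ tt)].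
    by rewrite scale0r.
  by rewrite !ffunE eqxx => /eqP; rewrite oner_eq0.
have [a [g [c [aL gT cC Ef]]]] := TL_inv fT.
have Ea : exists s, ap (Φ a) (xs m) = lay r (rn n) vx s.
  clear f fT f0 g gT c cC Ef; case: m a aL => [|m] a /=.
    by move=> ->; exists 0; rewrite phi_zero ap_zero star0r.
  by move=> [f' _ ->]; exists (ap (Φ f') (xs m)); rewrite -phi_star.
have {Ea} [s Ea] := Ea.
have g0 : ap (Φ g) (xs m.+1) = 0.
  move: f0; rewrite Ef !phi_add !ap_add (phi_capped cC) addr0 Ea phi_bend addrA.
  rewrite -starDr -starZr -starNr => /star_red_eq0[_ /eqP].
  by rewrite oppr_eq0 scaler_eq0 (negPf q_neq0) => /eqP.
have [a' [c' [a'L c'C Eb]]] := capped_bend (IH _ _ gT g0).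
rewrite Ef Eb -addrA; move: f0; rewrite Ef Eb !phi_add !ap_add.
rewrite (phi_capped cC) (phi_capped c'C) !addr0 -ap_add -phi_add => f0.
rewrite addrA addrA -[a + _ + _ + _]addrA.
apply: capped_add (capped_add c'C cC).
have : lined (a + a') by rewrite -[a]scale1r; apply: lined_lin.
clear f fT g gT c cC Ef s Ea g0 c' c'C Eb.
case: m a a' aL a'L f0 => [|m] a a' _ _ f0 /=.
  by move=> ->; apply: capped0.
move=> [f fT Ef]; rewrite Ef; apply: capped_line; apply: IH => //.
move: f0; rewrite Ef => /(etrans (esym (phi_star (c := r) f vx (xs m)))) f0.
by have [] := @star_red_eq0 (rn n) (ap (Φ f) (xs m)) 0; rewrite // star0r addr0.
Qed.

(** * Highest weight vectors and fullness on red diagrams *)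

Hypothesis q_root : forall n, (0 < n)%N -> q ^+ n != 1.
Hypothesis two_neq0 : 2%:R != 0 :> k.

(** The quantum integer [j]; it vanishes only if q^(2j) = 1. *)
Definition qint j := (q ^+ j - q ^- j) / (q - q^-1).

Lemma qint_neq0 j : (0 < j)%N -> qint j != 0.
Proof.
move=> j0; rewrite mulf_neq0 ?invr_neq0 // subr_eq0; apply/eqP => E.
have /eqP[] : q ^+ (j + j) != 1 by rewrite q_root // addn_gt0 j0.
by rewrite exprD {1}E mulVf // expf_neq0.
Qed.

Lemma E_iter_x u j v : iter j (@act (r :: u) gE) (lay r u vx v) =
  q ^+ j *: lay r u vx (iter j (@act u gE) v).
Proof.
elim: j v => [|j IH] v; first by rewrite expr0 scale1r.
by rewrite iterS IH actZ E_x scalerA -exprSr.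
Qed.

(** E turns a leading y into x once, and the contributions of the possible moments add up by q [j] +
    q^-j = [j+1]. *)
Lemma E_iter_y u j v : iter j.+1 (@act (r :: u) gE) (lay r u vy v) =
  qint j.+1 *: lay r u vx (iter j (@act u gE) v)
  + q ^- j.+1 *: lay r u vy (iter j.+1 (@act u gE) v).
Proof.
elim: j v => [|j IH] v.
  by rewrite /= E_y /qint !expr1 divff ?scale1r.
rewrite iterS IH actD !actZ E_x E_y scalerDr addrA !scalerA -scalerDl.
congr (_ *: _ + _ *: _); last by rewrite -invfM -exprSr.
rewrite /qint !exprS; have := expf_neq0 j q_neq0; set x := q ^+ j => x0.
have q_sq' : q * q - 1 != 0.
  apply: contra q_sq => /eqP E; rewrite -(mulrI_eq0 _ (mulfI q_neq0)).
  by rewrite mulrBr mulfV // E.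
by field; rewrite q_neq0 q_sq' x0.
Qed.

Lemma iterE0 u j : iter j (@act u gE) 0 = 0.
Proof. by elim: j => // j IH; rewrite iterS IH act0. Qed.

Lemma E_iterD u j v w : iter j (@act u gE) (v + w) =
  iter j (@act u gE) v + iter j (@act u gE) w.
Proof. by elim: j => // j IH; rewrite !iterS IH actD. Qed.

Lemma K_split u a c s : act gK (lay r u vx a + lay r u vy c) =
    s *: (lay r u vx a + lay r u vy c) ->
  act gK a = (q^-1 * s) *: a /\ act gK c = (q * s) *: c.
Proof.
rewrite actD K_x K_y scalerDr => /eqP; rewrite -subr_eq0 opprD addrACA.
rewrite -!starZr -!starNr -!starDr => /eqP/star_red_eq0[/eqP + /eqP].
rewrite !subr_eq0 => /eqP Ea /eqP Ec; split.
  by rewrite -scalerA -Ea scalerA mulVf ?scale1r.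
by rewrite -scalerA -Ec scalerA mulfV ?scale1r.
Qed.

(* By [E_iter_x] and [E_iter_y], [E^j (x⊗a + y⊗c)] has components
   [q^j E^j a + [j] E^(j-1) c] and [q^-j E^j c].  In the critical weight -j, one
   more application of E to the former gives [E^(j+1) a = 0], hence [a = 0]. *)
Lemma E_iter_inj n j d (v : sp k (ix (W (rn n)))) :
  act gK v = q ^- (j + d) *: v -> iter j (@act (rn n) gE) v = 0 -> v = 0.
Proof.
elim: n j d v => [|n IH] j d v Kv Ev.
  case: j Kv Ev => [|j] //; rewrite K_nil => /eqP.
  rewrite -subr_eq0 -[v in v - _]scale1r -scalerBl scaler_eq0 subr_eq0.
  case/orP=> [/eqP E|/eqP //].
  have /eqP[] : q ^+ (j.+1 + d) != 1 by rewrite q_root.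
  by rewrite -[LHS]invrK -E invr1.
case: j Kv Ev => [|j] // Kv Ev.
have [a [c Ev']] := star_red_split v; rewrite Ev' in Kv Ev *.
have [Ka Kc] := K_split Kv.
have {}Ka : act gK a = q ^- (j.+1 + d.+1) *: a by rewrite Ka addnS exprS invfM.
have {}Kc : act gK c = q ^- (j + d) *: c.
  by rewrite Kc addSn exprS invfM mulrA mulfV ?mul1r.
move: Ev; rewrite E_iterD E_iter_x E_iter_y addrA -!starZr -starDr => /star_red_eq0[E1 E2].
have Ec : iter j.+1 (@act (rn n) gE) c = 0.
  by move/eqP: E2; rewrite scaler_eq0 invr_eq0 expf_eq0 (negPf q_neq0) => /eqP.
suff [-> ->] : a = 0 /\ c = 0 by rewrite !star0r addr0.
case: d Kv Ka Kc => [|d] Kv Ka Kc.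
  have a0 : a = 0.
    apply: (IH j.+2 0); first by rewrite Ka addn1 addn0.
    move/(congr1 (act gE)): E1; rewrite actD !actZ -!iterS Ec scaler0 addr0 act0.
    by move/eqP; rewrite scaler_eq0 expf_eq0 (negPf q_neq0) andbF => /eqP.
  split=> //; apply: (IH j 0) => //.
  move: E1; rewrite a0 iterE0 scaler0 add0r => /eqP.
  by rewrite scaler_eq0 (negPf (qint_neq0 _)) // => /eqP.
have c0 : c = 0 by apply: (IH j.+1 d); rewrite // Kc addnS.
split=> //; apply: (IH j.+1 d.+2) => //.
move: E1; rewrite c0 iterE0 scaler0 addr0 => /eqP.
by rewrite scaler_eq0 expf_eq0 (negPf q_neq0) andbF => /eqP.
Qed.

(** The weights of [V_1^n] are quotients q^j / q^i; clearing denominators keeps the exponents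
    natural. *)
Lemma K_eigen n (v : sp k (ix (W (rn n)))) s :
  (forall i j, s * q ^+ i != q ^+ j) -> act gK v = s *: v -> v = 0.
Proof.
elim: n v s => [|n IH] v s sP Kv.
  move: Kv; rewrite K_nil => /eqP.
  rewrite -subr_eq0 -[v in v - _]scale1r -scalerBl scaler_eq0 subr_eq0.
  case/orP=> [/eqP E|/eqP //].
  by have := sP 0 0; rewrite -E mulr1 eqxx.
have [a [c Ev]] := star_red_split v; rewrite Ev in Kv *.
have [Ka Kc] := K_split Kv.
have -> : a = 0.
  apply: IH Ka => i j; apply: contra (sP i j.+1) => /eqP E.
  by rewrite exprS -E !mulrA mulfV ?mul1r.
have -> : c = 0.
  by apply: IH Kc => i j; have := sP i.+1 j; rewrite exprS mulrCA mulrA.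
by rewrite !star0r addr0.
Qed.

Lemma full_TL n m (v : sp k (ix (W (rn n)))) :
  act gK v = q ^+ m *: v -> act gE v = 0 ->
  exists f : mor (rn m) (rn n), ap (Φ f) (xs m) = v.
Proof.
elim: n m v => [|n IH] m v Kv Ev.
  case: m Kv => [|m] Kv.
    exists ((v tt : k) *: 1_[::]); rewrite phi_scale ap_scale phi_id ap_id.
    by rewrite /= [RHS]sp_unit.
  suff -> : v = 0 by exists 0; rewrite phi_zero ap_zero.
  move: Kv; rewrite K_nil => /eqP.
  rewrite -subr_eq0 -[v in v - _]scale1r -scalerBl scaler_eq0 subr_eq0.
  case/orP=> [/eqP E|/eqP //].
  by have := q_root (ltn0Sn m); rewrite -E eqxx.
have [a [c Ev']] := star_red_split v; rewrite Ev' in Kv Ev *.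
have [_ Kc] := K_split Kv.
have Ec : act gE c = 0.
  move: Ev; rewrite actD E_x E_y addrA -!starZr -starDr => /star_red_eq0[_ /eqP].
  by rewrite scaler_eq0 invr_eq0 (negPf q_neq0) => /eqP.
rewrite -exprS in Kc; have [g Eg] := IH m.+1 c Kc Ec.
(* The factor -q^-1 cancels the -q of [phi_bend], so the y-component becomes exactly c. *)
pose h : mor (rn m) (rn n.+1) := - q^-1 *: ((ι r ⊠ g) ⊚ (cup r ⊠ 1_(rn m))).
have Kxs l : act gK (xs l) = q ^+ l *: xs l.
  elim: l => [|l IHl]; first by rewrite K_nil scale1r.
  by rewrite K_x IHl starZr scalerA exprS.
have Exs l : act gE (xs l) = 0.
  elim: l => [|l IHl]; first by rewrite E_nil.
  by rewrite E_x IHl star0r scaler0.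
pose w := ap (Φ h) (xs m).
have Kw : act gK w = q ^+ m *: w by rewrite act_phi Kxs apZ.
have Ew : act gE w = 0 by rewrite act_phi Exs ap0.
have [s Ews] : exists s, w = lay r (rn n) vx s + lay r (rn n) vy c.
  exists (- q^-1 *: ap (Φ g) (lay r (rn m) vy (xs m))).
  rewrite /w /h phi_scale ap_scale phi_bend Eg scalerDr scalerN scalerA.
  by rewrite mulNr mulVf // scaleN1r opprK starZr.
have [a' Ea'] : exists a',
    lay r (rn n) vx a + lay r (rn n) vy c - w = lay r (rn n) vx a'.
  by exists (a - s); rewrite Ews opprD addrACA subrr addr0 starDr starNr.
have Ka' : act gK a' = (q^-1 * q ^+ m) *: a'.
  have [] // := @K_split (rn n) a' 0 (q ^+ m).
  rewrite star0r addr0 -Ea' actD Kv scalerBr; congr (_ + _).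
  by rewrite -(scaleN1r w) actZ Kw scaleN1r.
have {}Ea'0 : act gE a' = 0.
  have : act gE (lay r (rn n) vx a') = 0.
    by rewrite -Ea' -scaleN1r actD actZ Ew Ev scaler0 addr0.
  rewrite E_x -starZr => E0; have [] := @star_red_eq0 (rn n) (q *: act gE a') 0.
    by rewrite E0 star0r addr0.
  by move/eqP; rewrite scaler_eq0 (negPf q_neq0) => /eqP.
suff [f Ef] : exists f : mor (rn m) (rn n.+1),
    ap (Φ f) (xs m) = lay r (rn n) vx a'.
  by exists (f + h); rewrite phi_add ap_add Ef -Ea' subrK.
clear h w Kw Ew Ews Ea' Kv Ev Kc g Eg.
(* For m = 0 the vector [a'] has weight q^-1 and is killed by E, hence is zero; otherwise its weight
   is a natural power of q and induction applies. *)
case: m Ka' => [|m] Ka'.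
  exists 0; rewrite phi_zero ap_zero (@E_iter_inj n 1 0 a') ?star0r //.
  by rewrite Ka' mulr1 expr1.
have {}Ka' : act gK a' = q ^+ m *: a' by rewrite Ka' exprS mulrA mulVf // mul1r.
have [f Ef] := IH m a' Ka' Ea'0.
by exists (ι r ⊠ f); rewrite -Ef; apply: phi_star.
Qed.

Lemma q_exp_inj i j : q ^+ i = q ^+ j -> i = j.
Proof.
wlog ij : i j / (i <= j)%N.
  move=> H E; have [ij|/ltnW ij] := leqP i j; first exact: H.
  by apply/esym/H.
rewrite -(subnKC ij) exprD -[LHS]mulr1 => /(mulfI (expf_neq0 i q_neq0))/esym.
case: (j - i)%N => [|l] E; first by rewrite addn0.
by have := q_root (ltn0Sn l); rewrite E eqxx.
Qed.

(** Squaring forces i = j, and then 2 q^i = 0. *)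
Lemma q_expN i j : - q ^+ i != q ^+ j.
Proof.
apply/eqP => E; have Eij : (i * 2 = j * 2)%N.
  by apply: q_exp_inj; rewrite !exprM -E sqrrN.
move/eqP: Eij E; rewrite eqn_mul2r /= => /eqP -> /eqP.
rewrite eq_sym -subr_eq0 opprK -mulr2n -mulr_natr mulf_eq0 expf_eq0.
by rewrite (negPf q_neq0) (negPf two_neq0) andbF.
Qed.

(** * From red words to arbitrary words *)

(** K fixes the image of the unit and acts by -1 on the blue factor, so for p = true it would have
    eigenvalue -1 on [V_1^n], against [K_eigen]. *)
Lemma full_sorted p n (g : hom (W [::]) (W (sorted_word p n))) :
  exists f : mor [::] (sorted_word p n), Φ f = g.
Proof.
have Kg : act gK (ap g e1) = ap g e1 by rewrite act_phi K_nil.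
case: p g Kg => g Kg; last first.
  have [|f Ef] := @full_TL n 0 (ap g e1) (etrans Kg (esym (scale1r _))).
    by rewrite act_phi E_nil ap0.
  by exists f; apply: unit_ext.
exists 0; rewrite phi_zero; apply: unit_ext; rewrite ap_zero.
have [v Ev] := star_blue_split (ap g e1).
rewrite Ev (@K_eigen n v (-1)) ?star0r // => [i j|].
  by rewrite mulN1r q_expN.
have := Kg; rewrite Ev K_blue -starNr => /star_blue_inj E.
by rewrite scaleN1r -[in RHS]E opprK.
Qed.

Lemma widen_faithful p n (t : mor (rn 0) (rn n)) :
  TL t -> Φ (widen false p t) = 0 -> widen false p t = 0.
Proof.
case: p => //= tT t0; apply: capped_eq0.
by apply: (faithful_TL tT); rewrite t0 ap_zero.
Qed.

Lemma faithful_nil w (f : mor [::] w) : Φ f = 0 -> f = 0.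
Proof.
move=> f0; have [t tT E] := sort_blue_TL f.
have [g [gK _]] := sort_blue_invertible q w.
rewrite -[f]mor_comp1m -gK -mor_compA E widen_faithful ?comp0r //.
by rewrite -E phi_comp f0; apply: ap_ext => v; rewrite ap_comp !ap_zero ap0.
Qed.

Lemma full_nil w (g : hom (W [::]) (W w)) : exists f : mor [::] w, Φ f = g.
Proof.
have [h [hK _]] := sort_blue_invertible q w.
have [f Ef] := full_sorted (Φ (sort_blue q w) ∘ g).
exists (h ⊚ f); rewrite phi_comp Ef compA -phi_comp hK phi_id.
exact: comp1m.
Qed.

Lemma bendK c u w (f : mor (c :: u) w) :
  (cap c ⊠ 1_w) ⊚ (ι c ⊠ ((ι c ⊠ f) ⊚ (cup c ⊠ 1_u))) = f.
Proof.
rewrite tens_idcomp mor_compA cap_nat -mor_compA.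
by rewrite (zigzag_l q c u) mor_compm1.
Qed.

Lemma phi_faithful u w (f : mor u w) : Φ f = 0 -> f = 0.
Proof.
elim: u w f => [|c u IH] w f f0; first exact: faithful_nil.
rewrite -(bendK f) [X in ι c ⊠ X]IH ?tens0r ?comp0r //.
rewrite phi_comp (_ : Φ (ι c ⊠ f) = 0).
  by apply: ap_ext => v; rewrite ap_comp !ap_zero.
apply: star_ext => i v; rewrite ap_zero.
by apply: etrans (phi_star _ _ _) _; rewrite f0 ap_zero star0r.
Qed.

(** Tensoring g with the identity on the target side; g need not come from a diagram yet. *)
Lemma whisker_ex c u w (g : hom (W u) (W w)) :
  exists h : hom (W (c :: u)) (W (c :: w)),
    forall a v, ap h (lay c u a v) = lay c w a (ap g v).
Proof.
have [h [hK _]] := kons_iso q_neq0 q_sq c u.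
exists (kons q_neq0 q_sq c w ∘ (idm (cob c) ⊗ g) ∘ h) => a v.
by rewrite /star !ap_comp -(ap_comp h) hK ap_id ap_tens ap_id.
Qed.

Lemma star_star_ext c d u (a : D) (f g : hom (W (c :: d :: u)) a) :
  (forall i j v, ap f (lay c (d :: u) i (lay d u j v)) =
                 ap g (lay c (d :: u) i (lay d u j v))) -> f = g.
Proof.
move=> fg; apply: (iso_epi (merge_iso q_neq0 q_sq [:: c; d] u)).
apply/rhom_eqP/lfun_bvecP => -[[i j] l]; rewrite !bvec_pair.
by have := fg (bvec k i) (bvec k j) (bvec k l); rewrite -merge2E -!ap_comp.
Qed.

(** Bending the first source letter over to the target shortens the source; the preimage found there
    is bent back by the cap. *)
Lemma phi_full u w (g : hom (W u) (W w)) : exists f : mor u w, Φ f = g.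
Proof.
elim: u w g => [|c u IH] w g; first exact: full_nil.
have [g1 Eg1] := whisker_ex c g.
have [h Eh] := IH _ (g1 ∘ Φ (cup c ⊠ 1_u)).
exists ((cap c ⊠ 1_w) ⊚ (ι c ⊠ h)); rewrite phi_comp.
have [g2 Eg2] := whisker_ex c g1.
have -> : Φ (ι c ⊠ h) = g2 ∘ Φ (ι c ⊠ (cup c ⊠ 1_u)).
  apply: star_ext => i v; rewrite ap_comp; apply: etrans (phi_star _ _ _) _.
  rewrite Eh ap_comp -Eg2; congr (ap _ _); apply/esym/phi_star.
rewrite compA (_ : Φ (cap c ⊠ 1_w) ∘ g2 = g ∘ Φ (cap c ⊠ 1_(c :: u))).
  by rewrite -compA -phi_comp (zigzag_l q c u) phi_id compm1.
apply: star_star_ext => i j v; rewrite !ap_comp Eg2 Eg1.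
by rewrite !phi_cap_star apZ.
Qed.

Lemma Phi_dense (d : D) :
  exists u (f : hom (W u) d), is_iso f.
Proof.
case: d => d dP.
(* Stated among all representations, so that the induction over [generated] does not carry the
   membership proof in its objects. *)
suff [u [f fI]] : exists u (f : @hom k (repMonCat q_neq0) (sval (W u)) d),
    is_iso f.
  by exists u, f; case: fI => g gP; exists g.
elim: dP => {d}.
- by exists [:: r], (@rid k q _); exact: (@is_iso_id k (repMonCat q_neq0)).
- by exists [:: b], (@rid k q _); exact: (@is_iso_id k (repMonCat q_neq0)).
- by exists [::], (@rid k q _); exact: (@is_iso_id k (repMonCat q_neq0)).
move=> V V' _ [u [f fI]] _ [u' [f' f'I]].
have [h [hK Kh]] := merge_iso q_neq0 q_sq u u'.
exists (u ++ u'), (@comp k (repMonCat q_neq0) _ _ _ (tensm f f') h).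
apply: is_iso_comp; first exact: is_iso_tens.
by exists (merge q_neq0 q_sq u u').
Qed.

Lemma Phi_equivalence : is_equivalence (Phi q_neq0 q_sq).
Proof.
apply: fully_faithful_equivalence => [u v f g E|u v g|d].
- apply/eqP; rewrite -subr_eq0 -scaleN1r addrC; apply/eqP/phi_faithful.
  rewrite phi_add phi_scale; apply/eqP; rewrite addrC scaleN1r subr_eq0.
  by apply/eqP.
- exact: phi_full.
- exact: Phi_dense.
Qed.

End Faithful.

Section GroundField.
Variable R : realType.

Lemma qvar_root n : (0 < n)%N -> qvar R ^+ n != 1.
Proof.
case: n => // n _; rewrite -tofracXn -tofrac1 tofrac_eq.
apply/eqP => /(congr1 (fun p : {poly _} => size p)).
by rewrite size_polyXn size_poly1.
Qed.

Lemma Cq_two : 2%:R != 0 :> Cq R.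
Proof.
by rewrite -tofrac1 -tofracMn tofrac_eq0 -polyC_natr polyC_eq0 pnatr_eq0.
Qed.

End GroundField.

Theorem theorem4p6 (R : realType) :
  exists Phi : linMonFunctor (presMonCat (qvar R))
                             (genMonCat (qvar_neq0 R) (qvar_sq R)),
    extends_generators Phi /\ is_equivalence Phi.
Proof.
exists (Phi (qvar_neq0 R) (qvar_sq R)); split; first exact: Phi_extends.
exact: Phi_equivalence (@qvar_root R) (Cq_two R).
Qed.
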